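(* Let $\phi=\tilde p/p$ be a rational inner function on $\mathbb{D}^2$ with $\deg p=(m,n)$, and let $0<\mathfrak p<\infty$. If $\frac{\partial\phi}{\partial z_1}\in H^{\mathfrak p}(\mathbb{D}^2)$, then $\phi\in\mathfrak{D}_{(\mathfrak p,0)}$; and if $\frac{\partial\phi}{\partial z_2}\in H^{\mathfrak p}(\mathbb{D}^2)$, then $\phi\in\mathfrak{D}_{(0,\mathfrak p)}$.
   Context: $\phi=\tilde p/p$ where $p\in\mathbb{C}[z_1,z_2]$ has bidegree $(m,n)$, no zeros in $\mathbb{D}^2$, is atoral, and $\tilde p(z)=z_1^mz_2^n\overline{p(1/\bar z_1,1/\bar z_2)}$. $H^{\mathfrak p}(\mathbb{D}^2)$: holomorphic $f$ with $\sup_{0<r<1}\frac1{4\pi^2}\int_{\mathbb{T}^2}|f(r\zeta)|^{\mathfrak p}|d\zeta|<\infty$. For $\vec\alpha=(\alpha_1,\alpha_2)\in\mathbb{R}^2$, the anisotropic Dirichlet-type space $\mathfrak D_{\vec\alpha}$ consists of holomorphic $f(z)=\sum_{k,\ell\ge0}a_{k\ell}z_1^kz_2^\ell$ on $\mathbb{D}^2$ with $\|f\|^2_{\mathfrak D_{\vec\alpha}}=\sum_{k,\ell\ge0}(k+1)^{\alpha_1}(\ell+1)^{\alpha_2}|a_{k\ell}|^2<\infty$. *)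

(* Defs.v *)
From Stdlib Require Import Reals Lra ClassicalEpsilon.
Open Scope R_scope.

Definition CC := (R * R)%type.
Definition Cre (z : CC) : R := fst z.
Definition Cim (z : CC) : R := snd z.
Definition RtoC (x : R) : CC := (x, 0).
Definition C0 : CC := (0, 0).
Definition C1 : CC := (1, 0).
Definition Cadd (z w : CC) : CC := (fst z + fst w, snd z + snd w).
Definition Copp (z : CC) : CC := (- fst z, - snd z).
Definition Csub (z w : CC) : CC := Cadd z (Copp w).
Definition Cmul (z w : CC) : CC :=
  (fst z * fst w - snd z * snd w, fst z * snd w + snd z * fst w).
Definition Cconj (z : CC) : CC := (fst z, - snd z).
Definition Cinv (z : CC) : CC :=
  (fst z / (fst z ^ 2 + snd z ^ 2), - snd z / (fst z ^ 2 + snd z ^ 2)).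
Definition Cdiv (z w : CC) : CC := Cmul z (Cinv w).
Definition Cnorm (z : CC) : R := sqrt (fst z ^ 2 + snd z ^ 2).
Fixpoint Cpow (z : CC) (k : nat) : CC :=
  match k with O => C1 | S k' => Cmul z (Cpow z k') end.
Definition polar (r t : R) : CC := (r * cos t, r * sin t).

Fixpoint Csum (f : nat -> CC) (N : nat) : CC :=
  match N with O => f O | S N' => Cadd (Csum f N') (f N) end.

Definition inD (z : CC) : Prop := Cnorm z < 1.
Definition inD2 (z1 z2 : CC) : Prop := inD z1 /\ inD z2.

Definition peval (m n : nat) (c : nat -> nat -> CC) (z1 z2 : CC) : CC :=
  Csum (fun k => Csum (fun l => Cmul (c k l) (Cmul (Cpow z1 k) (Cpow z2 l))) n) m.

Definition bideg (m n : nat) (c : nat -> nat -> CC) : Prop :=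
  (forall k l, (m < k)%nat \/ (n < l)%nat -> c k l = C0) /\
  (exists l, c m l <> C0) /\ (exists k, c k n <> C0).

(* coefficients of the reflection  p~(z) = z1^m z2^n conj(p(1/conj z1, 1/conj z2)) *)
Definition refl_coef (m n : nat) (c : nat -> nat -> CC) : nat -> nat -> CC :=
  fun k l => if andb (Nat.leb k m) (Nat.leb l n)
             then Cconj (c (m - k)%nat (n - l)%nat) else C0.

Definition is_poly (f : CC -> CC -> CC) : Prop :=
  exists (a b : nat) (d : nat -> nat -> CC), forall z1 z2, f z1 z2 = peval a b d z1 z2.

Definition atoral (m n : nat) (c : nat -> nat -> CC) : Prop :=
  forall q : CC -> CC -> CC, is_poly q ->
    (exists r, is_poly r /\ forall z1 z2, peval m n c z1 z2 = Cmul (q z1 z2) (r z1 z2)) ->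
    (exists r, is_poly r /\
       forall z1 z2, peval m n (refl_coef m n c) z1 z2 = Cmul (q z1 z2) (r z1 z2)) ->
    exists a, forall z1 z2, q z1 z2 = a.

Definition rif (m n : nat) (c : nat -> nat -> CC) (z1 z2 : CC) : CC :=
  Cdiv (peval m n (refl_coef m n c) z1 z2) (peval m n c z1 z2).

Definition C_deriv_at (f : CC -> CC) (z d : CC) : Prop :=
  forall eps, 0 < eps -> exists delta, 0 < delta /\
    forall h, 0 < Cnorm h < delta ->
      Cnorm (Csub (Cdiv (Csub (f (Cadd z h)) (f z)) h) d) < eps.

Definition is_dz1 (f g : CC -> CC -> CC) : Prop :=
  forall z1 z2, inD2 z1 z2 -> C_deriv_at (fun w => f w z2) z1 (g z1 z2).
Definition is_dz2 (f g : CC -> CC -> CC) : Prop :=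
  forall z1 z2, inD2 z1 z2 -> C_deriv_at (fun w => f z1 w) z2 (g z1 z2).

(* holomorphic on D^2 (complex differentiable in each variable separately; Hartogs) *)
Definition holo_D2 (f : CC -> CC -> CC) : Prop :=
  forall z1 z2, inD2 z1 z2 ->
    (exists d, C_deriv_at (fun w => f w z2) z1 d) /\
    (exists d, C_deriv_at (fun w => f z1 w) z2 d).

(* Riemann integral of f on [a,b] (0 if f not Riemann integrable);
   the value does not depend on the integrability proof. *)
Definition RInt (f : R -> R) (a b : R) : R :=
  match excluded_middle_informative (inhabited (Riemann_integrable f a b)) with
  | left H => RiemannInt (epsilon H (fun _ => True))
  | right _ => 0
  end.

(* x^p for x >= 0, p > 0, with 0^p = 0 *)
Definition powp (x p : R) : R := if Rlt_dec 0 x then Rpower x p else 0.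

Definition in_Hp (p : R) (f : CC -> CC -> CC) : Prop :=
  holo_D2 f /\
  exists M, forall r, 0 < r < 1 ->
    / (4 * PI ^ 2) *
      RInt (fun t1 => RInt (fun t2 => powp (Cnorm (f (polar r t1) (polar r t2))) p)
                          0 (2 * PI)) 0 (2 * PI) <= M.

Definition weight (al1 al2 : R) (k l : nat) : R :=
  Rpower (INR k + 1) al1 * Rpower (INR l + 1) al2.

Definition Rsum2 (f : nat -> nat -> R) (N : nat) : R :=
  sum_f_R0 (fun k => sum_f_R0 (fun l => f k l) N) N.
Definition Csum2 (f : nat -> nat -> CC) (N : nat) : CC :=
  Csum (fun k => Csum (fun l => f k l) N) N.

(* f(z) = sum_{k,l} a_kl z1^k z2^l on D^2 (absolutely convergent double power
   series, i.e. a_kl are the Taylor coefficients of f), and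
   sum (k+1)^al1 (l+1)^al2 |a_kl|^2 < oo *)
Definition in_Dir (al1 al2 : R) (f : CC -> CC -> CC) : Prop :=
  exists a : nat -> nat -> CC,
    (forall z1 z2, inD2 z1 z2 ->
       (exists B, forall N,
          Rsum2 (fun k l => Cnorm (a k l) * Cnorm z1 ^ k * Cnorm z2 ^ l) N <= B) /\
       (forall eps, 0 < eps -> exists N0, forall N, (N0 <= N)%nat ->
          Cnorm (Csub (Csum2 (fun k l => Cmul (a k l) (Cmul (Cpow z1 k) (Cpow z2 l))) N)
                      (f z1 z2)) < eps)) /\
    (exists B, forall N, Rsum2 (fun k l => weight al1 al2 k l * Cnorm (a k l) ^ 2) N <= B).

(* Main.v *)
(** For a fixed unimodular [z2] the function [phi(_, z2)] is a finite Blaschke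
    product of degree at most [m]: the atoral hypothesis prevents [p(_, z2)] from
    vanishing identically, and zeros on the circle cancel.  Let [d] be the distance
    from its zero set to the circle.

    - Upper bound.  A Blaschke factor is bounded by 3 on the disc of radius
      [1 + d/2], and an l^2 version of this on Taylor coefficients [b_k] gives
      [sum (k+1) |b_k|^2 (1+d/2)^(2k) <= C_m], hence
      [sum (k+1)^p |b_k|^2 <= C d^(1-p)] for [p > 1], and [<= C] for [p <= 1].
    - Lower bound.  The product vanishes at a point at distance [d] from the circle
      and has modulus at least 1/2 at a point nearby, still at distance comparable
      to [d], so its derivative is at least of order [1/d] in between; point
      evaluation in [H^p] then bounds the mean of [|dphi/dz1|^p] below by [c d^(1-p)].

    The two bounds are only compared at points [z2] of the open disc close to the
    circle, where finitely many Taylor coefficients and the two values of [phi] have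
    moved little; compactness of the circle makes the comparison uniform.
    Integrating in [z2] and letting the radius tend to 1 gives the theorem. *)

Require Import Defs.
From Stdlib Require Import Reals Lra Lia List FunctionalExtensionality Classical ClassicalEpsilon.
From mathcomp Require ssreflect ssrfun ssrbool eqtype ssrnat fintype bigop ssralg Rstruct complex.
From Coquelicot Require Import Coquelicot.
Open Scope R_scope.

(** The order of the constants matters. The factor in the comparison of the two bounds depends on
    [m] and [p] only, while the width of the collar of the circle where the comparison holds depends
    on the truncation order [N]. So [N] is fixed, the radius tends to 1, and the bound that results
    is the same for all [N].

    The derivative is known only through its means at radii below 1, and [phi] may be discontinuous
    at boundary zeros of [p]. Taylor coefficients in [z1], and values of [phi] at interior [z1], are
    however continuous in [z2] up to the circle. This is why the comparison passes through these two
    quantities.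

    The work in one variable is done on coefficient sequences: with [p(_, z2) = q0 prod (1 - b z)],
    each step multiplies or divides by one linear factor, which is a two-term recursion, and the
    [l^2] bounds are sums of an inequality between neighbouring coefficients. Integrals occur only
    on circles of radius below 1, and power series carry geometric error bounds, so that passages to
    the limit become inequalities between partial sums. *)

Fixpoint csum (f : nat -> C) (N : nat) : C :=
  match N with O => f O | S N' => Cplus (csum f N') (f N) end.

(** * Roots of monic complex polynomials *)

Module ClosedFieldRoot.
Import ssreflect ssrfun ssrbool eqtype ssrnat fintype bigop ssralg GRing.Theory Rstruct complex.

Definition to_complex (z : C) : complex R := Complex (fst z) (snd z).
Definition of_complex (z : complex R) : C := let: Complex a b := z in (a, b).

Lemma of_complexM (x y : complex R) :
  of_complex (x * y)%R = Cmult (of_complex x) (of_complex y).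
Proof. by case: x => a b; case: y => c d. Qed.

Lemma of_complexD (x y : complex R) :
  of_complex (x + y)%R = Cplus (of_complex x) (of_complex y).
Proof. by case: x => a b; case: y => c d. Qed.

Lemma of_complexX (x : complex R) n : of_complex (x ^+ n)%R = Cpow (of_complex x) n.
Proof. by elim: n => [|n IH] //; rewrite exprS of_complexM IH. Qed.

(** Algebraic closedness, transported from [complex R] along [of_complex]. The shape, top power
    equal to the lower terms, is that of [solve_monicpoly]. *)
Lemma monic_root (n : nat) (c : nat -> C) :
  exists x : C, Cpow x (S n) = csum (fun i => Cmult (c i) (Cpow x i)) n.
Proof.
have [x Hx] := solve_monicpoly (fun i => to_complex (c i)) (ltn0Sn n).
exists (of_complex x); rewrite -of_complexX Hx {Hx}.
elim: n => [|n IH].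
- rewrite big_ord_recr big_ord0 of_complexD of_complexM of_complexX.
  have -> : of_complex (to_complex (c 0%N)) = c 0%N by case: (c _).
  exact: Cplus_0_l.
- rewrite big_ord_recr of_complexD IH of_complexM of_complexX.
  by congr Cplus => /=; case: (c _).
Qed.
End ClosedFieldRoot.

Set Bullet Behavior "Strict Subproofs".

(** * Finite complex sums *)

Lemma csum_S (f : nat -> C) N : csum f (S N) = (csum f N + f (S N))%C.
Proof. reflexivity. Qed.

Lemma csum_ext (f g : nat -> C) N :
  (forall k, (k <= N)%nat -> f k = g k) -> csum f N = csum g N.
Proof.
  induction N as [|N IH]; intros H; [apply H; lia|].
  rewrite !csum_S, IH, H; auto.
Qed.

Lemma csum_plus (f g : nat -> C) N :
  csum (fun k => f k + g k)%C N = (csum f N + csum g N)%C.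
Proof. induction N as [|N IH]; [reflexivity|]; rewrite !csum_S, IH; ring. Qed.

Lemma csum_scal (a : C) (f : nat -> C) N :
  csum (fun k => a * f k)%C N = (a * csum f N)%C.
Proof. induction N as [|N IH]; [reflexivity|]; rewrite !csum_S, IH; ring. Qed.

Lemma csum_scal_r (a : C) (f : nat -> C) N :
  csum (fun k => f k * a)%C N = (csum f N * a)%C.
Proof. induction N as [|N IH]; [reflexivity|]; rewrite !csum_S, IH; ring. Qed.

Lemma csum_zero (f : nat -> C) N :
  (forall k, (k <= N)%nat -> f k = 0%C) -> csum f N = 0%C.
Proof.
  induction N as [|N IH]; intros H; [apply H; lia|].
  rewrite csum_S, IH, H; auto; ring.
Qed.

Lemma csum_Sl (f : nat -> C) N : csum f (S N) = (f O + csum (fun k => f (S k)) N)%C.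
Proof.
  induction N as [|N IH]; [reflexivity|].
  rewrite (csum_S f), IH, (csum_S (fun k => f (S k))); ring.
Qed.

Lemma csum_extend (f : nat -> C) M N : (M <= N)%nat ->
  (forall k, (M < k)%nat -> f k = 0%C) -> csum f N = csum f M.
Proof.
  intros H Hf; induction H as [|N H IH]; [reflexivity|].
  rewrite csum_S, IH, Hf by lia; ring.
Qed.

Lemma csum_rev (f : nat -> C) N : csum (fun k => f (N - k)%nat) N = csum f N.
Proof.
  revert f; induction N as [|N IH]; intros f; [reflexivity|].
  rewrite csum_Sl, (csum_S f), <- (IH f).
  replace (S N - 0)%nat with (S N) by lia.
  rewrite Cplus_comm; f_equal.
Qed.

Lemma csum_exchange (f : nat -> nat -> C) M N :
  csum (fun k => csum (f k) N) M = csum (fun l => csum (fun k => f k l) M) N.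
Proof.
  induction M as [|M IH]; [reflexivity|].
  rewrite csum_S, IH, <- csum_plus; reflexivity.
Qed.

Lemma csum_conj (f : nat -> C) N :
  Cconj (csum f N) = csum (fun k => Cconj (f k)) N.
Proof.
  induction N as [|N IH]; [reflexivity|].
  rewrite !csum_S, <- IH; apply Cplus_conj.
Qed.

Lemma csum_mod (f : nat -> C) N :
  Cmod (csum f N) <= sum_f_R0 (fun k => Cmod (f k)) N.
Proof.
  induction N as [|N IH]; [apply Rle_refl|].
  rewrite csum_S; simpl; eapply Rle_trans; [apply Cmod_triangle|]; lra.
Qed.

Lemma Rsum_exchange (f : nat -> nat -> R) M N :
  sum_f_R0 (fun k => sum_f_R0 (f k) N) M
  = sum_f_R0 (fun l => sum_f_R0 (fun k => f k l) M) N.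
Proof.
  induction M as [|M IH]; [reflexivity|].
  simpl; rewrite IH, <- plus_sum; reflexivity.
Qed.

Lemma sum_nonneg (f : nat -> R) N : (forall k, 0 <= f k) -> 0 <= sum_f_R0 f N.
Proof. intros H; apply cond_pos_sum; assumption. Qed.

Lemma Cpow_S (z : C) k : Cpow z (S k) = (z * Cpow z k)%C.
Proof. reflexivity. Qed.

(** * Formal power series *)

(* Multiplication by [1 - b z], its inverse, and multiplication by [z - conj b]. *)
Definition mul_lin (b : C) (f : nat -> C) (k : nat) : C :=
  match k with O => f O | S j => (f (S j) - b * f j)%C end.

Fixpoint div_lin (b : C) (f : nat -> C) (k : nat) : C :=
  match k with O => f O | S j => (f (S j) + b * div_lin b f j)%C end.

Definition mul_refl (b : C) (f : nat -> C) (k : nat) : C :=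
  match k with
  | O => (- (Cconj b * f O))%C
  | S j => (f j - Cconj b * f (S j))%C
  end.

(** Multiplication by [(z - conj b) / (1 - b z)], the Blaschke factor with zero [conj b] when
    [|b| < 1]. *)
Definition blaschke (b : C) (f : nat -> C) : nat -> C := mul_refl b (div_lin b f).

Definition one : nat -> C := fun k => match k with O => 1%C | S _ => 0%C end.

Definition scale (a : C) (f : nat -> C) : nat -> C := fun k => (a * f k)%C.

Definition mul_lins (bs : list C) f := fold_right mul_lin f bs.
Definition div_lins (bs : list C) f := fold_right div_lin f bs.
Definition mul_refls (bs : list C) f := fold_right mul_refl f bs.
Definition blaschkes (bs : list C) f := fold_right blaschke f bs.

Lemma mul_div_lin b f : mul_lin b (div_lin b f) = f.
Proof. apply functional_extensionality; intros [|k]; simpl; ring. Qed.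

Lemma div_mul_lin b f : div_lin b (mul_lin b f) = f.
Proof.
  apply functional_extensionality; intros k.
  induction k as [|k IH]; [reflexivity|].
  simpl; rewrite IH; simpl; ring.
Qed.

Lemma mul_refl_lin_comm a b f : mul_refl a (mul_lin b f) = mul_lin b (mul_refl a f).
Proof. apply functional_extensionality; intros [|[|k]]; simpl; ring. Qed.

Lemma mul_lin_comm a b f : mul_lin a (mul_lin b f) = mul_lin b (mul_lin a f).
Proof. apply functional_extensionality; intros [|[|k]]; simpl; ring. Qed.

(** Commuting with [mul_lin b] passes to its inverse [div_lin b] by cancelling on both sides. *)
Lemma mul_refl_div_comm a b f : mul_refl a (div_lin b f) = div_lin b (mul_refl a f).
Proof.
  rewrite <- (div_mul_lin b (mul_refl a (div_lin b f))), <- mul_refl_lin_comm,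
    mul_div_lin; reflexivity.
Qed.

Lemma div_lin_comm a b f : div_lin a (div_lin b f) = div_lin b (div_lin a f).
Proof.
  rewrite <- (div_mul_lin b (div_lin a (div_lin b f))).
  f_equal.
  rewrite <- (div_mul_lin a (mul_lin b _)), mul_lin_comm, mul_div_lin, mul_div_lin.
  reflexivity.
Qed.

Lemma div_lin_blaschke_comm a b f :
  div_lin a (blaschke b f) = blaschke b (div_lin a f).
Proof. unfold blaschke; rewrite <- mul_refl_div_comm, div_lin_comm; reflexivity. Qed.

Lemma div_lin_blaschkes_comm a bs f :
  div_lin a (blaschkes bs f) = blaschkes bs (div_lin a f).
Proof.
  induction bs as [|b bs IH]; [reflexivity|].
  simpl; rewrite div_lin_blaschke_comm, IH; reflexivity.
Qed.

Lemma div_lins_refl_comm bs a f :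
  div_lins bs (mul_refl a f) = mul_refl a (div_lins bs f).
Proof.
  induction bs as [|b bs IH]; [reflexivity|].
  simpl; rewrite IH, mul_refl_div_comm; reflexivity.
Qed.

Lemma div_lins_lin_comm bs a f :
  div_lins bs (div_lin a f) = div_lin a (div_lins bs f).
Proof.
  induction bs as [|b bs IH]; [reflexivity|].
  simpl; rewrite IH, div_lin_comm; reflexivity.
Qed.

(** The commutation rules turn a quotient of products into a product of Blaschke factors. *)
Lemma div_lins_refls bs f : div_lins bs (mul_refls bs f) = blaschkes bs f.
Proof.
  induction bs as [|b bs IH]; [reflexivity|].
  simpl; rewrite div_lins_refl_comm, IH.
  unfold blaschke; rewrite mul_refl_div_comm; reflexivity.
Qed.

Lemma div_mul_lins bs f : div_lins bs (mul_lins bs f) = f.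
Proof.
  revert f; induction bs as [|b bs IH]; intros f; [reflexivity|].
  simpl; rewrite <- div_lins_lin_comm, div_mul_lin; apply IH.
Qed.

Lemma mul_lin_scale a b f : mul_lin b (scale a f) = scale a (mul_lin b f).
Proof. apply functional_extensionality; intros [|k]; unfold scale; simpl; ring. Qed.

Lemma div_lin_scale a b f : div_lin b (scale a f) = scale a (div_lin b f).
Proof.
  rewrite <- (div_mul_lin b (scale a (div_lin b f))), mul_lin_scale, mul_div_lin.
  reflexivity.
Qed.

Lemma div_lins_scale a bs f : div_lins bs (scale a f) = scale a (div_lins bs f).
Proof.
  induction bs as [|b bs IH]; [reflexivity|].
  simpl; rewrite IH, div_lin_scale; reflexivity.
Qed.

Lemma scale_scale a b f : scale a (scale b f) = scale (a * b)%C f.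
Proof. apply functional_extensionality; intros k; unfold scale; ring. Qed.

Definition supp (d : nat) (f : nat -> C) := forall k, (d < k)%nat -> f k = 0%C.

Lemma supp_one : supp 0 one.
Proof. intros [|k] H; [lia|reflexivity]. Qed.

Lemma supp_mul_lin d b f : supp d f -> supp (S d) (mul_lin b f).
Proof. intros H [|k] Hk; [lia|]; simpl; rewrite !H by lia; ring. Qed.

Lemma supp_mul_lins bs d f : supp d f -> supp (length bs + d) (mul_lins bs f).
Proof. intros H; induction bs as [|b bs IH]; [exact H|]; apply supp_mul_lin, IH. Qed.

Definition psum (f : nat -> C) (N : nat) (z : C) : C :=
  csum (fun k => f k * Cpow z k)%C N.

Lemma psum_S f N z : psum f (S N) z = (psum f N z + f (S N) * Cpow z (S N))%C.
Proof. reflexivity. Qed.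

Lemma psum_scale a f N z : psum (scale a f) N z = (a * psum f N z)%C.
Proof.
  unfold psum, scale; rewrite <- csum_scal; apply csum_ext; intros; ring.
Qed.

(** Truncation is not multiplicative: the factor [b z] raises degrees by one, hence meets the
    partial sum of order one less. *)
Lemma psum_mul_lin b f N z :
  psum (mul_lin b f) (S N) z = (psum f (S N) z - b * z * psum f N z)%C.
Proof.
  induction N as [|N IH].
  - unfold psum; rewrite !csum_S; simpl; ring.
  - rewrite psum_S, IH, (psum_S f (S N)), (psum_S f N).
    change (mul_lin b f (S (S N))) with (f (S (S N)) - b * f (S N))%C.
    rewrite (Cpow_S z (S N)); ring.
Qed.

Lemma psum_div_lin b f N z :
  psum (div_lin b f) (S N) z = (psum f (S N) z + b * z * psum (div_lin b f) N z)%C.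
Proof.
  rewrite <- (mul_div_lin b f) at 2.
  rewrite psum_mul_lin; ring.
Qed.

Lemma psum_supp d f N z : supp d f -> (d <= N)%nat -> psum f N z = psum f d z.
Proof.
  intros H HN; apply csum_extend; auto.
  intros k Hk; rewrite H; auto; ring.
Qed.

Definition lin_prod (bs : list C) (z : C) : C :=
  fold_right (fun b v => ((1 - b * z) * v)%C) 1%C bs.

Lemma psum_mul_lins bs d f z : supp d f ->
  psum (mul_lins bs f) (length bs + d) z = (lin_prod bs z * psum f d z)%C.
Proof.
  intros H; induction bs as [|b bs IH]; [simpl; ring|].
  assert (Hs := supp_mul_lins bs d f H).
  change (psum (mul_lin b (mul_lins bs f)) (S (length bs + d)) z
    = ((1 - b * z) * lin_prod bs z * psum f d z)%C).
  rewrite psum_mul_lin, (psum_supp _ _ (S _) z Hs) by lia.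
  rewrite IH; ring.
Qed.

(* The [b]s are the reciprocals of the roots, zero standing for a root at
   infinity, so that there are exactly [m] of them. *)
Lemma factor_lins m (q : nat -> C) : q O <> 0%C -> supp m q ->
  exists bs, length bs = m /\ q = scale (q O) (mul_lins bs one).
Proof.
  revert q; induction m as [|m IH]; intros q H0 Hs.
  - exists nil; split; [reflexivity|].
    apply functional_extensionality; intros [|k]; unfold scale; simpl; [ring|].
    rewrite Hs by lia; ring.
  (* [b] is a root of the reversed polynomial, whose leading coefficient [q O] is nonzero whatever
     the true degree of [q]. Its equation says that coefficient [S m] of [q / (1 - b z)] vanishes;
     the recursion of [div_lin] then kills all later ones. *)
  - destruct (ClosedFieldRoot.monic_root m (fun i => - (q (S m - i)%nat / q O))%C)
      as [b Hb].
    assert (E : forall k, div_lin b q k = csum (fun j => q (k - j)%nat * Cpow b j)%C k).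
    { induction k as [|k IHk].
      - unfold csum; simpl; ring.
      - rewrite csum_Sl; simpl div_lin; rewrite IHk, <- csum_scal.
        replace (S k - 0)%nat with (S k) by lia; simpl Cpow at 2.
        rewrite Cmult_1_r; f_equal; apply csum_ext; intros j Hj.
        replace (S k - S j)%nat with (k - j)%nat by lia; rewrite Cpow_S; ring. }
    assert (Z : div_lin b q (S m) = 0%C).
    { rewrite E, csum_S, Hb.
      replace (S m - S m)%nat with O by lia.
      rewrite <- csum_scal, <- csum_plus; apply csum_zero; intros k Hk; field; auto. }
    assert (Hs' : supp m (div_lin b q)).
    { intros k Hk; induction Hk as [|k Hk IHk]; [exact Z|].
      simpl; rewrite IHk, Hs by lia; ring. }
    destruct (IH (div_lin b q) H0 Hs') as [bs [Hl Hq]].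
    exists (b :: bs); split; [simpl; congruence|].
    simpl mul_lins; rewrite <- mul_lin_scale.
    change (q O) with (div_lin b q O); rewrite <- Hq, mul_div_lin; reflexivity.
Qed.

Lemma lin_prod_zero b bs z : In b bs -> (1 - b * z = 0)%C -> lin_prod bs z = 0%C.
Proof.
  intros Hb Hz; induction bs as [|a bs IH]; [destruct Hb|].
  simpl; destruct Hb as [->|Hb]; [rewrite Hz; ring|rewrite IH; auto; ring].
Qed.

Lemma factor_lins_nonvanishing m (q : nat -> C) : q O <> 0%C -> supp m q ->
  (forall z, Cmod z < 1 -> psum q m z <> 0%C) ->
  exists bs, length bs = m /\ q = scale (q O) (mul_lins bs one) /\
    (forall b, In b bs -> Cmod b <= 1) /\
    (forall z, psum q m z = (q O * lin_prod bs z)%C).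
Proof.
  intros H0 Hs Hz.
  destruct (factor_lins m q H0 Hs) as [bs [Hl Hq]].
  assert (Hev : forall z, psum q m z = (q O * lin_prod bs z)%C).
  { intros z; rewrite Hq at 1; rewrite psum_scale; f_equal.
    rewrite <- Hl, <- (Nat.add_0_r (length bs)), (psum_mul_lins _ _ _ _ supp_one).
    unfold psum, csum; simpl; ring. }
  exists bs; repeat split; auto.
  intros b Hb; apply Rnot_lt_le; intros Hlt.
  assert (Nb : b <> 0%C) by (intros ->; rewrite Cmod_0 in Hlt; lra).
  apply (Hz (/ b)%C).
  - rewrite Cmod_inv by auto.
    rewrite <- Rinv_1; apply Rinv_lt_contravar; lra.
  - rewrite Hev, (lin_prod_zero b); auto; [ring|field; auto].
Qed.

Definition conv (f g : nat -> C) (k : nat) : C :=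
  csum (fun j => f j * g (k - j)%nat)%C k.

Lemma conv_one g : conv one g = g.
Proof.
  apply functional_extensionality; intros [|k]; unfold conv.
  - unfold csum; simpl; ring.
  - rewrite csum_Sl, csum_zero; [simpl; ring|intros j _; simpl; ring].
Qed.

Lemma conv_scale a f g : conv (scale a f) g = scale a (conv f g).
Proof.
  apply functional_extensionality; intros k; unfold conv, scale.
  rewrite <- csum_scal; apply csum_ext; intros; ring.
Qed.

Lemma conv_mul_lin b f g : conv (mul_lin b f) g = mul_lin b (conv f g).
Proof.
  apply functional_extensionality; intros [|k]; unfold conv; [reflexivity|].
  change (mul_lin b (fun i => csum (fun j => f j * g (i - j)%nat)%C i) (S k))
    with (csum (fun j => f j * g (S k - j)%nat)%C (S k)
          - b * csum (fun j => f j * g (k - j)%nat)%C k)%C.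
  rewrite csum_Sl.
  rewrite (csum_Sl (fun j => f j * g (S k - j)%nat)%C).
  rewrite (csum_ext _ (fun j => f (S j) * g (S k - S j)%nat + (- b) * (f j * g (k - j)%nat))%C).
  - rewrite csum_plus, csum_scal; simpl mul_lin; ring.
  - intros j _; simpl; ring.
Qed.

Lemma conv_mul_lins bs g : conv (mul_lins bs one) g = mul_lins bs g.
Proof.
  induction bs as [|b bs IH]; [apply conv_one|].
  simpl; rewrite conv_mul_lin, IH; reflexivity.
Qed.

Lemma conv_factor_quot (q0 : C) bs A f : q0 <> 0%C ->
  conv (scale q0 (mul_lins bs one)) A = f -> A = scale (/ q0)%C (div_lins bs f).
Proof.
  intros H0 H; rewrite conv_scale, conv_mul_lins in H; rewrite <- H.
  rewrite div_lins_scale, div_mul_lins, scale_scale.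
  apply functional_extensionality; intros k; unfold scale.
  rewrite Cinv_l by auto; ring.
Qed.

(** Coefficients of [z^d conj (f (1 / conj z))], for a polynomial of formal degree [d]. *)
Definition refl1 (d : nat) (f : nat -> C) (k : nat) : C :=
  if Nat.leb k d then Cconj (f (d - k)%nat) else 0%C.

Lemma Cconj_minus_mult a b c : Cconj (a - b * c)%C = (Cconj a - Cconj b * Cconj c)%C.
Proof. unfold Cminus; rewrite Cplus_conj, Copp_conj, Cmult_conj; reflexivity. Qed.

(** Reflection is multiplicative with formal degrees adding up, and the reflection of [1 - b z] in
    degree 1 is [z - conj b]. The support condition settles the coefficient at index 0. *)
Lemma refl1_mul_lin d b f : supp d f ->
  refl1 (S d) (mul_lin b f) = mul_refl b (refl1 d f).
Proof.
  intros H; apply functional_extensionality; intros k; unfold refl1.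
  destruct k as [|k].
  - replace (S d - 0)%nat with (S d) by lia; replace (d - 0)%nat with d by lia; simpl.
    rewrite H by lia; replace (d - 0)%nat with d by lia.
    rewrite Cconj_minus_mult.
    replace (Cconj 0) with (RtoC 0) by (unfold Cconj, RtoC; simpl; f_equal; ring); ring.
  - cbn [mul_refl]. change (Nat.leb (S k) (S d)) with (Nat.leb k d).
    destruct (Nat.leb_spec k d).
    + replace (S d - S k)%nat with (d - k)%nat by lia.
      destruct (Nat.leb_spec (S k) d).
      * replace (d - k)%nat with (S (d - S k)) by lia; cbn [mul_lin].
        apply Cconj_minus_mult.
      * replace (d - k)%nat with O by lia; cbn [mul_lin]; ring.
    + destruct (Nat.leb_spec (S k) d); [lia|ring].
Qed.

Lemma refl1_mul_lins bs :
  refl1 (length bs) (mul_lins bs one) = mul_refls bs one.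
Proof.
  induction bs as [|b bs IH].
  - apply functional_extensionality; intros [|k]; unfold refl1; simpl; [|reflexivity].
    unfold Cconj, RtoC; simpl; f_equal; ring.
  - simpl mul_refls; rewrite <- IH; apply refl1_mul_lin.
    rewrite <- (Nat.add_0_r (length bs)); apply supp_mul_lins, supp_one.
Qed.

Lemma refl1_scale d a f : refl1 d (scale a f) = scale (Cconj a) (refl1 d f).
Proof.
  apply functional_extensionality; intros k; unfold refl1, scale.
  destruct (Nat.leb k d); [apply Cmult_conj|ring].
Qed.

(** * Weighted energy of Blaschke products *)

(** The mean of [|f|^2] over the circle of radius [rho], truncated at order [K]. *)
Definition energy (rho : R) (f : nat -> C) (K : nat) : R :=
  sum_f_R0 (fun k => Cmod (f k) ^ 2 * rho ^ (2 * k)) K.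

Definition dirichlet (rho : R) (f : nat -> C) (K : nat) : R :=
  sum_f_R0 (fun k => INR k * (Cmod (f k) ^ 2 * rho ^ (2 * k))) K.

Lemma energy_nonneg rho f K : 0 <= rho -> 0 <= energy rho f K.
Proof.
  intros H; apply sum_nonneg; intros k.
  apply Rmult_le_pos; [apply pow2_ge_0|apply pow_le; auto].
Qed.

Lemma Cmod2_sub_conj_mul (b u v : C) :
  Cmod (u - Cconj b * v)%C ^ 2
  = Cmod u ^ 2 + Cmod b ^ 2 * Cmod v ^ 2 - 2 * Re (b * u * Cconj v)%C.
Proof.
  rewrite !Cmod2_alt; destruct b as [b1 b2], u as [u1 u2], v as [v1 v2].
  unfold Re, Im, Cconj, Cminus, Cplus, Copp, Cmult; simpl; ring.
Qed.

Lemma Cmod2_sub_mul (b u v : C) :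
  Cmod (v - b * u)%C ^ 2
  = Cmod v ^ 2 + Cmod b ^ 2 * Cmod u ^ 2 - 2 * Re (b * u * Cconj v)%C.
Proof.
  rewrite !Cmod2_alt; destruct b as [b1 b2], u as [u1 u2], v as [v1 v2].
  unfold Re, Im, Cconj, Cminus, Cplus, Copp, Cmult; simpl; ring.
Qed.

Lemma Re_le_Cmod3 (b u v : C) : Re (b * u * Cconj v)%C <= Cmod b * Cmod u * Cmod v.
Proof.
  eapply Rle_trans; [apply Rle_abs|].
  eapply Rle_trans; [apply re_le_Cmod|].
  rewrite !Cmod_mult, Cmod_conj; lra.
Qed.

(** The weights of [|h k|^2] and [|h (S k)|^2] when [|z - conj b|^2] is compared with
    [9 |1 - b z|^2] and [x = |b|]. The two cross terms add up to [16 Re (b u conj v)], and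
    [2 u (rho v) <= u^2 + (rho v)^2] shares this out evenly, which produces both summands
    [8 * x * rho]. *)
Definition coefP (x rho : R) := rho ^ 2 - 9 * x ^ 2 * rho ^ 2 + 8 * x * rho.
Definition coefQ (x rho : R) := x ^ 2 - 9 + 8 * x * rho.

Lemma refl_vs_lin_pointwise (b : C) (h : nat -> C) (rho : R) k : 0 < rho ->
  Cmod (mul_refl b h (S k)) ^ 2 * rho ^ (2 * S k)
  - 9 * (Cmod (mul_lin b h (S k)) ^ 2 * rho ^ (2 * S k))
  <= coefP (Cmod b) rho * (Cmod (h k) ^ 2 * rho ^ (2 * k))
     + coefQ (Cmod b) rho * (Cmod (h (S k)) ^ 2 * rho ^ (2 * S k)).
Proof.
  intros Hr; simpl mul_refl; simpl mul_lin.
  rewrite Cmod2_sub_conj_mul, Cmod2_sub_mul.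
  assert (Ht := Re_le_Cmod3 b (h k) (h (S k))).
  set (t := Re _) in *; clearbody t.
  assert (Hb := Cmod_ge_0 b); assert (Hu := Cmod_ge_0 (h k));
    assert (Hv := Cmod_ge_0 (h (S k))).
  set (x := Cmod b) in *; set (u := Cmod (h k)) in *; set (v := Cmod (h (S k))) in *.
  clearbody x u v.
  replace (rho ^ (2 * S k)) with (rho ^ 2 * rho ^ (2 * k)).
  2: { replace (2 * S k)%nat with (2 + 2 * k)%nat by lia; rewrite pow_add; ring. }
  assert (Hk : 0 <= rho ^ (2 * k)) by (apply pow_le; lra).
  set (s := rho ^ (2 * k)) in *; clearbody s.
  unfold coefP, coefQ.
  assert (E : 0 <= 8 * x * rho * (u ^ 2 + rho ^ 2 * v ^ 2) - 16 * t * rho ^ 2).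
  { assert (0 <= 8 * x * rho * (u - rho * v) ^ 2).
    { apply Rmult_le_pos; [|apply pow2_ge_0].
      apply Rmult_le_pos; [lra|lra]. }
    assert (t * rho ^ 2 <= x * u * v * rho ^ 2).
    { apply Rmult_le_compat_r; [apply pow2_ge_0|auto]. }
    nra. }
  apply Rmult_le_compat_r with (r := s) in E; auto.
  rewrite Rmult_0_l in E.
  nra.
Qed.


(* The pseudo-hyperbolic distance condition on a zero of modulus [x], saying
   that the Blaschke factor is bounded by 3 on the disc of radius [rho]. *)
Definition tame (x rho : R) : Prop :=
  0 <= x /\ 1 <= rho <= 3 / 2 /\ x * rho < 1 /\ rho - x <= 3 * (1 - x * rho).

(** The sum equals [(rho - x)^2 - 9 (1 - x rho)^2]. *)
Lemma coefPQ_le0 x rho : tame x rho -> coefP x rho + coefQ x rho <= 0.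
Proof.
  unfold coefP, coefQ; intros (H0 & H1 & H2 & H3).
  assert (x <= rho) by nra.
  assert ((rho - x) * (rho - x) <= (3 * (1 - x * rho)) * (3 * (1 - x * rho)))
    by (apply Rmult_le_compat; lra).
  nra.
Qed.

Lemma coefQ_le0 x rho : tame x rho -> coefQ x rho <= 0.
Proof. unfold coefQ; intros (H0 & H1 & H2 & H3); nra. Qed.

(** Here [coefP x rho = rho (rho - x) + 9 x rho (1 - x rho)]; with [rho <= 3/2] and [x rho < 1] the
    factor is [9/2 + 9], rounded up to 14. *)
Lemma coefP_le x rho : tame x rho -> coefP x rho <= 14 * (1 - x * rho).
Proof.
  unfold coefP; intros (H0 & H1 & H2 & H3).
  assert (rho * (rho - x) <= rho * (3 * (1 - x * rho))) by (apply Rmult_le_compat_l; lra).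
  assert (0 <= 1 - x * rho) by lra.
  assert (rho * (1 - x * rho) <= 3 / 2 * (1 - x * rho)) by (apply Rmult_le_compat_r; lra).
  assert (x * rho * (1 - x * rho) <= 1 * (1 - x * rho)) by (apply Rmult_le_compat_r; lra).
  nra.
Qed.

(** In the sum of the pointwise bounds every [|h k|^2 rho^(2k)] with [k < K] occurs with
    [coefP + coefQ <= 0]. The last one occurs with [coefQ] alone, and keeping that term is what
    makes the induction close. *)
Lemma energy_refl_le (b : C) rho h K : tame (Cmod b) rho ->
  energy rho (mul_refl b h) K
  <= 9 * energy rho (mul_lin b h) K
     + coefQ (Cmod b) rho * (Cmod (h K) ^ 2 * rho ^ (2 * K)).
Proof.
  intros T; assert (H := coefPQ_le0 _ _ T); assert (HQ := coefQ_le0 _ _ T).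
  assert (T' := T); destruct T' as (H0 & H1 & H2 & H3).
  induction K as [|K IH].
  - unfold energy, sum_f_R0; change (2 * 0)%nat with O; rewrite !pow_O.
    change (mul_refl b h 0) with (- (Cconj b * h O))%C.
    change (mul_lin b h 0) with (h O).
    rewrite Cmod_opp, Cmod_mult, Cmod_conj, Rpow_mult_distr; unfold coefQ.
    assert (0 <= Cmod b * rho * Cmod (h O) ^ 2)
      by (apply Rmult_le_pos; [apply Rmult_le_pos; lra|apply pow2_ge_0]).
    lra.
  - assert (Hp := refl_vs_lin_pointwise b h rho K ltac:(lra)).
    unfold energy in *; rewrite !tech5.
    assert (0 <= Cmod (h K) ^ 2 * rho ^ (2 * K))
      by (apply Rmult_le_pos; [apply pow2_ge_0|apply pow_le; lra]).
    nra.
Qed.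

(** With the weight [k], the term [|h k|^2] meets [coefQ] with weight [k] and [coefP] with weight
    [k + 1]. One copy of [coefP] is left over; its smallness [1 - |b| rho] will offset the large
    energy of [h], a series divided by [1 - b z]. *)
Lemma dirichlet_refl_le (b : C) rho h K : tame (Cmod b) rho ->
  dirichlet rho (mul_refl b h) K
  <= 9 * dirichlet rho (mul_lin b h) K
     + 14 * (1 - Cmod b * rho) * (energy rho h K - Cmod (h K) ^ 2 * rho ^ (2 * K))
     + INR K * coefQ (Cmod b) rho * (Cmod (h K) ^ 2 * rho ^ (2 * K)).
Proof.
  intros T; assert (H := coefPQ_le0 _ _ T); assert (HQ := coefQ_le0 _ _ T);
    assert (HP := coefP_le _ _ T).
  assert (T' := T); destruct T' as (H0 & H1 & H2 & H3).
  induction K as [|K IH].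
  - unfold dirichlet, energy, sum_f_R0; change (INR 0) with 0.
    change (2 * 0)%nat with O; rewrite !pow_O.
    assert (0 <= Cmod (h O) ^ 2) by apply pow2_ge_0; nra.
  - assert (Hp := refl_vs_lin_pointwise b h rho K ltac:(lra)).
    unfold dirichlet, energy in *; rewrite !tech5.
    assert (Y0 : 0 <= Cmod (h K) ^ 2 * rho ^ (2 * K))
      by (apply Rmult_le_pos; [apply pow2_ge_0|apply pow_le; lra]).
    assert (Y1 : 0 <= Cmod (h (S K)) ^ 2 * rho ^ (2 * S K))
      by (apply Rmult_le_pos; [apply pow2_ge_0|apply pow_le; lra]).
    assert (HK : 0 <= INR K) by apply pos_INR.
    rewrite S_INR.
    set (y0 := Cmod (h K) ^ 2 * rho ^ (2 * K)) in *.
    set (y1 := Cmod (h (S K)) ^ 2 * rho ^ (2 * S K)) in *.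
    set (F := Cmod (mul_refl b h (S K)) ^ 2 * rho ^ (2 * S K)) in *.
    set (G := Cmod (mul_lin b h (S K)) ^ 2 * rho ^ (2 * S K)) in *.
    apply Rmult_le_compat_l with (r := INR K + 1) in Hp; [|lra].
    assert (INR K * ((coefP (Cmod b) rho + coefQ (Cmod b) rho) * y0) <= 0).
    { assert (0 <= INR K * y0) by (apply Rmult_le_pos; auto); nra. }
    assert (coefP (Cmod b) rho * y0 <= 14 * (1 - Cmod b * rho) * y0)
      by (apply Rmult_le_compat_r; auto).
    lra.
Qed.

(** If [conj b * b = 1] then [z - conj b = - conj b (1 - b z)]: the zero on the circle cancels. *)
Lemma blaschke_unimodular (b : C) f : Cmod b = 1 -> blaschke b f = scale (- Cconj b)%C f.
Proof.
  intros H; unfold blaschke.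
  rewrite <- (mul_div_lin b f) at 2.
  set (h := div_lin b f); clearbody h.
  assert (E : (Cconj b * b = 1)%C).
  { rewrite Cmult_comm, <- Cmod2_conj, H; f_equal; ring. }
  apply functional_extensionality; intros [|k]; unfold scale; simpl; [ring|].
  transitivity ((Cconj b * b) * h k - Cconj b * h (S k))%C; [rewrite E; ring|ring].
Qed.

Lemma energy_scale rho a f K : energy rho (scale a f) K = Cmod a ^ 2 * energy rho f K.
Proof.
  unfold energy, scale; rewrite scal_sum; apply sum_eq; intros.
  rewrite Cmod_mult; ring.
Qed.

Lemma dirichlet_scale rho a f K :
  dirichlet rho (scale a f) K = Cmod a ^ 2 * dirichlet rho f K.
Proof.
  unfold dirichlet, scale; rewrite scal_sum; apply sum_eq; intros.
  rewrite Cmod_mult; ring.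
Qed.

Lemma energy_blaschkes rho bs f K : 1 <= rho ->
  (forall b, In b bs -> Cmod b = 1 \/ tame (Cmod b) rho) ->
  energy rho (blaschkes bs f) K <= 9 ^ length bs * energy rho f K.
Proof.
  intros Hr; induction bs as [|b bs IH]; intros Hb.
  - simpl; lra.
  - assert (IH' := IH (fun a Ha => Hb a (or_intror Ha))).
    assert (E0 := energy_nonneg rho (blaschkes bs f) K ltac:(lra)).
    change (blaschkes (b :: bs) f) with (blaschke b (blaschkes bs f)); simpl length.
    rewrite <- tech_pow_Rmult.
    destruct (Hb b (or_introl eq_refl)) as [H1|T].
    + rewrite blaschke_unimodular, energy_scale, Cmod_opp, Cmod_conj, H1 by auto; lra.
    + unfold blaschke.
      assert (H := energy_refl_le b rho (div_lin b (blaschkes bs f)) K T).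
      rewrite mul_div_lin in H.
      assert (HQ := coefQ_le0 _ _ T).
      set (h := div_lin b (blaschkes bs f)) in *.
      assert (0 <= Cmod (h K) ^ 2 * rho ^ (2 * K))
        by (apply Rmult_le_pos; [apply pow2_ge_0|apply pow_le; lra]).
      nra.
Qed.

Lemma energy_one rho K : energy rho one K = 1.
Proof.
  induction K as [|K IH]; unfold energy in *.
  - simpl; rewrite Cmod_1; ring.
  - rewrite tech5, IH; simpl one; rewrite Cmod_0; ring.
Qed.

Lemma dirichlet_one rho K : dirichlet rho one K = 0.
Proof.
  induction K as [|K IH]; unfold dirichlet in *.
  - simpl; ring.
  - rewrite tech5, IH; simpl one; rewrite Cmod_0; ring.
Qed.

(** The coefficients of [1 / (1 - b z)] are the powers of [b], so the energy is a geometric sum of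
    ratio [(|b| rho)^2]; one factor [1 - |b| rho] compensates it. *)
Lemma energy_geometric (b : C) rho K : 0 <= rho -> Cmod b * rho < 1 ->
  (1 - Cmod b * rho) * energy rho (div_lin b one) K <= 1.
Proof.
  intros Hr H.
  assert (E : forall k, Cmod (div_lin b one k) = Cmod b ^ k).
  { induction k as [|k IH]; [apply Cmod_1|].
    simpl div_lin; rewrite Cplus_0_l, Cmod_mult, IH; reflexivity. }
  assert (x0 : 0 <= Cmod b * rho) by (apply Rmult_le_pos; auto; apply Cmod_ge_0).
  assert (G : forall K, (1 - Cmod b * rho) * energy rho (div_lin b one) K
            <= 1 - (Cmod b * rho) ^ (S K)).
  { induction K0 as [|k IH]; unfold energy in *.
    - simpl; rewrite Cmod_1; simpl; lra.
    - rewrite tech5, Rmult_plus_distr_l, E.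
      replace ((Cmod b ^ S k) ^ 2 * rho ^ (2 * S k)) with ((Cmod b * rho) ^ S k * (Cmod b * rho) ^ S k)
        by (rewrite Rpow_mult_distr, <- !pow_mult, Nat.mul_comm; replace (2 * S k)%nat with (S k + S k)%nat by lia; rewrite !pow_add; ring).
      assert (P := pow_le _ (S k) x0).
      assert ((Cmod b * rho) ^ S k <= 1).
      { rewrite <- (pow1 (S k)); apply pow_incr; lra. }
      rewrite <- (tech_pow_Rmult _ (S k)).
      set (y := (Cmod b * rho) ^ S k) in *; set (z := Cmod b * rho) in *.
      assert ((1 - z) * (y * y) <= (1 - z) * y) by (apply Rmult_le_compat_l; nra).
      lra. }
  eapply Rle_trans; [apply G|].
  assert (P := pow_le _ (S K) x0); lra.
Qed.

(** A further factor multiplies the Dirichlet sum by 9 and leaves the excess term, whose 14 comes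
    from [coefP_le] and whose [9 ^ d'] bounds the effect of the other factors on the energy. *)
Fixpoint dirichlet_bound (d : nat) : R :=
  match d with O => 0 | S d' => 9 * dirichlet_bound d' + 14 * 9 ^ d' end.

Lemma dirichlet_bound_nonneg d : 0 <= dirichlet_bound d.
Proof.
  induction d as [|d IH]; simpl; [lra|]; assert (0 <= 9 ^ d) by (apply pow_le; lra); lra.
Qed.

Lemma dirichlet_nonneg rho f K : 0 <= rho -> 0 <= dirichlet rho f K.
Proof.
  intros H; apply sum_nonneg; intros k.
  apply Rmult_le_pos; [apply pos_INR|].
  apply Rmult_le_pos; [apply pow2_ge_0|apply pow_le; auto].
Qed.

Lemma dirichlet_blaschkes rho bs K : 1 <= rho ->
  (forall b, In b bs -> Cmod b = 1 \/ tame (Cmod b) rho) ->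
  dirichlet rho (blaschkes bs one) K <= dirichlet_bound (length bs).
Proof.
  intros Hr; induction bs as [|b bs IH]; intros Hb.
  - simpl; rewrite dirichlet_one; lra.
  - assert (Hb' := fun a Ha => Hb a (or_intror Ha)).
    assert (IH' := IH Hb').
    change (blaschkes (b :: bs) one) with (blaschke b (blaschkes bs one)).
    simpl length; simpl dirichlet_bound.
    assert (P9 : 0 <= 9 ^ length bs) by (apply pow_le; lra).
    destruct (Hb b (or_introl eq_refl)) as [H1|T].
    + rewrite blaschke_unimodular, dirichlet_scale, Cmod_opp, Cmod_conj, H1 by auto.
      assert (D0 := dirichlet_nonneg rho (blaschkes bs one) K ltac:(lra)); lra.
    + unfold blaschke.
      assert (H := dirichlet_refl_le b rho (div_lin b (blaschkes bs one)) K T).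
      rewrite mul_div_lin in H.
      assert (HQ := coefQ_le0 _ _ T).
      destruct T as (T0 & T1 & T2 & T3).
      assert (INR K * coefQ (Cmod b) rho
         * (Cmod (div_lin b (blaschkes bs one) K) ^ 2 * rho ^ (2 * K)) <= 0).
      { assert (0 <= INR K * (Cmod (div_lin b (blaschkes bs one) K) ^ 2 * rho ^ (2 * K))).
        { apply Rmult_le_pos; [apply pos_INR|].
          apply Rmult_le_pos; [apply pow2_ge_0|apply pow_le; lra]. }
        nra. }
      assert (0 <= (1 - Cmod b * rho)
         * (Cmod (div_lin b (blaschkes bs one) K) ^ 2 * rho ^ (2 * K))).
      { apply Rmult_le_pos; [lra|].
        apply Rmult_le_pos; [apply pow2_ge_0|apply pow_le; lra]. }
      (* Moving [1 / (1 - b z)] inside the product leaves a geometric series, whose energy the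
         remaining Blaschke factors enlarge by at most [9 ^ length bs]. *)
      assert (E : (1 - Cmod b * rho) * energy rho (div_lin b (blaschkes bs one)) K
              <= 9 ^ length bs).
      { rewrite div_lin_blaschkes_comm.
        assert (G := energy_geometric b rho K ltac:(lra) T2).
        assert (EB := energy_blaschkes rho bs (div_lin b one) K Hr Hb').
        apply Rmult_le_compat_l with (r := 1 - Cmod b * rho) in EB; [|lra].
        nra. }
      lra.
Qed.

Definition blaschke_bound (d : nat) : R := dirichlet_bound d + 9 ^ d.

Lemma blaschkes_weighted_sum rho bs K : 1 <= rho ->
  (forall b, In b bs -> Cmod b = 1 \/ tame (Cmod b) rho) ->
  sum_f_R0 (fun k => (INR k + 1) * (Cmod (blaschkes bs one k) ^ 2 * rho ^ (2 * k))) K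
  <= blaschke_bound (length bs).
Proof.
  intros Hr Hb.
  assert (H1 := dirichlet_blaschkes rho bs K Hr Hb).
  assert (H2 := energy_blaschkes rho bs one K Hr Hb).
  rewrite energy_one in H2.
  unfold dirichlet, energy, blaschke_bound in *.
  rewrite (sum_eq _ (fun k => INR k * (Cmod (blaschkes bs one k) ^ 2 * rho ^ (2 * k))
    + Cmod (blaschkes bs one k) ^ 2 * rho ^ (2 * k))) by (intros; ring).
  rewrite plus_sum; lra.
Qed.

(** The origin of the 3 in [tame]: for [x = 1 - d] and [rho = 1 + d/2] one has [rho - x = 3d/2] and
    [1 - x rho = d/2 + d^2/2]. Smaller [x] only helps. *)
Lemma tame_of_delta x d : 0 <= x -> 0 < d <= 1 -> x <= 1 - d -> tame x (1 + d / 2).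
Proof. intros H0 H1 H2; unfold tame; repeat split; try lra; nra. Qed.

(** * Power weights against geometric growth *)

Lemma exp_le_compat x y : x <= y -> exp x <= exp y.
Proof. intros [H| ->]; [left; apply exp_increasing; auto|apply Rle_refl]. Qed.

Lemma exp_dominates_pow s : 0 < s -> exists Cs, 0 < Cs /\
  forall d k, 0 < d <= 1 -> Rpower ((INR k + 1) * d) s <= Cs * (1 + d / 2) ^ (2 * k).
Proof.
  intros Hs.
  (* [ln y <= c y - 1 - ln c] with [s c = 1/2], and [ln (1 + d/2) >= d/4]. *)
  exists (exp (1 / 2 + s * (- ln (/ (2 * s)) - 1))); split; [apply exp_pos|].
  intros d k Hd.
  set (y := (INR k + 1) * d).
  assert (Hk := pos_INR k).
  assert (Hy : 0 < y) by (unfold y; apply Rmult_lt_0_compat; lra).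
  assert (Hc : 0 < / (2 * s)) by (apply Rinv_0_lt_compat; lra).
  assert (L1 : ln y <= / (2 * s) * y - 1 - ln (/ (2 * s))).
  { assert (E : ln (/ (2 * s) * y) = ln (/ (2 * s)) + ln y) by (apply ln_mult; auto).
    assert (Hp : 0 < / (2 * s) * y) by (apply Rmult_lt_0_compat; auto).
    assert (I := exp_ineq1_le (ln (/ (2 * s) * y))).
    rewrite exp_ln in I by auto; lra. }
  assert (L2 : exp (d / 4) <= 1 + d / 2).
  { assert (E : 0 < exp (- (d / 4))) by apply exp_pos.
    assert (I := exp_ineq1_le (- (d / 4))).
    assert (M : exp (d / 4) * exp (- (d / 4)) = 1)
      by (rewrite <- exp_plus, Rplus_opp_r; apply exp_0).
    assert (P := exp_pos (d / 4)).
    assert (exp (d / 4) * (1 - d / 4) <= 1) by nra.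
    assert (1 <= (1 + d / 2) * (1 - d / 4)) by nra.
    apply Rmult_le_reg_r with (1 - d / 4); lra. }
  apply Rle_trans with (exp (1 / 2 + s * (- ln (/ (2 * s)) - 1)) * exp (d / 4) ^ (2 * k)).
  - replace (exp (d / 4) ^ (2 * k)) with (exp (INR k * d / 2)).
    + rewrite <- exp_plus; unfold Rpower; apply exp_le_compat.
      apply Rmult_le_compat_l with (r := s) in L1; [|lra].
      replace (s * (/ (2 * s) * y - 1 - ln (/ (2 * s))))
        with (y / 2 + s * (- ln (/ (2 * s)) - 1)) in L1 by (field; lra).
      unfold y in *; nra.
    + rewrite <- Rpower_pow by apply exp_pos; unfold Rpower; rewrite ln_exp.
      f_equal; rewrite mult_INR; simpl INR; field.
  - apply Rmult_le_compat_l; [left; apply exp_pos|].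
    apply pow_incr; split; [left; apply exp_pos|auto].
Qed.

(** The excess [(k + 1)^(p - 1)] is [d^(1 - p)] times a power of [(k + 1) d], and the growth of
    [(1 + d/2)^(2k)] absorbs that power uniformly in [d]. *)
Lemma weight_le_large p : 1 < p -> exists Cs, 0 < Cs /\
  forall d k, 0 < d <= 1 ->
    Rpower (INR k + 1) p <= Cs * Rpower d (1 - p) * ((INR k + 1) * (1 + d / 2) ^ (2 * k)).
Proof.
  intros Hp; destruct (exp_dominates_pow (p - 1)) as [Cs [H0 H]]; [lra|].
  exists Cs; split; auto; intros d k Hd.
  assert (Hk := pos_INR k).
  assert (E : Rpower (INR k + 1) p
    = Rpower d (1 - p) * ((INR k + 1) * Rpower ((INR k + 1) * d) (p - 1))).
  { rewrite <- Rpower_mult_distr by lra.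
    replace (INR k + 1) with (Rpower (INR k + 1) 1) at 2 by (apply Rpower_1; lra).
    transitivity (Rpower d (1 - p) * Rpower d (p - 1)
      * (Rpower (INR k + 1) 1 * Rpower (INR k + 1) (p - 1))); [|ring].
    rewrite <- !Rpower_plus; replace (1 - p + (p - 1)) with 0 by ring.
    rewrite Rpower_O by lra; rewrite Rmult_1_l; f_equal; ring. }
  rewrite E.
  specialize (H d k Hd).
  assert (0 < Rpower d (1 - p)) by apply exp_pos.
  assert (0 <= Rpower d (1 - p) * (INR k + 1)) by (apply Rmult_le_pos; lra).
  nra.
Qed.

Lemma weight_le_small p k : 0 < p <= 1 -> Rpower (INR k + 1) p <= INR k + 1.
Proof.
  intros Hp; assert (Hk := pos_INR k).
  rewrite <- (Rpower_1 (INR k + 1)) at 2 by lra.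
  apply Rle_Rpower; lra.
Qed.

(** * Values of Blaschke products near the circle *)

Definition refl_prod (bs : list C) (z : C) : C :=
  fold_right (fun b v => ((z - Cconj b) * v)%C) 1%C bs.

Lemma psum_mul_refl b f N z :
  psum (mul_refl b f) (S N) z = (z * psum f N z - Cconj b * psum f (S N) z)%C.
Proof.
  induction N as [|N IH].
  - unfold psum; rewrite !csum_S; simpl; ring.
  - rewrite psum_S, IH, (psum_S f (S N)), (psum_S f N).
    change (mul_refl b f (S (S N))) with (f (S N) - Cconj b * f (S (S N)))%C.
    rewrite (Cpow_S z (S N)); ring.
Qed.

Lemma supp_mul_refl d b f : supp d f -> supp (S d) (mul_refl b f).
Proof. intros H [|k] Hk; [lia|]; simpl; rewrite !H by lia; ring. Qed.

Lemma psum_mul_refls bs z : supp (length bs) (mul_refls bs one) /\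
  psum (mul_refls bs one) (length bs) z = refl_prod bs z.
Proof.
  induction bs as [|b bs [Hs IH]].
  - split; [exact supp_one|]; unfold psum; simpl; ring.
  - split; [apply supp_mul_refl, Hs|].
    change (psum (mul_refl b (mul_refls bs one)) (S (length bs)) z
      = ((z - Cconj b) * refl_prod bs z)%C).
    rewrite psum_mul_refl, (psum_supp _ _ (S _) z Hs) by lia.
    rewrite IH; ring.
Qed.

Lemma Cmod2_lin_refl (b z : C) :
  Cmod (1 - b * z)%C ^ 2 - Cmod (z - Cconj b)%C ^ 2
  = (1 - Cmod b ^ 2) * (1 - Cmod z ^ 2).
Proof.
  rewrite !Cmod2_alt; destruct b as [b1 b2], z as [z1 z2].
  unfold Re, Im, Cconj, Cminus, Cplus, Copp, Cmult, RtoC; simpl; ring.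
Qed.

Lemma Cmod_1_sub_ge (b z : C) : 1 - Cmod b * Cmod z <= Cmod (1 - b * z)%C.
Proof.
  assert (H := Cmod_triangle (1 - b * z)%C (b * z)%C).
  replace (1 - b * z + b * z)%C with (RtoC 1) in H by ring.
  rewrite Cmod_1, Cmod_mult in H; lra.
Qed.

Lemma pow2_le_reg x y : 0 <= y -> x ^ 2 <= y ^ 2 -> x <= y.
Proof. intros H0 H; destruct (Rle_dec x y); auto; nra. Qed.

(** Write [x = |b|] and [r = |z|]. Since [(1 - x^2)(1 - r^2) = (1 - x r)^2 - (r - x)^2] and
    [|1 - b z| >= 1 - x r], the factor is smallest when [z] and [conj b] lie on one ray. There it is
    the pseudo-hyperbolic distance [(r - x) / (1 - x r)], which [x <= 1 - d] and [r = 1 - k d] keep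
    above [1 - 2k]. *)
Lemma refl_factor_lower (b z : C) d k : 0 < d <= 1 -> 0 < k <= 1 / 4 ->
  Cmod b = 1 \/ Cmod b <= 1 - d -> Cmod z = 1 - k * d ->
  (1 - 2 * k) * Cmod (1 - b * z)%C <= Cmod (z - Cconj b)%C.
Proof.
  intros Hd Hk Hb Hz.
  assert (E := Cmod2_lin_refl b z).
  assert (G := Cmod_1_sub_ge b z).
  rewrite Hz in E, G.
  apply pow2_le_reg; [apply Cmod_ge_0|].
  assert (Hx := Cmod_ge_0 b).
  assert (S0 := Cmod_ge_0 (1 - b * z)%C).
  set (S := Cmod (1 - b * z)%C) in *; set (T := Cmod (z - Cconj b)%C) in *.
  set (x := Cmod b) in *; clearbody S T x.
  replace (T ^ 2) with (S ^ 2 - (1 - x ^ 2) * (1 - (1 - k * d) ^ 2)) by lra.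
  rewrite Rpow_mult_distr.
  destruct Hb as [-> | Hb].
  - assert ((1 - 2 * k) ^ 2 <= 1) by nra.
    assert (0 <= S ^ 2) by apply pow2_ge_0; nra.
  - set (r := 1 - k * d) in *.
    assert (kd : 0 < k * d <= 1 / 4) by (split; nra).
    assert (xr : 0 <= x * r < 1) by (unfold r; split; nra).
    assert (I : (1 - 2 * k) * (1 - x * r) <= r - x).
    { unfold r; assert (k * d <= k * (1 - x)) by (apply Rmult_le_compat_l; lra).
      assert (x * (k * d) <= k * d) by nra.
      assert (0 <= k * (k * d)) by (apply Rmult_le_pos; lra).
      assert (0 <= (1 - 2 * k)) by lra.
      assert ((1 - 2 * k) * (1 - x * (1 - k * d)) <= (1 - 2 * k) * (1 - x + k * d))
        by (apply Rmult_le_compat_l; lra).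
      lra. }
    assert (J : (1 - 2 * k) ^ 2 * (1 - x * r) ^ 2 <= (r - x) ^ 2).
    { rewrite <- Rpow_mult_distr; apply pow_incr; split; auto.
      apply Rmult_le_pos; lra. }
    assert (0 <= 1 - (1 - 2 * k) ^ 2) by nra.
    assert ((1 - x * r) ^ 2 <= S ^ 2) by (apply pow_incr; lra).
    assert ((1 - (1 - 2 * k) ^ 2) * (1 - x * r) ^ 2 <= (1 - (1 - 2 * k) ^ 2) * S ^ 2)
      by (apply Rmult_le_compat_l; auto).
    nra.
Qed.

Lemma refl_prod_lower bs z d k : 0 < d <= 1 -> 0 < k <= 1 / 4 ->
  (forall b, In b bs -> Cmod b = 1 \/ Cmod b <= 1 - d) -> Cmod z = 1 - k * d ->
  (1 - 2 * k) ^ length bs * Cmod (lin_prod bs z) <= Cmod (refl_prod bs z).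
Proof.
  intros Hd Hk Hb Hz; induction bs as [|b bs IH]; simpl.
  - lra.
  - rewrite !Cmod_mult.
    assert (H1 := refl_factor_lower b z d k Hd Hk (Hb b (or_introl eq_refl)) Hz).
    assert (H2 := IH (fun a Ha => Hb a (or_intror Ha))).
    apply Rle_trans with (((1 - 2 * k) * Cmod (1 - b * z)%C)
      * ((1 - 2 * k) ^ length bs * Cmod (lin_prod bs z))); [right; ring|].
    apply Rmult_le_compat; auto; apply Rmult_le_pos; try apply Cmod_ge_0; try lra.
    apply pow_le; lra.
Qed.

Lemma bernoulli_sub y m : 0 <= y <= 1 -> 1 - INR m * y <= (1 - y) ^ m.
Proof.
  intros H; induction m as [|m IH]; [simpl; lra|].
  rewrite S_INR, <- tech_pow_Rmult.
  assert (Hm := pos_INR m).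
  apply Rle_trans with ((1 - y) * (1 - INR m * y)); [nra|].
  apply Rmult_le_compat_l; lra.
Qed.

Lemma refl_prod_zero b bs : In b bs -> refl_prod bs (Cconj b) = 0%C.
Proof.
  intros Hb; induction bs as [|a bs IH]; [destruct Hb|].
  simpl; destruct Hb as [->|Hb]; [ring|rewrite IH; auto; ring].
Qed.

(** Selects the zero nearest to the circle; unimodular entries are set aside because their factors
    are constants. *)
Lemma largest_interior (bs : list C) : (forall b, In b bs -> Cmod b <= 1) ->
  (forall b, In b bs -> Cmod b = 1) \/
  exists b0, In b0 bs /\ Cmod b0 < 1 /\
    forall b, In b bs -> Cmod b = 1 \/ Cmod b <= Cmod b0.
Proof.
  induction bs as [|a bs IH]; intros H; [left; intros b []|].
  assert (Ha := H a (or_introl eq_refl)).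
  destruct (IH (fun b Hb => H b (or_intror Hb))) as [I|(b0 & I0 & I1 & I2)].
  - destruct (Rle_lt_or_eq_dec _ _ Ha) as [L|E].
    + right; exists a; repeat split; [now left|auto|].
      intros b [<-|Hb]; [right; lra|left; auto].
    + left; intros b [<-|Hb]; auto.
  - right; destruct (Rle_lt_or_eq_dec _ _ Ha) as [L|E].
    + destruct (Rle_dec (Cmod a) (Cmod b0)) as [l|l].
      * exists b0; repeat split; [now right|auto|].
        intros b [<-|Hb]; [right; auto|auto].
      * exists a; repeat split; [now left|auto|].
        intros b [<-|Hb]; [right; lra|].
        destruct (I2 b Hb); [now left|right; lra].
    + exists b0; repeat split; [now right|auto|].
      intros b [<-|Hb]; auto.
Qed.

Lemma unit_direction (a : C) : exists v : C, Cmod v = 1 /\ a = (Cmod a * v)%C.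
Proof.
  destruct (Req_dec (Cmod a) 0) as [H|H].
  - exists 1%C; split; [apply Cmod_1|].
    rewrite H; apply Cmod_eq_0 in H; rewrite H; ring.
  - assert (N : RtoC (Cmod a) <> 0%C) by (intros E; apply H; injection E; auto).
    exists (a / Cmod a)%C; split.
    + rewrite Cmod_div, Cmod_R, Rabs_pos_eq by (auto; apply Cmod_ge_0); field; auto.
    + field; auto.
Qed.

(** Chosen so that [(1 - 2 kappa)^m >= 1/2] by Bernoulli, which is the lower bound for a product of
    [m] factors at distance [kappa * d] from the circle. *)
Definition kappa (m : nat) : R := / (4 * (INR m + 1)).

Lemma kappa_bounds m : 0 < kappa m <= 1 / 4.
Proof.
  assert (H := pos_INR m); unfold kappa; split; [apply Rinv_0_lt_compat; lra|].
  unfold Rdiv; rewrite Rmult_1_l; apply Rinv_le_contravar; lra.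
Qed.

(* Either the product is a unimodular constant, or [d] is the distance from its
   zero set to the circle; then it vanishes at [a], and has modulus at least 1/2
   at [w], at comparable distance from the circle. *)
Lemma blaschke_dichotomy bs : (forall b, In b bs -> Cmod b <= 1) ->
  exists d, 0 < d <= 1 /\
    (forall K, sum_f_R0 (fun k => (INR k + 1)
        * (Cmod (blaschkes bs one k) ^ 2 * (1 + d / 2) ^ (2 * k))) K
      <= blaschke_bound (length bs)) /\
    (d = 1 \/ exists a w : C,
      Cmod a <= 1 - kappa (length bs) * d /\ Cmod w <= 1 - kappa (length bs) * d /\
      Cmod (w - a)%C <= d /\ refl_prod bs a = 0%C /\
      Cmod (lin_prod bs w) <= 2 * Cmod (refl_prod bs w)).
Proof.
  intros H; destruct (largest_interior bs H) as [H1|(b0 & I0 & I1 & I2)].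
  - exists 1; split; [lra|split; [|now left]].
    intros K; apply blaschkes_weighted_sum; [lra|auto].
  - assert (Hb0 := Cmod_ge_0 b0).
    assert (Hk := kappa_bounds (length bs)); set (k := kappa (length bs)) in *.
    set (d := 1 - Cmod b0).
    assert (Hd : 0 < d <= 1) by (unfold d; lra).
    exists d; split; [auto|split].
    + intros K; apply blaschkes_weighted_sum; [lra|].
      intros b Hb; destruct (I2 b Hb); [now left|right].
      apply tame_of_delta; auto; [apply Cmod_ge_0|unfold d; lra].
    + right.
      assert (kd : 0 < k * d <= d / 4) by (split; nra).
      (* The point [w] is taken on the ray through the zero [conj b0], so that [|w - a|] is a mere
         difference of radii. *)
      destruct (unit_direction (Cconj b0)) as (v & V1 & V2).
      rewrite Cmod_conj in V2.
      assert (Hw : Cmod ((1 - k * d)%R * v)%C = 1 - k * d).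
      { rewrite Cmod_mult, Cmod_R, V1, Rabs_pos_eq by lra; ring. }
      exists (Cconj b0), ((1 - k * d)%R * v)%C; repeat split.
      * rewrite Cmod_conj; unfold d in *; lra.
      * lra.
      * rewrite V2.
        replace ((1 - k * d)%R * v - Cmod b0 * v)%C with ((1 - k * d - Cmod b0)%R * v)%C
          by (rewrite !RtoC_minus; ring).
        rewrite Cmod_mult, Cmod_R, V1, Rabs_pos_eq; unfold d in *; lra.
      * apply refl_prod_zero; auto.
      * assert (I3 : forall b, In b bs -> Cmod b = 1 \/ Cmod b <= 1 - d).
        { intros b Hb; destruct (I2 b Hb); [now left|right; unfold d; lra]. }
        assert (L := refl_prod_lower bs _ d k Hd Hk I3 Hw).
        assert (B := bernoulli_sub (2 * k) (length bs) ltac:(lra)).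
        assert (1 / 2 <= (1 - 2 * k) ^ length bs).
        { eapply Rle_trans; [|apply B].
          unfold k, kappa; assert (Hm := pos_INR (length bs)).
          apply Rmult_le_reg_r with (2 * (INR (length bs) + 1)); [lra|].
          field_simplify; lra. }
        assert (0 <= Cmod (lin_prod bs ((1 - k * d)%R * v)%C)) by apply Cmod_ge_0.
        nra.
Qed.

(** * Continuity of complex-valued functions *)

(** The distance is a parameter so that one set of closure rules serves the complex plane, the line
    and pairs of reals. *)
Definition contC {X : Type} (d : X -> X -> R) (f : X -> C) (x : X) : Prop :=
  forall eps, 0 < eps -> exists delta, 0 < delta /\
    forall y, d y x < delta -> Cmod (f y - f x)%C < eps.

Lemma contC_ext {X} (d : X -> X -> R) (f g : X -> C) x :
  (forall y, f y = g y) -> contC d f x -> contC d g x.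
Proof.
  intros E H eps He; destruct (H eps He) as (dl & D & Hd).
  exists dl; split; auto; intros y Hy; rewrite <- !E; auto.
Qed.

Lemma contC_const {X} (d : X -> X -> R) c x : contC d (fun _ => c) x.
Proof.
  intros eps He; exists 1; split; [lra|]; intros y _.
  replace (c - c)%C with (RtoC 0) by ring; rewrite Cmod_0; auto.
Qed.

Lemma contC_plus {X} (d : X -> X -> R) (f g : X -> C) x :
  contC d f x -> contC d g x -> contC d (fun y => f y + g y)%C x.
Proof.
  intros Hf Hg eps He.
  destruct (Hf (eps / 2)) as (d1 & D1 & H1); [lra|].
  destruct (Hg (eps / 2)) as (d2 & D2 & H2); [lra|].
  exists (Rmin d1 d2); split; [apply Rmin_pos; auto|]; intros y Hy.
  specialize (H1 y (Rlt_le_trans _ _ _ Hy (Rmin_l _ _))).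
  specialize (H2 y (Rlt_le_trans _ _ _ Hy (Rmin_r _ _))).
  replace (f y + g y - (f x + g x))%C with ((f y - f x) + (g y - g x))%C by ring.
  eapply Rle_lt_trans; [apply Cmod_triangle|]; lra.
Qed.

Lemma contC_mult {X} (d : X -> X -> R) (f g : X -> C) x :
  contC d f x -> contC d g x -> contC d (fun y => f y * g y)%C x.
Proof.
  intros Hf Hg eps He.
  assert (A0 := Cmod_ge_0 (f x)); assert (B0 := Cmod_ge_0 (g x)).
  set (M := 1 + Cmod (f x) + Cmod (g x)).
  assert (M0 : 0 < M) by (unfold M; lra).
  set (e := Rmin 1 (eps / M)).
  assert (e0 : 0 < e) by (apply Rmin_pos; [lra|apply Rdiv_lt_0_compat; auto]).
  assert (e1 : e <= 1) by apply Rmin_l.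
  assert (e2 : e * M <= eps).
  { apply Rle_trans with (eps / M * M); [|right; field; lra].
    apply Rmult_le_compat_r; [lra|apply Rmin_r]. }
  destruct (Hf e e0) as (d1 & D1 & H1); destruct (Hg e e0) as (d2 & D2 & H2).
  exists (Rmin d1 d2); split; [apply Rmin_pos; auto|]; intros y Hy.
  specialize (H1 y (Rlt_le_trans _ _ _ Hy (Rmin_l _ _))).
  specialize (H2 y (Rlt_le_trans _ _ _ Hy (Rmin_r _ _))).
  replace (f y * g y - f x * g x)%C
    with ((f y - f x) * (g y - g x) + ((f y - f x) * g x + f x * (g y - g x)))%C by ring.
  eapply Rle_lt_trans; [apply Cmod_triangle|].
  eapply Rle_lt_trans; [apply Rplus_le_compat_l, Cmod_triangle|].
  rewrite !Cmod_mult.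
  assert (P := Cmod_ge_0 (f y - f x)%C); assert (Q := Cmod_ge_0 (g y - g x)%C).
  unfold M in e2; nra.
Qed.

Lemma contC_opp {X} (d : X -> X -> R) (f : X -> C) x : contC d f x -> contC d (fun y => - f y)%C x.
Proof.
  intros H; apply contC_ext with (fun y => (- (1)) * f y)%C.
  - intros y; ring.
  - apply contC_mult; auto; apply contC_const.
Qed.

Lemma contC_minus {X} (d : X -> X -> R) (f g : X -> C) x :
  contC d f x -> contC d g x -> contC d (fun y => f y - g y)%C x.
Proof. intros Hf Hg; apply contC_plus; auto; apply contC_opp; auto. Qed.

Lemma contC_inv {X} (d : X -> X -> R) (f : X -> C) x :
  f x <> 0%C -> contC d f x -> contC d (fun y => / f y)%C x.
Proof.
  intros Nz H eps He.
  assert (A0 : 0 < Cmod (f x)) by (apply Cmod_gt_0; exact Nz).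
  set (a := Cmod (f x)) in *.
  destruct (H (Rmin (a / 2) (eps * a * a / 2))) as (d1 & D1 & H1).
  { apply Rmin_pos; [lra|].
    assert (0 < eps * a * a) by (repeat apply Rmult_lt_0_compat; auto); lra. }
  exists d1; split; auto; intros y Hy; specialize (H1 y Hy).
  assert (L1 := Rlt_le_trans _ _ _ H1 (Rmin_l _ _)).
  assert (L2 := Rlt_le_trans _ _ _ H1 (Rmin_r _ _)).
  assert (T := Cmod_triangle (f y) (f x - f y)%C).
  replace (f y + (f x - f y))%C with (f x) in T by ring.
  replace (f x - f y)%C with (- (f y - f x))%C in T by ring.
  rewrite Cmod_opp in T; fold a in T.
  assert (B0 : a / 2 < Cmod (f y)) by lra.
  assert (Ny : f y <> 0%C) by (apply Cmod_gt_0; lra).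
  replace (/ f y - / f x)%C with (- ((f y - f x) / (f y * f x)))%C by (field; auto).
  rewrite Cmod_opp, Cmod_div, Cmod_mult by (apply Cmult_neq_0; auto).
  fold a; set (b := Cmod (f y)) in *.
  assert (0 < b * a) by (apply Rmult_lt_0_compat; lra).
  apply Rmult_lt_reg_r with (b * a); auto.
  unfold Rdiv; rewrite Rmult_assoc, Rinv_l, Rmult_1_r by lra.
  eapply Rlt_trans; [apply L2|].
  assert (eps * a * (a / 2) < eps * a * b).
  { apply Rmult_lt_compat_l; [apply Rmult_lt_0_compat; auto|auto]. }
  lra.
Qed.

Lemma contC_div {X} (d : X -> X -> R) (f g : X -> C) x :
  g x <> 0%C -> contC d f x -> contC d g x -> contC d (fun y => f y / g y)%C x.
Proof. intros N Hf Hg; apply contC_mult; auto; apply contC_inv; auto. Qed.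

Lemma contC_csum {X} (d : X -> X -> R) (f : nat -> X -> C) N x :
  (forall k, (k <= N)%nat -> contC d (f k) x) -> contC d (fun y => csum (fun k => f k y) N) x.
Proof.
  induction N as [|N IH]; intros H; [apply H; lia|].
  apply contC_plus; [apply IH; auto|apply H; lia].
Qed.

Lemma contC_pow {X} (d : X -> X -> R) (f : X -> C) k x :
  contC d f x -> contC d (fun y => Cpow (f y) k) x.
Proof.
  intros H; induction k as [|k IH]; [exact (contC_const d 1%C x)|].
  exact (contC_mult d _ _ x H IH).
Qed.

Lemma contC_conj {X} (d : X -> X -> R) (f : X -> C) x :
  contC d f x -> contC d (fun y => Cconj (f y)) x.
Proof.
  intros H eps He; destruct (H eps He) as (dl & D & Hd); exists dl; split; auto.
  intros y Hy; specialize (Hd y Hy).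
  replace (Cconj (f y) - Cconj (f x))%C with (Cconj (f y - f x)%C); [rewrite Cmod_conj; auto|].
  unfold Cminus; rewrite Cplus_conj, Copp_conj; reflexivity.
Qed.

Definition distC (y x : C) : R := Cmod (y - x)%C.
Definition distR (y x : R) : R := Rabs (y - x).
Definition distRR (y x : R * R) : R :=
  Rmax (Rabs (fst y - fst x)) (Rabs (snd y - snd x)).

Lemma contC_id x : contC distC (fun z => z) x.
Proof. intros eps He; exists eps; split; auto. Qed.

Lemma contC_comp {X} (d : X -> X -> R) (f : C -> C) (g : X -> C) x :
  contC d g x -> contC distC f (g x) -> contC d (fun y => f (g y)) x.
Proof.
  intros Hg Hf eps He; destruct (Hf eps He) as (d1 & D1 & H1).
  destruct (Hg d1 D1) as (d2 & D2 & H2); exists d2; split; auto.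
  intros y Hy; apply H1, H2, Hy.
Qed.

Lemma Cmod_lt_of_parts (z : C) e : Rabs (fst z) < e / 2 -> Rabs (snd z) < e / 2 -> Cmod z < e.
Proof.
  intros H1 H2.
  assert (T := Cmod_triangle (RtoC (fst z)) (Ci * RtoC (snd z))%C).
  replace (RtoC (fst z) + Ci * RtoC (snd z))%C with z in T.
  - rewrite Cmod_mult, !Cmod_R, Cmod_Ci in T; lra.
  - destruct z; unfold Ci, RtoC, Cplus, Cmult; simpl; f_equal; ring.
Qed.

Lemma contC_RtoC {X} (d : X -> X -> R) (f : X -> R) x :
  (forall eps, 0 < eps -> exists dl, 0 < dl /\ forall y, d y x < dl -> Rabs (f y - f x) < eps) ->
  contC d (fun y => RtoC (f y)) x.
Proof.
  intros H eps He; destruct (H eps He) as (dl & D & Hd); exists dl; split; auto.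
  intros y Hy; rewrite <- RtoC_minus, Cmod_R; auto.
Qed.

Lemma continuity_eps (f : R -> R) x : continuity f ->
  forall eps, 0 < eps -> exists dl, 0 < dl /\ forall y, Rabs (y - x) < dl -> Rabs (f y - f x) < eps.
Proof.
  intros H eps He; destruct (H x eps He) as (dl & D & Hd).
  exists dl; split; auto; intros y Hy.
  destruct (Req_dec x y) as [->|N].
  - rewrite Rminus_eq_0, Rabs_R0; auto.
  - apply (Hd y); repeat split; auto.
Qed.

(** * The circle in polar coordinates *)

Definition cis (t : R) : C := (cos t, sin t).

Lemma polar_cis r t : polar r t = (RtoC r * cis t)%C.
Proof. unfold polar, cis, RtoC, Cmult; simpl; f_equal; ring. Qed.

Lemma Cmod_cis t : Cmod (cis t) = 1.
Proof.
  unfold Cmod, cis; simpl fst; simpl snd.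
  replace (cos t ^ 2 + sin t ^ 2) with 1; [apply sqrt_1|].
  rewrite <- (sin2_cos2 t); unfold Rsqr; ring.
Qed.

Lemma Cmod_polar r t : 0 <= r -> Cmod (polar r t) = r.
Proof. intros H; rewrite polar_cis, Cmod_mult, Cmod_cis, Cmod_R, Rabs_pos_eq; lra. Qed.

Lemma cis_cont t : contC distR cis t.
Proof.
  intros eps He.
  destruct (continuity_eps cos t continuity_cos (eps / 2)) as (d1 & D1 & H1); [lra|].
  destruct (continuity_eps sin t continuity_sin (eps / 2)) as (d2 & D2 & H2); [lra|].
  exists (Rmin d1 d2); split; [apply Rmin_pos; auto|]; intros y Hy.
  apply Cmod_lt_of_parts; simpl.
  - apply H1; exact (Rlt_le_trans _ _ _ Hy (Rmin_l _ _)).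
  - apply H2; exact (Rlt_le_trans _ _ _ Hy (Rmin_r _ _)).
Qed.

Lemma polar_cont_fst r p : contC distRR (fun q => polar r (fst q)) p.
Proof.
  apply contC_ext with (fun q => RtoC r * cis (fst q))%C; [intros; rewrite polar_cis; auto|].
  apply contC_mult; [apply contC_const|].
  intros eps He; destruct (cis_cont (fst p) eps He) as (dl & D & H).
  exists dl; split; auto; intros y Hy; apply H.
  exact (Rle_lt_trans _ _ _ (Rmax_l _ _) Hy).
Qed.

Lemma polar_cont_snd r p : contC distRR (fun q => polar r (snd q)) p.
Proof.
  apply contC_ext with (fun q => RtoC r * cis (snd q))%C; [intros; rewrite polar_cis; auto|].
  apply contC_mult; [apply contC_const|].
  intros eps He; destruct (cis_cont (snd p) eps He) as (dl & D & H).
  exists dl; split; auto; intros y Hy; apply H.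
  exact (Rle_lt_trans _ _ _ (Rmax_r _ _) Hy).
Qed.

Lemma polar_cont r t : contC distR (polar r) t.
Proof.
  apply contC_ext with (fun q => RtoC r * cis q)%C; [intros; rewrite polar_cis; auto|].
  apply contC_mult; [apply contC_const|apply cis_cont].
Qed.

Lemma polar_cont_pair p : contC distRR (fun q => polar (fst q) (snd q)) p.
Proof.
  apply contC_ext with (fun q => RtoC (fst q) * cis (snd q))%C; [intros; rewrite polar_cis; auto|].
  apply contC_mult.
  - apply contC_RtoC; intros eps He; exists eps; split; auto; intros y Hy.
    exact (Rle_lt_trans _ _ _ (Rmax_l _ _) Hy).
  - intros eps He; destruct (cis_cont (snd p) eps He) as (dl & D & H).
    exists dl; split; auto; intros y Hy; apply H.
    exact (Rle_lt_trans _ _ _ (Rmax_r _ _) Hy).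
Qed.

Lemma continuous_of_eps (f : R -> R) x :
  (forall eps, 0 < eps -> exists dl, 0 < dl /\ forall y, Rabs (y - x) < dl -> Rabs (f y - f x) < eps) ->
  continuous f x.
Proof.
  intros H P [e HP]; destruct (H e (cond_pos e)) as (dl & D & Hd).
  exists (mkposreal dl D); intros y Hy; apply HP, Hd, Hy.
Qed.

Lemma continuous_Re f x : contC distR f x -> continuous (fun t => Re (f t)) x.
Proof.
  intros H; apply continuous_of_eps; intros eps He.
  destruct (H eps He) as (dl & D & Hd); exists dl; split; auto; intros y Hy.
  eapply Rle_lt_trans; [|apply (Hd y Hy)].
  replace (Re (f y) - Re (f x)) with (Re (f y - f x)%C) by reflexivity.
  apply re_le_Cmod.
Qed.

Lemma Cmod_reverse_triangle (a b : C) : Rabs (Cmod a - Cmod b) <= Cmod (a - b)%C.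
Proof.
  assert (T1 := Cmod_triangle (a - b)%C b); replace (a - b + b)%C with a in T1 by ring.
  assert (T2 := Cmod_triangle (b - a)%C a); replace (b - a + a)%C with b in T2 by ring.
  replace (b - a)%C with (- (a - b))%C in T2 by ring; rewrite Cmod_opp in T2.
  apply Rabs_le; lra.
Qed.

Lemma continuous_Cmod f x : contC distR f x -> continuous (fun t => Cmod (f t)) x.
Proof.
  intros H; apply continuous_of_eps; intros eps He.
  destruct (H eps He) as (dl & D & Hd); exists dl; split; auto; intros y Hy.
  eapply Rle_lt_trans; [apply Cmod_reverse_triangle|apply (Hd y Hy)].
Qed.

Lemma continuity_2d_Cmod (f : R -> R -> C) x y :
  contC distRR (fun q => f (fst q) (snd q)) (x, y) ->
  continuity_2d_pt (fun u v => Cmod (f u v)) x y.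
Proof.
  intros H eps; destruct (H eps (cond_pos eps)) as (dl & D & Hd).
  exists (mkposreal dl D); intros u v Hu Hv; simpl in *.
  eapply Rle_lt_trans; [apply Cmod_reverse_triangle|apply (Hd (u, v))].
  apply Rmax_lub_lt; auto.
Qed.

Lemma ex_RInt_continuous_all (f : R -> R) a b : (forall x, continuous f x) -> ex_RInt f a b.
Proof. intros H; apply (ex_RInt_continuous (V := R_CompleteNormedModule)); auto. Qed.

(** * Geometrically convergent power series *)

(** Uniform convergence on the closed disc of radius [r] with a geometric rate. The rate survives
    division by [1 - b z] when [|b| r < 1], and it passes through integrals as an explicit error. *)
Definition geo (r : R) (f : nat -> C) (F : C -> C) : Prop :=
  exists K th, 0 <= K /\ 0 < th < 1 /\
    forall z, Cmod z <= r -> forall L, Cmod (psum f L z - F z)%C <= K * th ^ L.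

Lemma geo_ext r f F G : (forall z, Cmod z <= r -> F z = G z) -> geo r f F -> geo r f G.
Proof.
  intros E (K & th & H1 & H2 & H); exists K, th; repeat split; try lra.
  intros z Hz L; rewrite <- E; auto.
Qed.

Lemma geo_scale r a f F : geo r f F -> geo r (scale a f) (fun z => a * F z)%C.
Proof.
  intros (K & th & H1 & H2 & H); exists (Cmod a * K), th.
  repeat split; try lra; [apply Rmult_le_pos; auto; apply Cmod_ge_0|].
  intros z Hz L; rewrite psum_scale.
  replace (a * psum f L z - a * F z)%C with (a * (psum f L z - F z))%C by ring.
  rewrite Cmod_mult, Rmult_assoc; apply Rmult_le_compat_l; [apply Cmod_ge_0|auto].
Qed.

Lemma psum_plus f g N z : psum (fun k => f k + g k)%C N z = (psum f N z + psum g N z)%C.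
Proof. unfold psum; rewrite <- csum_plus; apply csum_ext; intros; ring. Qed.

Lemma pow_le_base x y n : 0 <= x <= y -> x ^ n <= y ^ n.
Proof. intros H; apply pow_incr; auto. Qed.

Lemma pow_le_one x n : 0 <= x <= 1 -> x ^ n <= 1.
Proof. intros H; rewrite <- (pow1 n); apply pow_incr; auto. Qed.

Lemma geo_plus r f g F G : geo r f F -> geo r g G ->
  geo r (fun k => f k + g k)%C (fun z => F z + G z)%C.
Proof.
  intros (K & th & H1 & H2 & H) (K' & th' & H1' & H2' & H').
  exists (K + K'), (Rmax th th').
  assert (M1 := Rmax_l th th'); assert (M2 := Rmax_r th th').
  repeat split; try lra; [apply Rmax_lub_lt; lra|].
  intros z Hz L; rewrite psum_plus.
  replace (psum f L z + psum g L z - (F z + G z))%C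
    with ((psum f L z - F z) + (psum g L z - G z))%C by ring.
  eapply Rle_trans; [apply Cmod_triangle|].
  specialize (H z Hz L); specialize (H' z Hz L).
  assert (K * th ^ L <= K * Rmax th th' ^ L)
    by (apply Rmult_le_compat_l; auto; apply pow_le_base; lra).
  assert (K' * th' ^ L <= K' * Rmax th th' ^ L)
    by (apply Rmult_le_compat_l; auto; apply pow_le_base; lra).
  lra.
Qed.

Lemma psum_bound f N z r : Cmod z <= r ->
  Cmod (psum f N z) <= sum_f_R0 (fun k => Cmod (f k) * r ^ k) N.
Proof.
  intros Hz; eapply Rle_trans; [apply csum_mod|].
  apply sum_Rle; intros k _; rewrite Cmod_mult, Cmod_pow.
  apply Rmult_le_compat_l; [apply Cmod_ge_0|].
  apply pow_incr; split; auto; apply Cmod_ge_0.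
Qed.

Lemma sum_f_R0_mono f M N : (forall k, 0 <= f k) -> (M <= N)%nat ->
  sum_f_R0 f M <= sum_f_R0 f N.
Proof.
  intros H HN; induction HN as [|N HN IH]; [lra|]; simpl; assert (Hk := H (S N)); lra.
Qed.

Lemma geo_poly r d f : 0 <= r -> supp d f -> geo r f (psum f d).
Proof.
  intros Hr Hs.
  set (B := sum_f_R0 (fun k => Cmod (f k) * r ^ k) d).
  assert (P : forall k, 0 <= Cmod (f k) * r ^ k)
    by (intros; apply Rmult_le_pos; [apply Cmod_ge_0|apply pow_le; auto]).
  assert (B0 : 0 <= B) by (apply sum_nonneg; auto).
  assert (T : 0 < (1 / 2) ^ d) by (apply pow_lt; lra).
  (* From order [d] on the error is zero; before, it is at most [2 * B], and dividing by
     [(1 / 2) ^ d] makes the bound hold at all these orders. *)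
  exists (2 * B / (1 / 2) ^ d), (1 / 2); repeat split; try lra.
  { apply Rmult_le_pos; [lra|left; apply Rinv_0_lt_compat; auto]. }
  intros z Hz L; destruct (Nat.le_gt_cases d L) as [HL|HL].
  - rewrite (psum_supp d) by auto.
    replace (psum f d z - psum f d z)%C with (RtoC 0) by ring; rewrite Cmod_0.
    apply Rmult_le_pos; [|apply pow_le; lra].
    apply Rmult_le_pos; [lra|left; apply Rinv_0_lt_compat; auto].
  - apply Rle_trans with (2 * B).
    + unfold Cminus; eapply Rle_trans; [apply Cmod_triangle|]; rewrite Cmod_opp.
      assert (H1 := psum_bound f L z r Hz); assert (H2 := psum_bound f d z r Hz).
      fold B in H2.
      assert (H3 := sum_f_R0_mono _ L d P ltac:(lia)); fold B in H3; lra.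
    + replace (2 * B) with (2 * B / (1 / 2) ^ d * (1 / 2) ^ d) at 1 by (field; lra).
      apply Rmult_le_compat_l.
      * apply Rmult_le_pos; [lra|left; apply Rinv_0_lt_compat; auto].
      * replace d with (L + (d - L))%nat by lia; rewrite pow_add.
        assert (0 < (1 / 2) ^ L) by (apply pow_lt; lra).
        assert ((1 / 2) ^ (d - L) <= 1) by (apply pow_le_one; lra).
        nra.
Qed.

Lemma lin_neq_0 (b z : C) : Cmod b * Cmod z < 1 -> (1 - b * z <> 0)%C.
Proof.
  intros H E; assert (G := Cmod_1_sub_ge b z); rewrite E, Cmod_0 in G; lra.
Qed.

Lemma geo_div_lin r b f F : 0 <= r -> Cmod b * r < 1 -> geo r f F ->
  geo r (div_lin b f) (fun z => F z / (1 - b * z))%C.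
Proof.
  intros Hr Hb (K & th & K0 & Ht & H).
  set (tau := Cmod b * r) in *.
  assert (tau0 : 0 <= tau) by (apply Rmult_le_pos; auto; apply Cmod_ge_0).
  set (th' := Rmax th ((1 + tau) / 2)).
  assert (M1 : th <= th') by apply Rmax_l.
  assert (M2 : (1 + tau) / 2 <= th') by apply Rmax_r.
  assert (M3 : th' < 1) by (apply Rmax_lub_lt; lra).
  assert (f0 := Cmod_ge_0 (f O)).
  (* The errors of the quotient satisfy [e_(L+1) = error of f + b z e_L], a contraction by [tau].
     The last summand of [K'] gives [K <= K' (th' - tau)], which closes the induction; the other two
     cover order 0. *)
  set (K' := Cmod (f O) + (Cmod (f O) + K) / (1 - tau) + K / (th' - tau)).
  assert (A1 : 0 <= (Cmod (f O) + K) / (1 - tau))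
    by (apply Rmult_le_pos; [lra|left; apply Rinv_0_lt_compat; lra]).
  assert (A2 : 0 <= K / (th' - tau))
    by (apply Rmult_le_pos; [lra|left; apply Rinv_0_lt_compat; lra]).
  assert (HK' : 0 <= K') by (unfold K'; lra).
  exists K', th'; split; [auto|split; [lra|]].
  intros z Hz.
  assert (bz : Cmod b * Cmod z <= tau)
    by (apply Rmult_le_compat_l; auto; apply Cmod_ge_0).
  assert (N : (1 - b * z <> 0)%C) by (apply lin_neq_0; lra).
  assert (D : 1 - tau <= Cmod (1 - b * z)%C)
    by (eapply Rle_trans; [|apply Cmod_1_sub_ge]; lra).
  induction L as [|L IH].
  - rewrite pow_O, Rmult_1_r.
    unfold Cminus at 1; eapply Rle_trans; [apply Cmod_triangle|].
    rewrite Cmod_opp, Cmod_div by auto.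
    assert (E0 : psum (div_lin b f) 0 z = f O) by (unfold psum; simpl; ring).
    rewrite E0.
    assert (H0 := H z Hz O); rewrite pow_O, Rmult_1_r in H0.
    replace (psum f 0 z) with (f O) in H0 by (unfold psum; simpl; ring).
    assert (T := Cmod_triangle (f O) (- (f O - F z))%C).
    replace (f O + - (f O - F z))%C with (F z) in T by ring; rewrite Cmod_opp in T.
    assert (Cmod (F z) / Cmod (1 - b * z)%C <= (Cmod (f O) + K) / (1 - tau)).
    { apply Rmult_le_compat; [apply Cmod_ge_0| |lra|].
      - left; apply Rinv_0_lt_compat; lra.
      - apply Rinv_le_contravar; lra. }
    unfold K'; lra.
  - rewrite psum_div_lin.
    replace (psum f (S L) z + b * z * psum (div_lin b f) L z - F z / (1 - b * z))%C
      with ((psum f (S L) z - F z) + b * z * (psum (div_lin b f) L z - F z / (1 - b * z)))%C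
      by (field; auto).
    eapply Rle_trans; [apply Cmod_triangle|].
    rewrite !Cmod_mult.
    assert (HL := H z Hz (S L)).
    assert (HL' : K * th ^ S L <= K * th' ^ S L)
      by (apply Rmult_le_compat_l; auto; apply pow_le_base; lra).
    assert (Cmod b * Cmod z * Cmod (psum (div_lin b f) L z - F z / (1 - b * z))%C
      <= tau * (K' * th' ^ L)).
    { apply Rmult_le_compat; auto; [|apply Cmod_ge_0].
      apply Rmult_le_pos; apply Cmod_ge_0. }
    assert (P : 0 <= th' ^ L) by (apply pow_le; lra).
    assert (K <= K' * (th' - tau)).
    { apply Rle_trans with (K / (th' - tau) * (th' - tau)); [right; field; lra|].
      apply Rmult_le_compat_r; [lra|unfold K'; lra]. }
    change (th' ^ S L) with (th' * th' ^ L) in *.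
    assert (K * (th' * th' ^ L) <= K' * (th' - tau) * th' ^ L).
    { apply Rle_trans with (K * th' ^ L); [|apply Rmult_le_compat_r; auto].
      apply Rmult_le_compat_l; auto; nra. }
    lra.
Qed.

Lemma lin_prod_neq_0 bs z : (forall b, In b bs -> Cmod b * Cmod z < 1) -> lin_prod bs z <> 0%C.
Proof.
  induction bs as [|b bs IH]; intros H; simpl; [apply C1_nz|].
  apply Cmult_neq_0; [apply lin_neq_0, H; now left|apply IH; intros; apply H; now right].
Qed.

Lemma geo_div_lins r bs f F : 0 <= r -> (forall b, In b bs -> Cmod b * r < 1) -> geo r f F ->
  geo r (div_lins bs f) (fun z => F z / lin_prod bs z)%C.
Proof.
  intros Hr; induction bs as [|b bs IH]; intros Hb H.
  - apply (geo_ext r f F); auto; intros z _; simpl; field.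
  - apply geo_ext with (fun z => F z / lin_prod bs z / (1 - b * z))%C.
    + intros z Hz; simpl; field.
      assert (forall a, In a (b :: bs) -> Cmod a * Cmod z < 1).
      { intros a Ha; eapply Rle_lt_trans; [|apply (Hb a Ha)].
        apply Rmult_le_compat_l; auto; apply Cmod_ge_0. }
      split; [|apply lin_neq_0; auto; apply H0; now left].
      apply lin_prod_neq_0; intros; apply H0; now right.
    + apply geo_div_lin; auto; [apply Hb; now left|].
      apply IH; auto; intros; apply Hb; now right.
Qed.

Lemma geo_unique_limit K th x y (u : nat -> R) : 0 < th < 1 ->
  (forall L, Rabs (u L - x) <= K * th ^ L) -> (forall L, Rabs (u L - y) <= K * th ^ L) -> x = y.
Proof.
  intros Ht Hx Hy.
  destruct (Req_dec x y) as [E|N]; auto; exfalso.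
  assert (P : 0 < Rabs (x - y)) by (apply Rabs_pos_lt; lra).
  assert (K0 : 0 <= K).
  { assert (H := Hx O); rewrite pow_O in H; assert (H' := Rabs_pos (u O - x)); lra. }
  destruct (pow_lt_1_zero th) with (y := Rabs (x - y) / (2 * K + 1)) as [N0 HN].
  - rewrite Rabs_pos_eq; lra.
  - apply Rdiv_lt_0_compat; lra.
  - specialize (HN N0 (le_n _)); rewrite Rabs_pos_eq in HN by (apply pow_le; lra).
    assert (H1 := Hx N0); assert (H2 := Hy N0).
    assert (T : Rabs (x - y) <= Rabs (u N0 - x) + Rabs (u N0 - y)).
    { replace (x - y) with (- (u N0 - x) + (u N0 - y)) by ring.
      eapply Rle_trans; [apply Rabs_triang|]; rewrite Rabs_Ropp; lra. }
    apply Rmult_lt_compat_r with (r := 2 * K + 1) in HN; [|lra].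
    replace (Rabs (x - y) / (2 * K + 1) * (2 * K + 1)) with (Rabs (x - y)) in HN by (field; lra).
    assert (0 < th ^ N0) by (apply pow_lt; lra).
    nra.
Qed.

(** * Parseval and Poisson formulas *)

Lemma cis_pow t k : Cpow (cis t) k = cis (INR k * t).
Proof.
  induction k as [|k IH].
  - unfold cis; simpl; rewrite Rmult_0_l, cos_0, sin_0; reflexivity.
  - rewrite Cpow_S, IH, S_INR; replace ((INR k + 1) * t) with (t + INR k * t) by ring.
    unfold cis, Cmult; simpl; rewrite cos_plus, sin_plus; f_equal; ring.
Qed.

Lemma is_RInt_monomial (c : C) k : (0 < k)%nat ->
  is_RInt (fun t => Re (c * Cpow (cis t) k)%C) 0 (2 * PI) 0.
Proof.
  intros Hk.
  assert (K0 : INR k <> 0) by (apply not_0_INR; lia).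
  set (F := fun t => (fst c * sin (INR k * t) + snd c * cos (INR k * t)) / INR k).
  set (f := fun t => fst c * cos (INR k * t) - snd c * sin (INR k * t)).
  apply (is_RInt_ext f).
  { intros t _; rewrite cis_pow; unfold f, Re, cis, Cmult; simpl; ring. }
  assert (E : 0 = minus (F (2 * PI)) (F 0)).
  { unfold F, minus, plus, opp; simpl.
    replace (INR k * (2 * PI)) with (0 + 2 * INR k * PI) by ring.
    rewrite sin_period, cos_period, Rmult_0_r; field; auto. }
  enough (X : is_RInt f 0 (2 * PI) (minus (F (2 * PI)) (F 0))) by (rewrite <- E in X; exact X).
  apply (is_RInt_derive F f).
  - intros t _; unfold F, f; auto_derive; auto; field; auto.
  - intros t _; apply (ex_derive_continuous f); unfold f; auto_derive; auto.
Qed.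

Lemma Cconj_RtoC (x : R) : Cconj (RtoC x) = RtoC x.
Proof. unfold Cconj, RtoC; simpl; f_equal; ring. Qed.

Lemma Cpow_conj z k : Cconj (Cpow z k) = Cpow (Cconj z) k.
Proof.
  induction k as [|k IH]; [apply Cconj_RtoC|]; rewrite !Cpow_S, Cmult_conj, IH; auto.
Qed.

Lemma Cpow_RtoC (r : R) k : Cpow (RtoC r) k = RtoC (r ^ k).
Proof. induction k as [|k IH]; [reflexivity|]; rewrite Cpow_S, IH, <- RtoC_mult; auto. Qed.

Lemma cis_conj_pow t k : (Cpow (cis t) k * Cconj (Cpow (cis t) k) = 1)%C.
Proof. rewrite <- Cmod2_conj, Cmod_pow, Cmod_cis, pow1; f_equal; ring. Qed.

Lemma polar_pow r t k : Cpow (polar r t) k = (RtoC (r ^ k) * Cpow (cis t) k)%C.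
Proof. rewrite polar_cis, Cpow_mult_l, Cpow_RtoC; auto. Qed.

(** Orthogonality: after cancelling conjugate powers only the positive frequencies [N - k]
    remain. *)
Lemma is_RInt_cross (a : C) f r N L : (L < N)%nat ->
  is_RInt (fun t => Re (a * Cpow (polar r t) N * Cconj (psum f L (polar r t)))%C) 0 (2 * PI) 0.
Proof.
  assert (M : forall k, (k < N)%nat ->
    is_RInt (fun t => Re (a * Cpow (polar r t) N * Cconj (f k * Cpow (polar r t) k))%C) 0 (2 * PI) 0).
  { intros k Hk.
    apply (is_RInt_ext (fun t => Re (a * RtoC (r ^ N) * Cconj (f k) * RtoC (r ^ k)
      * Cpow (cis t) (N - k))%C)); [|apply is_RInt_monomial; lia].
    intros t _; f_equal.
    rewrite Cmult_conj, !polar_pow, Cmult_conj, Cconj_RtoC.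
    replace (Cpow (cis t) N) with (Cpow (cis t) (N - k) * Cpow (cis t) k)%C
      by (rewrite <- Cpow_add_r; f_equal; lia).
    transitivity (a * RtoC (r ^ N) * Cconj (f k) * RtoC (r ^ k) * Cpow (cis t) (N - k)
      * (Cpow (cis t) k * Cconj (Cpow (cis t) k)))%C; [|ring].
    rewrite cis_conj_pow; ring. }
  induction L as [|L IH]; intros HL.
  - apply M; auto.
  - replace 0 with (plus 0 0) at 2 by (unfold plus; simpl; ring).
    apply (is_RInt_ext (fun t => plus
      (Re (a * Cpow (polar r t) N * Cconj (psum f L (polar r t)))%C)
      (Re (a * Cpow (polar r t) N * Cconj (f (S L) * Cpow (polar r t) (S L)))%C))).
    + intros t _; rewrite psum_S, Cplus_conj, Cmult_plus_distr_l; reflexivity.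
    + apply (is_RInt_plus (V := R_NormedModule)); [apply IH; lia|apply M; auto].
Qed.

Lemma Re_conj z : Re (Cconj z) = Re z.
Proof. reflexivity. Qed.

Definition pairing (f g : nat -> C) (r : R) (L : nat) : C :=
  csum (fun k => f k * Cconj (g k) * RtoC (r ^ (2 * k)))%C L.

Lemma is_RInt_parseval_finite f g r L :
  is_RInt (fun t => Re (psum f L (polar r t) * Cconj (psum g L (polar r t)))%C)
    0 (2 * PI) (2 * PI * Re (pairing f g r L)).
Proof.
  assert (D : forall k, is_RInt (fun t => Re (f k * Cpow (polar r t) k
      * Cconj (g k * Cpow (polar r t) k))%C) 0 (2 * PI)
      (2 * PI * Re (f k * Cconj (g k) * RtoC (r ^ (2 * k)))%C)).
  { intros k.
    apply (is_RInt_ext (fun _ => Re (f k * Cconj (g k) * RtoC (r ^ (2 * k)))%C)).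
    - intros t _; f_equal.
      rewrite Cmult_conj, !polar_pow, Cmult_conj, Cconj_RtoC.
      transitivity (f k * Cconj (g k) * (RtoC (r ^ k) * RtoC (r ^ k))
        * (Cpow (cis t) k * Cconj (Cpow (cis t) k)))%C; [|ring].
      rewrite cis_conj_pow, <- RtoC_mult, <- pow_add.
      replace (k + k)%nat with (2 * k)%nat by lia; ring.
    - replace (2 * PI * Re (f k * Cconj (g k) * RtoC (r ^ (2 * k)))%C)
        with (scal (2 * PI - 0) (Re (f k * Cconj (g k) * RtoC (r ^ (2 * k)))%C))
        by (unfold scal; simpl; unfold mult; simpl; ring).
      apply (is_RInt_const (V := R_NormedModule)). }
  induction L as [|L IH]; [apply D|].
  apply (is_RInt_ext (fun t => plus (plus (plus
      (Re (psum f L (polar r t) * Cconj (psum g L (polar r t)))%C)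
      (Re (g (S L) * Cpow (polar r t) (S L) * Cconj (psum f L (polar r t)))%C))
      (Re (f (S L) * Cpow (polar r t) (S L) * Cconj (psum g L (polar r t)))%C))
      (Re (f (S L) * Cpow (polar r t) (S L) * Cconj (g (S L) * Cpow (polar r t) (S L)))%C))).
  - intros t _; rewrite !psum_S.
    set (z := polar r t).
    (* Conjugation does not change a real part, so both cross terms can be brought to the form of
       [is_RInt_cross]. *)
    rewrite <- (Re_conj (g (S L) * _ * _)%C), (Cmult_conj (g (S L) * _)%C), Cconj_conj.
    rewrite Cplus_conj.
    set (a := psum f L z); set (b := psum g L z).
    set (c := (f (S L) * z ^ S L)%C); set (d := (g (S L) * z ^ S L)%C).
    transitivity (Re (a * Cconj b + Cconj d * a + c * Cconj b + c * Cconj d)%C);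
      [reflexivity|f_equal; ring].
  - replace (2 * PI * Re (pairing f g r (S L)))
      with (plus (plus (plus (2 * PI * Re (pairing f g r L)) 0) 0)
        (2 * PI * Re (f (S L) * Cconj (g (S L)) * RtoC (r ^ (2 * S L)))%C)).
    + apply (is_RInt_plus (V := R_NormedModule)); [|apply D].
      apply (is_RInt_plus (V := R_NormedModule)); [|apply is_RInt_cross; lia].
      apply (is_RInt_plus (V := R_NormedModule)); [auto|apply is_RInt_cross; lia].
    + unfold pairing; rewrite csum_S.
      set (a := csum _ L); set (c := (f (S L) * _ * _)%C).
      unfold plus, Re; simpl; ring.
Qed.

Lemma is_RInt_close (u v : R -> R) a b Iu Iv e : a <= b ->
  is_RInt u a b Iu -> is_RInt v a b Iv -> (forall t, a < t < b -> Rabs (u t - v t) <= e) ->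
  Rabs (Iu - Iv) <= (b - a) * e.
Proof.
  intros Hab Hu Hv H.
  assert (D := is_RInt_minus (V := R_NormedModule) _ _ _ _ _ _ Hu Hv).
  assert (C1 := is_RInt_const (V := R_NormedModule) a b e).
  assert (C2 := is_RInt_const (V := R_NormedModule) a b (- e)).
  assert (L1 := is_RInt_le _ _ _ _ _ _ Hab D C1).
  assert (L2 := is_RInt_le _ _ _ _ _ _ Hab C2 D).
  unfold minus, plus, opp, scal in *; simpl in *; unfold mult in *; simpl in *.
  apply Rabs_le; split.
  - assert (X : (b - a) * - e <= Iu + - Iv).
    { apply L2; intros t Hab'; specialize (H t Hab'); apply Rabs_le_between in H; lra. }
    lra.
  - apply L1; intros t Hab'; specialize (H t Hab'); apply Rabs_le_between in H; lra.
Qed.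

Lemma parseval r f g F G I : 0 <= r -> geo r f F -> geo r g G ->
  is_RInt (fun t => Re (F (polar r t) * Cconj (G (polar r t)))%C) 0 (2 * PI) I ->
  exists K th, 0 <= K /\ 0 < th < 1 /\
    forall L, Rabs (Re (pairing f g r L) - I / (2 * PI)) <= K * th ^ L.
Proof.
  intros Hr (K & th & H1 & H2 & H) (K' & th' & H1' & H2' & H') HI.
  assert (M1 := Rmax_l th th'); assert (M2 := Rmax_r th th').
  set (T := Rmax th th') in *.
  assert (T1 : T < 1) by (apply Rmax_lub_lt; lra).
  assert (f0 := Cmod_ge_0 (f O)); assert (g0 := Cmod_ge_0 (g O)).
  (* From [|f_L - F| |G| + |f_L| |g_L - G|], where comparison with order 0 gives [|G| <= |g O| + K']
     and [|f_L| <= |f O| + 2 K]. *)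
  set (Q := K * (Cmod (g O) + K') + (Cmod (f O) + 2 * K) * K').
  assert (HQ : 0 <= Q) by (unfold Q; nra).
  exists Q, T; split; [auto|split; [lra|]]; intros L.
  assert (PI0 := PI_RGT_0).
  assert (E := is_RInt_close _ _ 0 (2 * PI) _ _ (Q * T ^ L) ltac:(lra)
    (is_RInt_parseval_finite f g r L) HI).
  replace (Re (pairing f g r L) - I / (2 * PI))
    with (/ (2 * PI) * (2 * PI * Re (pairing f g r L) - I)) by (field; lra).
  rewrite Rabs_mult, Rabs_pos_eq by (left; apply Rinv_0_lt_compat; lra).
  apply Rmult_le_reg_l with (2 * PI); [lra|].
  rewrite <- Rmult_assoc, Rinv_r, Rmult_1_l by lra.
  eapply Rle_trans; [apply E|right; ring].
  intros t _; set (z := polar r t).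
  assert (Hz : Cmod z <= r) by (unfold z; rewrite Cmod_polar; lra).
  eapply Rle_trans; [|apply Rle_refl].
  replace (Re (psum f L z * Cconj (psum g L z)) - Re (F z * Cconj (G z)))
    with (Re ((psum f L z - F z) * Cconj (G z) + psum f L z * Cconj (psum g L z - G z))%C).
  2: { unfold Cminus at 2; rewrite Cplus_conj, Copp_conj.
       transitivity (Re (psum f L z * Cconj (psum g L z) - F z * Cconj (G z))%C);
         [f_equal; ring|reflexivity]. }
  eapply Rle_trans; [apply re_le_Cmod|].
  eapply Rle_trans; [apply Cmod_triangle|].
  rewrite !Cmod_mult, !Cmod_conj.
  assert (B1 := H z Hz L); assert (B2 := H' z Hz L).
  assert (B3 := H z Hz O); assert (B4 := H' z Hz O).
  rewrite pow_O, Rmult_1_r in B3, B4.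
  replace (psum f 0 z) with (f O) in B3 by (unfold psum; simpl; ring).
  replace (psum g 0 z) with (g O) in B4 by (unfold psum; simpl; ring).
  assert (Tr : forall a b : C, Cmod b <= Cmod a + Cmod (a - b)%C).
  { intros a b; assert (X := Cmod_triangle a (- (a - b))%C).
    replace (a + - (a - b))%C with b in X by ring; rewrite Cmod_opp in X; auto. }
  assert (C1 := Tr (g O) (G z)); assert (C2 := Tr (f O) (F z)).
  assert (C3 := Tr (F z) (psum f L z)).
  replace (F z - psum f L z)%C with (- (psum f L z - F z))%C in C3 by ring.
  rewrite Cmod_opp in C3.
  assert (P1 : th ^ L <= T ^ L) by (apply pow_le_base; lra).
  assert (P2 : th' ^ L <= T ^ L) by (apply pow_le_base; lra).
  assert (P3 : th ^ L <= 1) by (apply pow_le_one; lra).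
  assert (P0 : 0 <= T ^ L) by (apply pow_le; lra).
  assert (B1' : Cmod (psum f L z - F z)%C <= K * T ^ L) by nra.
  assert (B2' : Cmod (psum g L z - G z)%C <= K' * T ^ L) by nra.
  assert (B1'' : Cmod (psum f L z - F z)%C <= K) by nra.
  assert (Cmod (psum f L z - F z)%C * Cmod (G z) <= (K * T ^ L) * (Cmod (g O) + K'))
    by (apply Rmult_le_compat; try apply Cmod_ge_0; lra).
  assert (Cmod (psum f L z) * Cmod (psum g L z - G z)%C <= (Cmod (f O) + 2 * K) * (K' * T ^ L))
    by (apply Rmult_le_compat; try apply Cmod_ge_0; lra).
  unfold Q; lra.
Qed.

Lemma geo_small K th e : 0 <= K -> 0 < th < 1 -> 0 < e ->
  exists N0, forall L, (N0 <= L)%nat -> K * th ^ L < e.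
Proof.
  intros K0 Ht He.
  destruct (pow_lt_1_zero th) with (y := e / (K + 1)) as [N0 HN].
  - rewrite Rabs_pos_eq; lra.
  - apply Rdiv_lt_0_compat; lra.
  - exists N0; intros L HL; specialize (HN L HL).
    rewrite Rabs_pos_eq in HN by (apply pow_le; lra).
    apply Rmult_lt_compat_r with (r := K + 1) in HN; [|lra].
    replace (e / (K + 1) * (K + 1)) with e in HN by (field; lra).
    assert (0 < th ^ L) by (apply pow_lt; lra); nra.
Qed.

Lemma le_geo_limit x y K th N : 0 <= K -> 0 < th < 1 ->
  (forall L, (N <= L)%nat -> x <= y + K * th ^ L) -> x <= y.
Proof.
  intros K0 Ht H; apply le_epsilon; intros e He.
  destruct (geo_small K th e K0 Ht He) as [N0 HN].
  specialize (H (max N N0) ltac:(lia)); specialize (HN (max N N0) ltac:(lia)); lra.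
Qed.

Lemma Re_mult_conj (z : C) : Re (z * Cconj z)%C = Cmod z ^ 2.
Proof. rewrite <- Cmod2_conj; reflexivity. Qed.

Lemma pairing_self f r L :
  Re (pairing f f r L) = sum_f_R0 (fun k => Cmod (f k) ^ 2 * r ^ (2 * k)) L.
Proof.
  unfold pairing.
  assert (T : forall k, Re (f k * Cconj (f k) * RtoC (r ^ (2 * k)))%C
    = Cmod (f k) ^ 2 * r ^ (2 * k)).
  { intros k; rewrite <- Cmod2_conj, <- RtoC_mult; reflexivity. }
  induction L as [|L IH]; [apply T|].
  rewrite csum_S, tech5, <- IH, <- T; reflexivity.
Qed.

Lemma continuous_Cmod2 f x : contC distR f x -> continuous (fun t => Cmod (f t) ^ 2) x.
Proof.
  intros H; apply continuous_ext with (fun t => Re (f t * Cconj (f t))%C).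
  - intros t; apply Re_mult_conj.
  - apply continuous_Re, contC_mult; auto; apply contC_conj; auto.
Qed.

Lemma bessel r f F N : 0 <= r -> geo r f F ->
  (forall t, contC distR (fun t => F (polar r t)) t) ->
  sum_f_R0 (fun k => Cmod (f k) ^ 2 * r ^ (2 * k)) N
  <= RInt (fun t => Cmod (F (polar r t)) ^ 2) 0 (2 * PI) / (2 * PI).
Proof.
  intros Hr Hg Hc.
  assert (HI : is_RInt (fun t => Re (F (polar r t) * Cconj (F (polar r t)))%C) 0 (2 * PI)
    (RInt (fun t => Cmod (F (polar r t)) ^ 2) 0 (2 * PI))).
  { apply (is_RInt_ext (fun t => Cmod (F (polar r t)) ^ 2)).
    - intros t _; rewrite Re_mult_conj; auto.
    - apply (RInt_correct (V := R_CompleteNormedModule)), ex_RInt_continuous_all.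
      intros t; apply continuous_Cmod2, Hc. }
  destruct (parseval r f f F F _ Hr Hg Hg HI) as (K & th & K0 & Ht & H).
  apply le_geo_limit with K th N; auto; intros L HL.
  specialize (H L); rewrite pairing_self in H; apply Rabs_le_between in H.
  assert (M := sum_f_R0_mono (fun k => Cmod (f k) ^ 2 * r ^ (2 * k)) N L).
  assert (forall k, 0 <= Cmod (f k) ^ 2 * r ^ (2 * k))
    by (intros; apply Rmult_le_pos; [apply pow2_ge_0|apply pow_le; auto]).
  specialize (M H0 HL); lra.
Qed.

Lemma RtoC_neq_0 (x : R) : x <> 0 -> RtoC x <> 0%C.
Proof. intros H E; apply H; exact (f_equal fst E). Qed.

(** On [|z| = r] this is the Poisson kernel [(r^2 - |w|^2) / |z - w|^2], written with a denominator
    [1 - b z] to which [div_lin] applies. *)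
Definition poisson (r : R) (w z : C) : R :=
  (1 - (Cmod w / r) ^ 2) / Cmod (1 - Cconj w / RtoC (r ^ 2) * z)%C ^ 2.

Lemma poisson_kernel_mod r w : 0 < r -> Cmod (Cconj w / RtoC (r ^ 2))%C = Cmod w / r ^ 2.
Proof.
  intros Hr; assert (0 < r ^ 2) by (apply pow_lt; auto).
  rewrite Cmod_div, Cmod_conj, Cmod_R, Rabs_pos_eq by (try lra; intros E; injection E; lra).
  reflexivity.
Qed.

Lemma poisson_bounds r w z : 0 < r -> Cmod w < r -> Cmod z = r ->
  0 <= poisson r w z <= (r + Cmod w) / (r - Cmod w).
Proof.
  intros Hr Hw Hz; assert (w0 := Cmod_ge_0 w).
  assert (S0 : 0 <= Cmod w / r < 1).
  { split; [apply Rmult_le_pos; auto; left; apply Rinv_0_lt_compat; auto|].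
    apply Rmult_lt_reg_r with r; auto; unfold Rdiv.
    rewrite Rmult_assoc, Rinv_l by lra; lra. }
  assert (D := Cmod_1_sub_ge (Cconj w / RtoC (r ^ 2))%C z).
  rewrite poisson_kernel_mod, Hz in D by auto.
  replace (Cmod w / r ^ 2 * r) with (Cmod w / r) in D by (field; lra).
  replace ((r + Cmod w) / (r - Cmod w)) with ((1 + Cmod w / r) / (1 - Cmod w / r))
    by (field; lra).
  unfold poisson; set (s := Cmod w / r) in *; set (q := Cmod (1 - _)%C) in *; clearbody s q.
  assert (Q : 0 < q ^ 2) by (apply pow_lt; lra).
  split.
  - apply Rmult_le_pos; [nra|left; apply Rinv_0_lt_compat; auto].
  - apply Rmult_le_reg_r with (q ^ 2); auto.
    replace ((1 - s ^ 2) / q ^ 2 * q ^ 2) with (1 - s ^ 2) by (field; intros ->; simpl in Q; lra).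
    apply Rle_trans with ((1 + s) / (1 - s) * (1 - s) ^ 2).
    + right; field; lra.
    + apply Rmult_le_compat_l.
      * apply Rmult_le_pos; [lra|left; apply Rinv_0_lt_compat; lra].
      * apply pow_incr; lra.
Qed.

(** Parseval for [c F / (1 - b z)] and [1 / (1 - b z)], with [b = conj w / r^2] and
    [c = 1 - |w|^2 / r^2]. As [conj b * r^2 = w], the pairing is the partial sum at [w] of the
    series of [c F / (1 - b z)], and [1 - b w = c] makes its limit [F w]. *)
Lemma poisson_formula r f F w : 0 < r -> Cmod w < r -> geo r f F ->
  (forall t, contC distR (fun t => F (polar r t)) t) ->
  is_RInt (fun t => poisson r w (polar r t) * Re (F (polar r t))) 0 (2 * PI)
    (2 * PI * Re (F w)).
Proof.
  intros Hr Hw Hg Hc; assert (w0 := Cmod_ge_0 w).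
  set (b := (Cconj w / RtoC (r ^ 2))%C).
  assert (Hb : Cmod b = Cmod w / r ^ 2) by (apply poisson_kernel_mod; auto).
  assert (Hbr : Cmod b * r < 1).
  { rewrite Hb; replace (Cmod w / r ^ 2 * r) with (Cmod w / r) by (field; lra).
    apply Rmult_lt_reg_r with r; auto; unfold Rdiv.
    rewrite Rmult_assoc, Rinv_l by lra; lra. }
  set (c := RtoC (1 - (Cmod w / r) ^ 2)).
  assert (Gk := geo_scale r c _ _ (geo_div_lin r b f F ltac:(lra) Hbr Hg)).
  assert (G1 := geo_div_lin r b one _ ltac:(lra) Hbr (geo_poly r 0 one ltac:(lra) supp_one)).
  assert (Nz : forall t, (1 - b * polar r t <> 0)%C).
  { intros t; apply lin_neq_0; rewrite Cmod_polar; lra. }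
  assert (E : forall t,
    Re (c * (F (polar r t) / (1 - b * polar r t))
        * Cconj (psum one 0 (polar r t) / (1 - b * polar r t)))%C
    = poisson r w (polar r t) * Re (F (polar r t))).
  { intros t; set (z := polar r t); assert (N := Nz t); fold z in N.
    replace (psum one 0 z) with (RtoC 1) by (unfold psum; simpl; ring).
    unfold poisson; fold b; set (q := (1 - b * z)%C) in *.
    assert (q0 : 0 < Cmod q) by (apply Cmod_gt_0; auto).
    assert (X : Cconj (1 / q)%C = (q / RtoC (Cmod q ^ 2))%C).
    { rewrite Cmod2_conj.
      assert (N' : Cconj q <> 0%C).
      { intros Z; assert (Y := Cmod_conj q); rewrite Z, Cmod_0 in Y; lra. }
      unfold Cdiv; rewrite Cmult_conj, Cconj_RtoC, Cinv_conj by auto.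
      field; auto. }
    rewrite X.
    assert (Cmod q ^ 2 <> 0) by (apply Rgt_not_eq, pow_lt; auto).
    assert (RtoC (Cmod q ^ 2) <> 0%C) by (intros Z; injection Z; auto).
    replace (c * (F z / q) * (q / RtoC (Cmod q ^ 2)))%C
      with (RtoC ((1 - (Cmod w / r) ^ 2) / Cmod q ^ 2) * F z)%C.
    - unfold Re, RtoC, Cmult; simpl; ring.
    - unfold c; rewrite RtoC_div by auto; field; auto. }
  set (I := RInt (fun t => poisson r w (polar r t) * Re (F (polar r t))) 0 (2 * PI)).
  assert (HI : is_RInt (fun t => poisson r w (polar r t) * Re (F (polar r t))) 0 (2 * PI) I).
  { apply (RInt_correct (V := R_CompleteNormedModule)), ex_RInt_continuous_all.
    intros t; eapply continuous_ext; [intros s; apply E|].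
    apply (continuous_Re (fun t => (c * (F (polar r t) / (1 - b * polar r t))
        * Cconj (psum one 0 (polar r t) / (1 - b * polar r t)))%C)).
    assert (CL : contC distR (fun t => 1 - b * polar r t)%C t).
    { apply contC_minus; [apply contC_const|].
      apply contC_mult; [apply contC_const|apply polar_cont]. }
    apply contC_mult.
    - apply contC_mult; [apply contC_const|apply contC_div; auto].
    - apply contC_conj, contC_div; auto.
      apply contC_mult; [apply contC_const|apply contC_pow, polar_cont]. }
  assert (HI' := is_RInt_ext _ _ _ _ _ (fun t _ => eq_sym (E t)) HI).
  destruct (parseval r _ _ _ _ _ ltac:(lra) Gk G1 HI') as (K & th & K0 & Ht & H).
  destruct Gk as (K' & th' & K0' & Ht' & H').
  assert (PE : forall L, pairing (scale c (div_lin b f)) (div_lin b one) r L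
     = psum (scale c (div_lin b f)) L w).
  { intros L; apply csum_ext; intros k _.
    assert (B1 : div_lin b one k = Cpow b k).
    { induction k as [|k IHk]; [reflexivity|]; simpl; rewrite IHk; ring. }
    rewrite B1, Cpow_conj; unfold b.
    assert (R2 : RtoC (r ^ 2) <> 0%C)
      by (apply RtoC_neq_0, Rgt_not_eq, pow_lt; auto).
    replace (Cconj (Cconj w / RtoC (r ^ 2)))%C with (w / RtoC (r ^ 2))%C.
    2: { unfold Cdiv; rewrite Cmult_conj, Cconj_conj; f_equal.
         rewrite <- RtoC_inv by (apply Rgt_not_eq, pow_lt; auto); rewrite Cconj_RtoC; auto. }
    replace (r ^ (2 * k)) with ((r ^ 2) ^ k) by (rewrite <- pow_mult; auto).
    rewrite <- (Cpow_RtoC (r ^ 2) k), <- Cmult_assoc, <- Cpow_mult_l.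
    do 2 f_equal; field; auto. }
  assert (Ew : (c * (F w / (1 - b * w)) = F w)%C).
  { assert (X : (1 - b * w)%C = c).
    { unfold b, c.
      replace (Cconj w / RtoC (r ^ 2) * w)%C with ((w * Cconj w) / RtoC (r ^ 2))%C.
      - rewrite <- Cmod2_conj, <- RtoC_div, <- RtoC_minus by (apply Rgt_not_eq, pow_lt; auto).
        f_equal; field; lra.
      - field; apply RtoC_neq_0, Rgt_not_eq, pow_lt; auto. }
    rewrite X; field.
    rewrite <- X; apply lin_neq_0.
    apply Rle_lt_trans with (Cmod b * r); auto.
    apply Rmult_le_compat_l; [apply Cmod_ge_0|lra]. }
  assert (HP := PI_RGT_0).
  assert (V : I / (2 * PI) = Re (F w)).
  { apply geo_unique_limit with (Rmax K K') (Rmax th th')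
      (fun L => Re (pairing (scale c (div_lin b f)) (div_lin b one) r L)).
    - split; [apply Rlt_le_trans with th; [lra|apply Rmax_l]|apply Rmax_lub_lt; lra].
    - intros L; eapply Rle_trans; [apply H|].
      apply Rmult_le_compat; [auto|apply pow_le; lra|apply Rmax_l|].
      apply pow_incr; split; [lra|apply Rmax_l].
    - intros L; rewrite PE.
      assert (HL := H' w ltac:(lra) L); rewrite Ew in HL.
      replace (Re (psum (scale c (div_lin b f)) L w) - Re (F w))
        with (Re (psum (scale c (div_lin b f)) L w - F w)%C) by reflexivity.
      eapply Rle_trans; [apply re_le_Cmod|].
      eapply Rle_trans; [apply HL|].
      apply Rmult_le_compat; [auto|apply pow_le; lra|apply Rmax_r|].
      apply pow_incr; split; [lra|apply Rmax_r]. }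
  rewrite <- V.
  assert (X : forall i : R, 2 * PI * (i / (2 * PI)) = i) by (intros; field; lra).
  rewrite X; exact HI.
Qed.

(** * Convexity and point evaluation *)

Lemma exp_convex l a : 0 <= l <= 1 -> exp (l * a) <= l * exp a + (1 - l).
Proof.
  intros Hl.
  assert (P := exp_pos (l * a)).
  assert (A1 := exp_ineq1_le ((1 - l) * a)).
  assert (A2 := exp_ineq1_le (- (l * a))).
  assert (E1 : exp a = exp (l * a) * exp ((1 - l) * a))
    by (rewrite <- exp_plus; f_equal; ring).
  assert (E2 : 1 = exp (l * a) * exp (- (l * a)))
    by (rewrite <- exp_plus, Rplus_opp_r, exp_0; auto).
  assert (exp (l * a) * (1 + (1 - l) * a) <= exp a) by (rewrite E1; nra).
  assert (exp (l * a) * (1 + - (l * a)) <= 1) by (rewrite E2 at 2; nra).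
  nra.
Qed.

(** Young's inequality [x/y <= (x/y)^p / p + 1 - 1/p], obtained from convexity of [exp] at
    [p ln (x/y)] and multiplied by [p y^p]. *)
Lemma powp_tangent x y p : 1 <= p -> 0 <= x -> 0 < y ->
  (1 - p) * Rpower y p + p * Rpower y (p - 1) * x <= powp x p.
Proof.
  intros Hp Hx Hy; unfold powp.
  assert (Y1 : 0 < Rpower y (p - 1)) by apply exp_pos.
  assert (Yp : Rpower y p = y * Rpower y (p - 1)).
  { rewrite <- (Rpower_1 y) at 2 by auto; rewrite <- Rpower_plus; f_equal; ring. }
  destruct (Rlt_dec 0 x) as [X|X].
  - assert (H := exp_convex (/ p) (p * ln (x / y))).
    assert (Hi : 0 <= / p <= 1).
    { split; [left; apply Rinv_0_lt_compat; lra|].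
      rewrite <- Rinv_1; apply Rinv_le_contravar; lra. }
    specialize (H Hi).
    replace (/ p * (p * ln (x / y))) with (ln (x / y)) in H by (field; lra).
    assert (XY : 0 < x / y) by (apply Rdiv_lt_0_compat; auto).
    rewrite exp_ln in H by auto.
    change (exp (p * ln (x / y))) with (Rpower (x / y) p) in H.
    assert (E : Rpower x p = Rpower (x / y) p * Rpower y p).
    { rewrite Rpower_mult_distr by auto; f_equal; field; lra. }
    rewrite E.
    apply Rmult_le_compat_l with (r := p * Rpower y p) in H.
    2: { rewrite Yp; apply Rmult_le_pos; [lra|]; apply Rmult_le_pos; lra. }
    replace (p * Rpower y p * (x / y)) with (p * Rpower y (p - 1) * x) in H
      by (rewrite Yp; field; lra).
    replace (p * Rpower y p * (/ p * Rpower (x / y) p + (1 - / p)))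
      with (Rpower (x / y) p * Rpower y p + (p - 1) * Rpower y p) in H by (field; lra).
    lra.
  - replace x with 0 by lra; rewrite Yp.
    assert (0 <= (p - 1) * (y * Rpower y (p - 1)))
      by (apply Rmult_le_pos; [lra|apply Rmult_le_pos; lra]).
    lra.
Qed.

(* Jensen's inequality against the Poisson kernel, in the form: the tangent of
   [x ^ p] at [|F w|] turns [|F| ^ p] into the real part of an affine function of F. *)
Lemma hardy_point_evaluation r f F w p : 0 < r -> Cmod w < r -> 1 <= p -> geo r f F ->
  (forall t, contC distR (fun t => F (polar r t)) t) ->
  ex_RInt (fun t => powp (Cmod (F (polar r t))) p) 0 (2 * PI) ->
  2 * PI * powp (Cmod (F w)) p
  <= (r + Cmod w) / (r - Cmod w) * RInt (fun t => powp (Cmod (F (polar r t))) p) 0 (2 * PI).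
Proof.
  intros Hr Hw Hp Hg Hc Hi; assert (w0 := Cmod_ge_0 w).
  assert (PI0 := PI_RGT_0).
  assert (B0 : 0 < (r + Cmod w) / (r - Cmod w)) by (apply Rdiv_lt_0_compat; lra).
  assert (Pw : forall x, 0 <= powp x p)
    by (intros x; unfold powp; destruct (Rlt_dec 0 x); [left; apply exp_pos|lra]).
  set (y := Cmod (F w)).
  destruct (Rlt_dec 0 y) as [Hy|Hy].
  2: { unfold powp at 1; destruct (Rlt_dec 0 y); [lra|].
       rewrite Rmult_0_r; apply Rmult_le_pos; [lra|].
       apply RInt_ge_0; auto; lra. }
  destruct (unit_direction (F w)) as (v & V1 & V2).
  set (u := Cconj v).
  assert (uF : (u * F w = RtoC y)%C).
  { rewrite V2; fold y; unfold u.
    transitivity (RtoC y * (v * Cconj v))%C; [ring|].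
    rewrite <- Cmod2_conj, V1; replace (1 ^ 2) with 1 by ring; ring. }
  (* The rotation [u] makes [u * F w] equal to [y], so [Re F2] equals [y^p] at [w] and is at most
     [|F|^p] everywhere. The constant 1 is written [psum one 0] so that [geo_poly] supplies its
     series. *)
  set (a := RtoC ((1 - p) * Rpower y p)); set (c := RtoC (p * Rpower y (p - 1))).
  set (F2 := fun z => (a * psum one 0 z + c * u * F z)%C).
  assert (G2 : geo r (fun k => scale a one k + scale (c * u)%C f k)%C F2).
  { apply geo_plus; apply geo_scale; auto; apply geo_poly; [lra|apply supp_one]. }
  assert (C2 : forall t, contC distR (fun t => F2 (polar r t)) t).
  { intros t; apply contC_plus; apply contC_mult; auto; try apply contC_const.
    apply contC_mult; [apply contC_const|apply contC_pow, polar_cont]. }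
  assert (ReF2 : forall z, Re (F2 z)
    = (1 - p) * Rpower y p + p * Rpower y (p - 1) * Re (u * F z)%C).
  { intros z; unfold F2.
    replace (psum one 0 z) with (RtoC 1) by (unfold psum; simpl; ring).
    unfold a, c, RtoC, Re, Cplus, Cmult; simpl; ring. }
  assert (J := poisson_formula r _ F2 w Hr Hw G2 C2).
  rewrite ReF2, uF in J.
  assert (Yp : Rpower y p = y * Rpower y (p - 1)).
  { rewrite <- (Rpower_1 y) at 2 by auto; rewrite <- Rpower_plus; f_equal; ring. }
  replace ((1 - p) * Rpower y p + p * Rpower y (p - 1) * Re (RtoC y)) with (powp y p) in J.
  2: { unfold powp; destruct (Rlt_dec 0 y); [|lra]; unfold Re, RtoC; simpl; rewrite Yp; ring. }
  assert (HR := is_RInt_scal (V := R_NormedModule) _ 0 (2 * PI)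
    ((r + Cmod w) / (r - Cmod w)) _ (RInt_correct (V := R_CompleteNormedModule) _ _ _ Hi)).
  assert (P2 : 0 <= 2 * PI) by lra.
  apply (is_RInt_le _ _ _ _ _ _ P2 J HR).
  intros t _; unfold scal; simpl; unfold mult; simpl.
  set (z := polar r t).
  assert (Hz : Cmod z = r) by (apply Cmod_polar; lra).
  assert (PB := poisson_bounds r w z Hr Hw Hz).
  assert (T := powp_tangent (Cmod (F z)) y p Hp (Cmod_ge_0 _) Hy).
  assert (R1 : Re (u * F z)%C <= Cmod (F z)).
  { eapply Rle_trans; [apply Rle_abs|]; eapply Rle_trans; [apply re_le_Cmod|].
    rewrite Cmod_mult; unfold u; rewrite Cmod_conj, V1, Rmult_1_l; apply Rle_refl. }
  assert (0 < Rpower y (p - 1)) by apply exp_pos.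
  assert (L : Re (F2 z) <= powp (Cmod (F z)) p).
  { rewrite ReF2; eapply Rle_trans; [|apply T].
    apply Rplus_le_compat_l, Rmult_le_compat_l; auto; apply Rmult_le_pos; lra. }
  apply Rle_trans with (poisson r w z * powp (Cmod (F z)) p).
  - apply Rmult_le_compat_l; [apply PB|exact L].
  - apply Rmult_le_compat_r; [apply Pw|apply PB].
Qed.

(** * Formal quotients *)

(** A new coefficient needs all earlier ones, so the recursion carries the whole table; only entries
    of index at most [k] are meaningful. *)
Fixpoint quot_tab (q f : nat -> C) (k : nat) : nat -> C :=
  match k with
  | O => fun _ => (f O / q O)%C
  | S k' => fun i => if Nat.leb i k' then quot_tab q f k' i
      else ((f k - csum (fun j => q (k - j)%nat * quot_tab q f k' j) k') / q O)%C
  end.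

Definition quot (q f : nat -> C) (k : nat) : C := quot_tab q f k k.

Lemma quot_tab_eq q f k i : (i <= k)%nat -> quot_tab q f k i = quot q f i.
Proof.
  induction k as [|k IH]; intros Hi.
  - replace i with O by lia; reflexivity.
  - destruct (Nat.eq_dec i (S k)) as [->|N]; [reflexivity|].
    cbn [quot_tab]; destruct (Nat.leb_spec i k); [apply IH; auto|lia].
Qed.

Lemma quot_S q f k :
  quot q f (S k) = ((f (S k) - csum (fun j => q (S k - j)%nat * quot q f j) k) / q O)%C.
Proof.
  unfold quot at 1; cbn [quot_tab].
  destruct (Nat.leb_spec (S k) k); [lia|].
  rewrite (csum_ext _ (fun j => q (S k - j)%nat * quot q f j)%C); auto.
  intros j Hj; rewrite quot_tab_eq; auto.
Qed.

Lemma conv_quot (q f : nat -> C) : q O <> 0%C -> conv q (quot q f) = f.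
Proof.
  intros H; apply functional_extensionality; intros [|k]; unfold conv.
  - unfold quot; simpl; field; auto.
  - rewrite <- csum_rev, csum_S.
    replace (S k - S k)%nat with O by lia; replace (S k - 0)%nat with (S k) by lia.
    rewrite quot_S.
    rewrite (csum_ext _ (fun j => q (S k - j)%nat * quot q f j)%C).
    + field; auto.
    + intros j Hj; replace (S k - (S k - j))%nat with j by lia; auto.
Qed.

Lemma quot_factor (q f : nat -> C) bs : q O <> 0%C -> q = scale (q O) (mul_lins bs one) ->
  quot q f = scale (/ q O)%C (div_lins bs f).
Proof. intros H E; apply conv_factor_quot; auto; rewrite <- E; apply conv_quot; auto. Qed.

(** A coefficient of the formal quotient depends on finitely many coefficients and divides only by
    [q O]. This gives continuity in [z2] up to the circle even when the denominator has zeros on the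
    torus. *)
Lemma contC_quot {X} (d : X -> X -> R) (q f : X -> nat -> C) x :
  q x O <> 0%C -> (forall k, contC d (fun y => q y k) x) ->
  (forall k, contC d (fun y => f y k) x) ->
  forall k, contC d (fun y => quot (q y) (f y) k) x.
Proof.
  intros H0 Hq Hf k; induction k as [k IH] using (well_founded_induction Wf_nat.lt_wf).
  destruct k as [|k].
  - apply (contC_div d (fun y => f y O) (fun y => q y O)); auto.
  - apply contC_ext with (fun y => ((f y (S k)
      - csum (fun j => q y (S k - j)%nat * quot (q y) (f y) j) k) / q y O)%C).
    + intros y; rewrite quot_S; auto.
    + apply contC_div; auto; apply contC_minus; auto.
      apply (contC_csum d (fun j y => q y (S k - j)%nat * quot (q y) (f y) j)%C).
      intros j Hj; apply contC_mult; auto; apply IH; lia.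
Qed.

(** Each division costs a factor [1 / (1 - r)], a fixed point of [x = 1 + r x]. The bound depends on
    the number of the [b] only, not on their position. *)
Lemma div_lins_bound bs f r B : 0 <= r < 1 -> 0 <= B -> (forall b, In b bs -> Cmod b <= 1) ->
  (forall k, Cmod (f k) * r ^ k <= B) ->
  forall k, Cmod (div_lins bs f k) * r ^ k <= B / (1 - r) ^ length bs.
Proof.
  intros Hr HB; induction bs as [|b bs IH]; intros Hb Hf.
  - intros k; simpl; rewrite Rdiv_1_r; auto.
  - assert (IH' := IH (fun a Ha => Hb a (or_intror Ha)) Hf).
    assert (b1 := Hb b (or_introl eq_refl)); assert (b0 := Cmod_ge_0 b).
    assert (P : 0 < (1 - r) ^ length bs) by (apply pow_lt; lra).
    change (div_lins (b :: bs) f) with (div_lin b (div_lins bs f)); simpl length.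
    set (B' := B / (1 - r) ^ length bs) in *.
    assert (HB' : 0 <= B') by (apply Rmult_le_pos; auto; left; apply Rinv_0_lt_compat; auto).
    replace (B / (1 - r) ^ S (length bs)) with (B' / (1 - r))
      by (unfold B'; simpl; field; split; lra).
    assert (G : B' + r * (B' / (1 - r)) = B' / (1 - r)) by (field; lra).
    assert (G0 : 0 <= B' / (1 - r))
      by (apply Rmult_le_pos; auto; left; apply Rinv_0_lt_compat; lra).
    induction k as [|k IHk].
    + specialize (IH' O); simpl in *; nra.
    + cbn [div_lin].
      assert (rk : 0 <= r ^ S k) by (apply pow_le; lra).
      eapply Rle_trans; [apply Rmult_le_compat_r; [auto|apply Cmod_triangle]|].
      rewrite Cmod_mult, Rmult_plus_distr_r, <- G.
      apply Rplus_le_compat; [apply IH'|].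
      change (r ^ S k) with (r * r ^ k).
      apply Rle_trans with (Cmod b * (r * (Cmod (div_lin b (div_lins bs f) k) * r ^ k)));
        [right; ring|].
      assert (0 <= r * (Cmod (div_lin b (div_lins bs f) k) * r ^ k)).
      { apply Rmult_le_pos; [lra|].
        apply Rmult_le_pos; [apply Cmod_ge_0|apply pow_le; lra]. }
      assert (r * (Cmod (div_lin b (div_lins bs f) k) * r ^ k) <= r * (B' / (1 - r)))
        by (apply Rmult_le_compat_l; lra).
      nra.
Qed.

Lemma mul_lins_one_bound bs : (forall b, In b bs -> Cmod b <= 1) ->
  forall k, Cmod (mul_lins bs one k) <= 2 ^ length bs.
Proof.
  induction bs as [|b bs IH]; intros Hb k.
  - destruct k; simpl; rewrite ?Cmod_1, ?Cmod_0; lra.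
  - assert (IH' := IH (fun a Ha => Hb a (or_intror Ha))).
    assert (b1 := Hb b (or_introl eq_refl)); assert (b0 := Cmod_ge_0 b).
    change (mul_lins (b :: bs) one) with (mul_lin b (mul_lins bs one)); simpl length.
    change (2 ^ S (length bs)) with (2 * 2 ^ length bs).
    destruct k as [|k]; cbn [mul_lin].
    + assert (H := IH' O); assert (H0 := Cmod_ge_0 (mul_lins bs one O)); lra.
    + unfold Cminus; eapply Rle_trans; [apply Cmod_triangle|].
      rewrite Cmod_opp, Cmod_mult.
      assert (H1 := IH' (S k)); assert (H2 := IH' k).
      assert (H0 := Cmod_ge_0 (mul_lins bs one k)); nra.
Qed.

Lemma lin_prod_lower bs z : (forall b, In b bs -> Cmod b <= 1) -> Cmod z <= 1 ->
  (1 - Cmod z) ^ length bs <= Cmod (lin_prod bs z).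
Proof.
  intros Hb Hz; induction bs as [|b bs IH]; simpl.
  - rewrite Cmod_1; lra.
  - rewrite Cmod_mult; apply Rmult_le_compat; [lra|apply pow_le; lra| |].
    + eapply Rle_trans; [|apply Cmod_1_sub_ge].
      assert (b1 := Hb b (or_introl eq_refl)); assert (z0 := Cmod_ge_0 z); nra.
    + apply IH; intros; apply Hb; now right.
Qed.

(** * Holomorphic functions given by one power series on the unit disc *)

Definition anal (G : C -> C) : Prop :=
  exists al, forall r, 0 <= r < 1 -> geo r al G.

Lemma anal_ext F G : (forall z, Cmod z < 1 -> F z = G z) -> anal F -> anal G.
Proof.
  intros E (al & H); exists al; intros r Hr; apply geo_ext with F; auto.
  intros z Hz; apply E; lra.
Qed.

Lemma anal_plus F G : anal F -> anal G -> anal (fun z => F z + G z)%C.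
Proof.
  intros (a & Ha) (b & Hb); exists (fun k => a k + b k)%C; intros r Hr.
  apply geo_plus; auto.
Qed.

Lemma anal_scale c F : anal F -> anal (fun z => c * F z)%C.
Proof. intros (a & Ha); exists (scale c a); intros r Hr; apply geo_scale; auto. Qed.

Lemma geo_shift r f F : 0 <= r -> geo r f F -> geo r (mul_refl 0 f) (fun z => z * F z)%C.
Proof.
  intros Hr (K & th & K0 & Ht & H).
  assert (f0 := Cmod_ge_0 (f O)).
  assert (E : (Cconj 0 = 0)%C) by apply Cconj_RtoC.
  assert (Q : 0 <= r * K / th)
    by (apply Rmult_le_pos; [apply Rmult_le_pos; auto|left; apply Rinv_0_lt_compat; lra]).
  assert (Q' : 0 <= r * (Cmod (f O) + K)) by (apply Rmult_le_pos; lra).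
  exists (r * (Cmod (f O) + K) + r * K / th), th; split; [lra|split; [auto|]].
  intros z Hz [|L].
  - rewrite pow_O, Rmult_1_r.
    replace (psum (mul_refl 0 f) 0 z - z * F z)%C
      with (z * ((psum f 0 z - F z) - f O))%C
      by (unfold psum; simpl; rewrite E; ring).
    rewrite Cmod_mult.
    assert (H0 := H z Hz O); rewrite pow_O, Rmult_1_r in H0.
    assert (T := Cmod_triangle (psum f 0 z - F z)%C (- f O)%C); rewrite Cmod_opp in T.
    assert (Cmod z * Cmod (psum f 0 z - F z - f O)%C <= r * (Cmod (f O) + K)).
    { apply Rmult_le_compat; try apply Cmod_ge_0; auto; unfold Cminus at 1; lra. }
    lra.
  - rewrite psum_mul_refl, E.
    replace (z * psum f L z - 0 * psum f (S L) z - z * F z)%C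
      with (z * (psum f L z - F z))%C by ring.
    rewrite Cmod_mult.
    apply Rle_trans with (r * (K * th ^ L)).
    + apply Rmult_le_compat; try apply Cmod_ge_0; auto.
    + assert (P : 0 < th ^ L) by (apply pow_lt; lra).
      change (th ^ S L) with (th * th ^ L).
      replace (r * (K * th ^ L)) with (r * K / th * (th * th ^ L)) by (field; lra).
      apply Rmult_le_compat_r; [nra|lra].
Qed.

Lemma anal_mul_pow k F : anal F -> anal (fun z => Cpow z k * F z)%C.
Proof.
  intros H; induction k as [|k (a & Ha)].
  - apply anal_ext with F; auto; intros z _; simpl; ring.
  - exists (mul_refl 0 a); intros r Hr.
    apply geo_ext with (fun z => z * (Cpow z k * F z))%C; [intros; simpl; ring|].
    apply geo_shift; [lra|auto].
Qed.

Lemma anal_csum (F : nat -> C -> C) N : (forall k, (k <= N)%nat -> anal (F k)) ->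
  anal (fun z => csum (fun k => F k z) N).
Proof.
  induction N as [|N IH]; intros H; [apply H; lia|].
  apply anal_plus; [apply IH; auto|apply H; lia].
Qed.

Lemma anal_poly_mul f d F : anal F -> anal (fun z => psum f d z * F z)%C.
Proof.
  intros H; apply anal_ext with (fun z => csum (fun k => f k * (Cpow z k * F z))%C d).
  - intros z _; unfold psum; rewrite <- csum_scal_r; apply csum_ext; intros; ring.
  - apply (anal_csum (fun k z => f k * (Cpow z k * F z))%C); intros.
    apply anal_scale, anal_mul_pow; auto.
Qed.

Lemma anal_one : anal (fun _ => 1%C).
Proof.
  exists one; intros r Hr.
  apply geo_ext with (psum one 0); [intros; unfold psum; simpl; ring|].
  apply geo_poly; [lra|apply supp_one].
Qed.

Lemma anal_poly f d : anal (psum f d).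
Proof.
  apply anal_ext with (fun z => psum f d z * 1)%C; [intros; ring|].
  apply anal_poly_mul, anal_one.
Qed.

Lemma psum_at_0 f d : psum f d 0 = f O.
Proof.
  unfold psum; destruct d as [|d]; [simpl; ring|].
  rewrite csum_Sl, csum_zero; [simpl; ring|].
  intros k _; rewrite Cpow_S; ring.
Qed.

Lemma anal_div (q : nat -> C) d F : supp d q -> (forall z, Cmod z < 1 -> psum q d z <> 0%C) ->
  anal F -> anal (fun z => F z / psum q d z)%C.
Proof.
  intros Hs Hz (a & Ha).
  assert (H0 : q O <> 0%C).
  { rewrite <- (psum_at_0 q d); apply Hz; rewrite Cmod_0; lra. }
  destruct (factor_lins_nonvanishing d q H0 Hs Hz) as (bs & Hl & Hq & Hb & Hev).
  exists (scale (/ q O)%C (div_lins bs a)); intros r Hr.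
  apply geo_ext with (fun z => / q O * (F z / lin_prod bs z))%C.
  - intros z Hzr; rewrite Hev; field; split; auto.
    intros E; apply (Hz z); [lra|]; rewrite Hev, E; ring.
  - apply geo_scale, geo_div_lins; [lra| |auto].
    intros b Hb'; specialize (Hb b Hb'); assert (b0 := Cmod_ge_0 b); nra.
Qed.

(** The constants hidden in [geo] may vary with [f]. A bound on the coefficients gives a tail with
    named constants, which can be summed over the rows of a double series. *)
Lemma geo_tail r f F z N B y : geo r f F -> Cmod z <= r -> 0 <= B -> 0 <= y < 1 ->
  (forall l, Cmod (f l) * Cmod z ^ l <= B * y ^ l) ->
  Cmod (psum f N z - F z)%C <= B / (1 - y) * y ^ N.
Proof.
  intros (K & th & K0 & Ht & H) Hz HB Hy Hf.
  assert (T : forall L, (N <= L)%nat ->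
    Cmod (psum f N z - psum f L z)%C <= B / (1 - y) * (y ^ N - y ^ L)).
  { intros L HL; induction HL as [|L HL IH].
    - replace (psum f N z - psum f N z)%C with (RtoC 0) by ring; rewrite Cmod_0; lra.
    - rewrite psum_S.
      replace (psum f N z - (psum f L z + f (S L) * Cpow z (S L)))%C
        with ((psum f N z - psum f L z) + - (f (S L) * Cpow z (S L)))%C by ring.
      eapply Rle_trans; [apply Cmod_triangle|].
      rewrite Cmod_opp, Cmod_mult, Cmod_pow.
      assert (Hl := Hf (S L)); change (y ^ S L) with (y * y ^ L) in *.
      assert (0 <= y ^ L) by (apply pow_le; lra).
      assert (B * (y * y ^ L) <= B / (1 - y) * (y ^ L - y * y ^ L)).
      { replace (B / (1 - y) * (y ^ L - y * y ^ L)) with (B * y ^ L) by (field; lra).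
        apply Rmult_le_compat_l; auto; nra. }
      lra. }
  apply le_geo_limit with K th N; auto; intros L HL.
  replace (psum f N z - F z)%C with ((psum f N z - psum f L z) + (psum f L z - F z))%C by ring.
  eapply Rle_trans; [apply Cmod_triangle|].
  assert (HT := T L HL); assert (HH := H z Hz L).
  assert (0 <= B / (1 - y)) by (apply Rmult_le_pos; auto; left; apply Rinv_0_lt_compat; lra).
  assert (0 <= y ^ L) by (apply pow_le; lra).
  nra.
Qed.

(** * Stable polynomials in two variables *)

(* Coefficients in the first variable of [peval m n c _ z2]. *)
Definition rowp (c : nat -> nat -> C) (n : nat) (z2 : C) (k : nat) : C := psum (c k) n z2.

(** The last clause is the form in which the atoral hypothesis enters: no slice over a point of the
    circle vanishes identically. *)
Definition stable (m n : nat) (c : nat -> nat -> C) : Prop :=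
  (forall k l, (m < k)%nat \/ (n < l)%nat -> c k l = 0%C) /\
  (forall z1 z2, Cmod z1 < 1 -> Cmod z2 < 1 -> psum (rowp c n z2) m z1 <> 0%C) /\
  (forall z, Cmod z = 1 -> exists k, rowp c n z k <> 0%C).

Definition rowt (m n : nat) (c : nat -> nat -> C) : C -> nat -> C :=
  rowp (refl_coef m n c) n.

Definition phi (m n : nat) (c : nat -> nat -> C) (z1 z2 : C) : C :=
  (psum (rowt m n c z2) m z1 / psum (rowp c n z2) m z1)%C.

(** The Taylor coefficients of [phi] in [z1]; as a formal quotient they make sense for [|z2| = 1]
    too. *)
Definition phik (m n : nat) (c : nat -> nat -> C) (z2 : C) : nat -> C :=
  quot (rowp c n z2) (rowt m n c z2).

Lemma rowp_supp m n (c : nat -> nat -> C) z : (forall k l, (m < k)%nat \/ (n < l)%nat -> c k l = 0%C) ->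
  supp m (rowp c n z).
Proof.
  intros H k Hk; unfold rowp, psum; apply csum_zero; intros l _.
  rewrite H by auto; ring.
Qed.

Lemma refl_coef_supp m n (c : nat -> nat -> C) k l : (m < k)%nat \/ (n < l)%nat ->
  (refl_coef m n c k l : C) = 0%C.
Proof.
  intros H; unfold refl_coef.
  destruct (Nat.leb_spec k m), (Nat.leb_spec l n); simpl; auto; lia.
Qed.

Lemma rowt_supp m n (c : nat -> nat -> C) z : supp m (rowt m n c z).
Proof. apply (rowp_supp m n (refl_coef m n c)); apply refl_coef_supp. Qed.

Lemma contC_psum {X} (d : X -> X -> R) (f : X -> nat -> C) (g : X -> C) N x :
  (forall k, contC d (fun y => f y k) x) -> contC d g x ->
  contC d (fun y => psum (f y) N (g y)) x.
Proof.
  intros Hf Hg; apply (contC_csum d (fun k y => f y k * Cpow (g y) k)%C).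
  intros k _; apply contC_mult; auto; apply contC_pow; auto.
Qed.

Lemma contC_rowp {X} (d : X -> X -> R) c n (g : X -> C) k x : contC d g x ->
  contC d (fun y => rowp c n (g y) k) x.
Proof. intros H; apply (contC_psum d (fun _ => c k)); auto; intros; apply contC_const. Qed.

Lemma radial_limit (F G : C -> C) (B : R) z : 0 <= B -> Cmod z <= 1 ->
  contC distC F z -> contC distC G z ->
  (forall w, Cmod w < 1 -> Cmod (F w) <= B * Cmod (G w)) ->
  Cmod (F z) <= B * Cmod (G z).
Proof.
  intros HB Hz HF HG H; apply le_epsilon; intros e He.
  set (e' := e / (B + 1)).
  assert (e0 : 0 < e') by (apply Rdiv_lt_0_compat; lra).
  destruct (HF e' e0) as (d1 & D1 & H1); destruct (HG e' e0) as (d2 & D2 & H2).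
  set (d := Rmin 1 (Rmin d1 d2)).
  assert (Hd : 0 < d) by (repeat apply Rmin_pos; lra).
  assert (d_1 : d <= 1) by apply Rmin_l.
  assert (dd : d <= Rmin d1 d2) by apply Rmin_r.
  assert (dd1 := Rmin_l d1 d2); assert (dd2 := Rmin_r d1 d2).
  set (w := (RtoC (1 - d / 2) * z)%C).
  assert (z0 := Cmod_ge_0 z).
  assert (Hw : Cmod w < 1).
  { unfold w; rewrite Cmod_mult, Cmod_R, Rabs_pos_eq by lra; nra. }
  assert (Dw : distC w z < d).
  { unfold distC, w; replace (RtoC (1 - d / 2) * z - z)%C with (RtoC (- (d / 2)) * z)%C
      by (rewrite RtoC_minus, RtoC_opp; ring).
    rewrite Cmod_mult, Cmod_R, Rabs_Ropp, Rabs_pos_eq by lra; nra. }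
  specialize (H1 w ltac:(lra)); specialize (H2 w ltac:(lra)); specialize (H w Hw).
  assert (R1 := Cmod_reverse_triangle (F w) (F z)); assert (R2 := Cmod_reverse_triangle (G w) (G z)).
  apply Rabs_le_between in R1; apply Rabs_le_between in R2.
  assert (E : e = e' + B * e') by (unfold e'; field; lra).
  assert (B * Cmod (G w) <= B * (Cmod (G z) + e')) by (apply Rmult_le_compat_l; lra).
  lra.
Qed.

(** In place of Hurwitz's theorem, two inequalities from the factorisation at interior [w] pass to
    the radial limit. Every coefficient of the slice is at most [2^m] times the one of order 0, so
    that one cannot vanish on the circle without the whole slice; and it is at most
    [(1 - |z1|)^(-m)] times the value at [z1], so that value is nonzero. *)
Lemma stable_closed m n (c : nat -> nat -> C) z2 : stable m n c -> Cmod z2 <= 1 ->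
  rowp c n z2 O <> 0%C /\
  forall z1, Cmod z1 < 1 -> psum (rowp c n z2) m z1 <> 0%C.
Proof.
  intros (Hs & Hn & Ht) Hz.
  assert (H0 : forall w, Cmod w < 1 -> rowp c n w O <> 0%C).
  { intros w Hw; rewrite <- (psum_at_0 _ m); apply Hn; auto; rewrite Cmod_0; lra. }
  assert (cont : forall k, contC distC (fun w => rowp c n w k) z2)
    by (intros; apply (contC_rowp distC c n (fun w => w)), contC_id).
  assert (N0 : rowp c n z2 O <> 0%C).
  { destruct (Rle_lt_or_eq_dec _ _ Hz) as [L|E]; [auto|].
    destruct (Ht z2 E) as [k Hk]; intros Z; apply Hk, Cmod_eq_0.
    apply Rle_antisym; [|apply Cmod_ge_0].
    apply Rle_trans with (2 ^ m * Cmod (rowp c n z2 O)); [|rewrite Z, Cmod_0; lra].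
    apply (radial_limit (fun w => rowp c n w k) (fun w => rowp c n w O)); auto.
    - apply pow_le; lra.
    - intros w Hw.
      destruct (factor_lins_nonvanishing m (rowp c n w) (H0 w Hw) (rowp_supp m n c w Hs)
        (fun z1 Hz1 => Hn z1 w Hz1 Hw)) as (bs & Hl & Hq & Hb & Hev).
      assert (Ek := f_equal (fun f => f k) Hq); cbv beta in *; rewrite Ek; unfold scale; rewrite Cmod_mult, Rmult_comm.
      apply Rmult_le_compat_r; [apply Cmod_ge_0|].
      rewrite <- Hl; apply mul_lins_one_bound; auto. }
  split; auto; intros z1 Hz1 Z.
  assert (L : Cmod (rowp c n z2 O) <= / (1 - Cmod z1) ^ m * Cmod (psum (rowp c n z2) m z1)).
  { assert (P : 0 < (1 - Cmod z1) ^ m) by (apply pow_lt; lra).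
    apply (radial_limit (fun w => rowp c n w O) (fun w => psum (rowp c n w) m z1)); auto.
    - left; apply Rinv_0_lt_compat; auto.
    - apply contC_psum; auto; apply contC_const.
    - intros w Hw.
      destruct (factor_lins_nonvanishing m (rowp c n w) (H0 w Hw) (rowp_supp m n c w Hs)
        (fun z1 Hz1 => Hn z1 w Hz1 Hw)) as (bs & Hl & Hq & Hb & Hev).
      cbv beta; rewrite Hev, Cmod_mult.
      assert (G := lin_prod_lower bs z1 Hb ltac:(lra)); rewrite Hl in G.
      apply Rmult_le_reg_l with ((1 - Cmod z1) ^ m); auto.
      rewrite <- Rmult_assoc, Rinv_r, Rmult_1_l by lra.
      rewrite Rmult_comm; apply Rmult_le_compat_l; auto; apply Cmod_ge_0. }
  rewrite Z, Cmod_0, Rmult_0_r in L.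
  apply N0, Cmod_eq_0, Rle_antisym; auto; apply Cmod_ge_0.
Qed.

Lemma stable_factor m n (c : nat -> nat -> C) z2 : stable m n c -> Cmod z2 <= 1 ->
  exists bs, length bs = m /\
    rowp c n z2 = scale (rowp c n z2 O) (mul_lins bs one) /\
    (forall b, In b bs -> Cmod b <= 1) /\
    (forall z, psum (rowp c n z2) m z = (rowp c n z2 O * lin_prod bs z)%C).
Proof.
  intros Hst Hz; destruct (stable_closed m n c z2 Hst Hz) as [N0 N1].
  apply factor_lins_nonvanishing; auto; apply rowp_supp, Hst.
Qed.

Lemma phik_geo m n (c : nat -> nat -> C) z2 r : stable m n c -> Cmod z2 <= 1 -> 0 <= r < 1 ->
  geo r (phik m n c z2) (fun z1 => phi m n c z1 z2).
Proof.
  intros Hst Hz Hr.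
  destruct (stable_closed m n c z2 Hst Hz) as [N0 N1].
  destruct (stable_factor m n c z2 Hst Hz) as (bs & Hl & Hq & Hb & Hev).
  unfold phik; rewrite (quot_factor _ _ bs N0 Hq).
  assert (Hbr : forall b, In b bs -> Cmod b * r < 1).
  { intros b Hb'; specialize (Hb b Hb'); assert (b0 := Cmod_ge_0 b); nra. }
  apply geo_ext with (fun z => / rowp c n z2 O
    * (psum (rowt m n c z2) m z / lin_prod bs z))%C.
  - intros z Hzr; unfold phi; rewrite Hev; field; split; auto.
    intros E; apply (N1 z); [lra|]; rewrite Hev, E; ring.
  - apply geo_scale, geo_div_lins; [lra|auto|].
    apply geo_poly; [lra|apply rowt_supp].
Qed.

Lemma contC_phik m n (c : nat -> nat -> C) z2 k : stable m n c -> Cmod z2 <= 1 ->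
  contC distC (fun z => phik m n c z k) z2.
Proof.
  intros Hst Hz; apply contC_quot.
  - apply (stable_closed m n c z2 Hst Hz).
  - intros j; apply (contC_rowp distC c n (fun w => w)), contC_id.
  - intros j; apply (contC_rowp distC (refl_coef m n c) n (fun w => w)), contC_id.
Qed.

Lemma Cpow_unimodular_conj z l n : Cmod z = 1 -> (l <= n)%nat ->
  (Cpow z n * Cpow (Cconj z) l = Cpow z (n - l))%C.
Proof.
  intros Hz Hl.
  replace (Cpow z n) with (Cpow z (n - l) * Cpow z l)%C by (rewrite <- Cpow_add_r; f_equal; lia).
  rewrite <- Cmult_assoc, <- Cpow_mult_l, <- Cmod2_conj, Hz, Cpow_RtoC.
  rewrite !pow1; ring.
Qed.

(** For [|z| = 1] one has [1 / conj z = z], so reflecting in both variables amounts to reflecting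
    the slice, up to the factor [z^n]. *)
Lemma rowt_unimodular m n (c : nat -> nat -> C) z : Cmod z = 1 ->
  rowt m n c z = scale (Cpow z n) (refl1 m (rowp c n z)).
Proof.
  intros Hz; apply functional_extensionality; intros k.
  unfold rowt, rowp, scale, refl1.
  destruct (Nat.leb_spec k m) as [L|L].
  - unfold psum; rewrite csum_conj, <- csum_scal.
    rewrite <- (csum_rev (fun l => Cpow z n * Cconj (c (m - k)%nat l * Cpow z l))%C).
    apply csum_ext; intros l Hl.
    rewrite Cmult_conj, Cpow_conj.
    transitivity (Cconj (c (m - k)%nat (n - l)%nat) * (Cpow z n * Cpow (Cconj z) (n - l)))%C; [|ring].
    rewrite Cpow_unimodular_conj by (auto; lia).
    replace (n - (n - l))%nat with l by lia.
    unfold refl_coef; rewrite (proj2 (Nat.leb_le k m)), (proj2 (Nat.leb_le l n)) by auto.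
    reflexivity.
  - unfold psum; rewrite csum_zero; [ring|]; intros l _.
    rewrite refl_coef_supp by auto; ring.
Qed.

Lemma phi_unimodular m n (c : nat -> nat -> C) z : stable m n c -> Cmod z = 1 ->
  exists bs u, length bs = m /\ Cmod u = 1 /\ (forall b, In b bs -> Cmod b <= 1) /\
    phik m n c z = scale u (blaschkes bs one) /\
    forall z1, Cmod z1 < 1 -> phi m n c z1 z = (u * (refl_prod bs z1 / lin_prod bs z1))%C.
Proof.
  intros Hst Hz.
  destruct (stable_closed m n c z Hst ltac:(lra)) as [N0 N1].
  destruct (stable_factor m n c z Hst ltac:(lra)) as (bs & Hl & Hq & Hb & Hev).
  set (q0 := rowp c n z O) in *.
  assert (T : rowt m n c z = scale (Cpow z n * Cconj q0)%C (mul_refls bs one)).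
  { rewrite rowt_unimodular, Hq, refl1_scale, scale_scale by auto.
    rewrite <- Hl, refl1_mul_lins; auto. }
  exists bs, (Cpow z n * Cconj q0 / q0)%C; repeat split; auto.
  - rewrite Cmod_div, Cmod_mult, Cmod_pow, Cmod_conj, Hz, pow1 by auto.
    field; apply Rgt_not_eq, Cmod_gt_0; auto.
  - unfold phik; rewrite (quot_factor _ _ bs N0 Hq), T, div_lins_scale, div_lins_refls, scale_scale.
    f_equal; fold q0; field; auto.
  - intros z1 Hz1; unfold phi; rewrite T, Hev, psum_scale, <- Hl.
    rewrite (proj2 (psum_mul_refls bs z1)); fold q0; field; split; auto.
    intros E; apply (N1 z1); auto; rewrite Hev, E; ring.
Qed.

(** * Weighted sums over the boundary *)

Definition hsum (m n : nat) (c : nat -> nat -> C) (p : R) (N : nat) (z : C) : R :=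
  sum_f_R0 (fun k => Rpower (INR k + 1) p * Cmod (phik m n c z k) ^ 2) N.

Lemma Cmod2_contR {X} (d : X -> X -> R) (w : nat -> R) (f : X -> nat -> C) N x :
  (forall k, contC d (fun y => f y k) x) ->
  contC d (fun y => RtoC (sum_f_R0 (fun k => w k * Cmod (f y k) ^ 2) N)) x.
Proof.
  intros H.
  apply contC_ext with (fun y => csum (fun k => RtoC (w k) * (f y k * Cconj (f y k)))%C N).
  - intros y; induction N as [|N IH].
    + simpl csum; rewrite <- Cmod2_conj, <- RtoC_mult; reflexivity.
    + rewrite csum_S, IH, tech5, RtoC_plus, RtoC_mult, Cmod2_conj; reflexivity.
  - apply (contC_csum d (fun k y => RtoC (w k) * (f y k * Cconj (f y k)))%C).
    intros k _; apply contC_mult; [apply contC_const|].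
    apply contC_mult; auto; apply contC_conj; auto.
Qed.

Lemma contC_hsum m n (c : nat -> nat -> C) p N z : stable m n c -> Cmod z <= 1 ->
  contC distC (fun z => RtoC (hsum m n c p N z)) z.
Proof. intros Hst Hz; apply Cmod2_contR; intros k; apply contC_phik; auto. Qed.

Lemma Cmod_unit_scale u (f : nat -> C) k : Cmod u = 1 -> Cmod (scale u f k) = Cmod (f k).
Proof. intros H; unfold scale; rewrite Cmod_mult, H; ring. Qed.

Lemma hsum_small m n (c : nat -> nat -> C) p N z : stable m n c -> Cmod z = 1 -> 0 < p <= 1 ->
  hsum m n c p N z <= blaschke_bound m.
Proof.
  intros Hst Hz Hp.
  destruct (phi_unimodular m n c z Hst Hz) as (bs & u & Hl & Hu & Hb & Hk & _).
  destruct (blaschke_dichotomy bs Hb) as (d & Hd & Hs & _).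
  rewrite Hl in Hs; eapply Rle_trans; [|apply (Hs N)].
  apply sum_Rle; intros k _; rewrite Hk, Cmod_unit_scale by auto.
  assert (W := weight_le_small p k Hp).
  assert (P := pow2_ge_0 (Cmod (blaschkes bs one k))).
  assert (Hk0 := pos_INR k).
  assert (1 <= (1 + d / 2) ^ (2 * k)) by (apply pow_R1_Rle; lra).
  apply Rle_trans with ((INR k + 1) * Cmod (blaschkes bs one k) ^ 2).
  - apply Rmult_le_compat_r; auto.
  - apply Rmult_le_compat_l; [lra|nra].
Qed.

(** [C0] is chosen before the polynomial and the boundary point, and [d] before [N]. The gap 1/2
    compares a zero [a] of the slice with the point [w] of [blaschke_dichotomy]. *)
Lemma hsum_large m p : 1 < p -> exists C0, 0 < C0 /\
  forall n c z, stable m n c -> Cmod z = 1 -> exists d, 0 < d <= 1 /\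
    (forall N, hsum m n c p N z <= C0 * Rpower d (1 - p)) /\
    (d = 1 \/ exists a w : C,
      Cmod a <= 1 - kappa m * d /\ Cmod w <= 1 - kappa m * d /\ Cmod (w - a)%C <= d /\
      1 / 2 <= Cmod (phi m n c w z - phi m n c a z)%C).
Proof.
  intros Hp; destruct (weight_le_large p Hp) as (Cs & Cs0 & W).
  assert (B0 : 0 < blaschke_bound m).
  { unfold blaschke_bound; assert (H := dirichlet_bound_nonneg m).
    assert (0 < 9 ^ m) by (apply pow_lt; lra); lra. }
  exists (Cs * blaschke_bound m); split; [apply Rmult_lt_0_compat; auto|].
  intros n c z Hst Hz.
  destruct (phi_unimodular m n c z Hst Hz) as (bs & u & Hl & Hu & Hb & Hk & Hphi).
  destruct (blaschke_dichotomy bs Hb) as (d & Hd & Hs & Hdich).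
  rewrite Hl in Hs, Hdich; exists d; split; [auto|split].
  - intros N.
    assert (P : 0 < Rpower d (1 - p)) by apply exp_pos.
    apply Rle_trans with (Cs * Rpower d (1 - p) * sum_f_R0 (fun k => (INR k + 1)
        * (Cmod (blaschkes bs one k) ^ 2 * (1 + d / 2) ^ (2 * k))) N).
    + rewrite scal_sum; apply sum_Rle; intros k _; rewrite Hk, Cmod_unit_scale by auto.
      specialize (W d k Hd).
      assert (Q := pow2_ge_0 (Cmod (blaschkes bs one k))).
      apply Rle_trans with (Cs * Rpower d (1 - p) * ((INR k + 1) * (1 + d / 2) ^ (2 * k))
        * Cmod (blaschkes bs one k) ^ 2); [apply Rmult_le_compat_r; auto|right; ring].
    + assert (0 < Cs * Rpower d (1 - p)) by (apply Rmult_lt_0_compat; auto).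
      apply Rle_trans with (Cs * Rpower d (1 - p) * blaschke_bound m); [|right; ring].
      apply Rmult_le_compat_l; [lra|apply Hs].
  - destruct Hdich as [E|(a & w & Ha & Hw & Hwa & Za & Lw)]; [now left|right].
    assert (K := kappa_bounds m).
    assert (kd : 0 < kappa m * d) by (apply Rmult_lt_0_compat; lra).
    exists a, w; repeat split; auto.
    rewrite !Hphi, Za by lra.
    assert (Nw : lin_prod bs w <> 0%C).
    { apply lin_prod_neq_0; intros b Hb'; specialize (Hb b Hb').
      assert (b0 := Cmod_ge_0 b); assert (w0 := Cmod_ge_0 w); nra. }
    replace (u * (refl_prod bs w / lin_prod bs w) - u * (0 / lin_prod bs a))%C
      with (u * (refl_prod bs w / lin_prod bs w))%C by (unfold Cdiv; ring).
    rewrite Cmod_mult, Hu, Rmult_1_l, Cmod_div by auto.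
    assert (L0 : 0 < Cmod (lin_prod bs w)) by (apply Cmod_gt_0; auto).
    apply Rmult_le_reg_r with (Cmod (lin_prod bs w)); auto.
    unfold Rdiv; rewrite (Rmult_assoc (Cmod (refl_prod bs w))), Rinv_l by lra; lra.
Qed.

(** * Complex derivatives *)

(* Caratheodory's form of differentiability: the difference quotient extends
   continuously to [h = 0]. *)
Definition cderiv (f : C -> C) (z d : C) : Prop :=
  exists E : C -> C, contC distC E 0 /\ E 0%C = d /\
    exists dl, 0 < dl /\ forall h, Cmod h < dl -> (f (z + h) - f z = h * E h)%C.

Lemma cderiv_ext f g z d : (forall w, f w = g w) -> cderiv f z d -> cderiv g z d.
Proof.
  intros H (E & HE & E0 & dl & D & Hd); exists E; repeat split; auto.
  exists dl; split; auto; intros h Hh; rewrite <- !H; auto.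
Qed.

Lemma cderiv_const (c z : C) : cderiv (fun _ => c) z 0.
Proof.
  exists (fun _ => RtoC 0); split; [apply contC_const|split; auto].
  exists 1; split; [lra|intros; ring].
Qed.

Lemma cderiv_id z : cderiv (fun w => w) z 1.
Proof.
  exists (fun _ => RtoC 1); split; [apply contC_const|split; auto].
  exists 1; split; [lra|intros; ring].
Qed.

Lemma cderiv_plus f g z df dg : cderiv f z df -> cderiv g z dg ->
  cderiv (fun w => f w + g w)%C z (df + dg)%C.
Proof.
  intros (E & HE & E0 & d1 & D1 & H1) (E' & HE' & E0' & d2 & D2 & H2).
  exists (fun h => E h + E' h)%C; split; [apply contC_plus; auto|].
  split; [rewrite E0, E0'; auto|].
  exists (Rmin d1 d2); split; [apply Rmin_pos; auto|]; intros h Hh.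
  assert (L1 := Rmin_l d1 d2); assert (L2 := Rmin_r d1 d2).
  rewrite Cmult_plus_distr_l, <- H1, <- H2 by lra; ring.
Qed.

Lemma cderiv_mult f g z df dg : cderiv f z df -> cderiv g z dg ->
  cderiv (fun w => f w * g w)%C z (df * g z + f z * dg)%C.
Proof.
  intros (E & HE & E0 & d1 & D1 & H1) (E' & HE' & E0' & d2 & D2 & H2).
  exists (fun h => E h * g z + f z * E' h + h * (E h * E' h))%C; split.
  - repeat (apply contC_plus || apply contC_mult); auto;
      solve [apply contC_const | apply contC_id].
  - split; [rewrite E0, E0'; ring|].
    exists (Rmin d1 d2); split; [apply Rmin_pos; auto|]; intros h Hh.
    assert (L1 := Rmin_l d1 d2); assert (L2 := Rmin_r d1 d2).
    assert (F1 : f (z + h)%C = (f z + h * E h)%C) by (rewrite <- H1 by lra; ring).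
    assert (F2 : g (z + h)%C = (g z + h * E' h)%C) by (rewrite <- H2 by lra; ring).
    rewrite F1, F2; ring.
Qed.

Lemma cderiv_inv (f : C -> C) z (df : C) : f z <> 0%C -> cderiv f z df ->
  cderiv (fun w => / f w)%C z (- (df / (f z * f z)))%C.
Proof.
  intros N (E & HE & E0 & d1 & D1 & H1).
  set (q := fun h => (f z + h * E h)%C).
  assert (q0 : q 0%C = f z) by (unfold q; ring).
  assert (Cq : contC distC q 0).
  { apply contC_plus; [apply contC_const|apply contC_mult; [apply contC_id|auto]]. }
  exists (fun h => - (E h / (q h * f z)))%C; split.
  - apply contC_opp, contC_div; auto; [rewrite q0; apply Cmult_neq_0; auto|].
    apply contC_mult; auto; apply contC_const.
  - split; [rewrite q0, E0; auto|].
    assert (P : 0 < Cmod (f z)) by (apply Cmod_gt_0; auto).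
    destruct (Cq (Cmod (f z)) P) as (d2 & D2 & H2).
    exists (Rmin d1 d2); split; [apply Rmin_pos; auto|]; intros h Hh.
    assert (L1 := Rmin_l d1 d2); assert (L2 := Rmin_r d1 d2).
    assert (F1 : f (z + h)%C = q h) by (unfold q; rewrite <- H1 by lra; ring).
    assert (Nq : q h <> 0%C).
    { intros Z; specialize (H2 h); unfold distC in H2.
      replace (h - 0)%C with h in H2 by ring; specialize (H2 ltac:(lra)).
      rewrite Z, q0 in H2; replace (0 - f z)%C with (- f z)%C in H2 by ring.
      rewrite Cmod_opp in H2; lra. }
    rewrite F1.
    transitivity (- ((q h - f z) / (q h * f z)))%C; [field; auto|].
    unfold q at 1; field; split; auto.
Qed.

Lemma cderiv_unique_at (f : C -> C) (z d g : C) :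
  cderiv f z d -> C_deriv_at f z g -> g = d.
Proof.
  intros (E & HE & E0 & d1 & D1 & H1) Hg.
  assert (Z : Cmod (g - d)%C = 0).
  { apply Rle_antisym; [|apply Cmod_ge_0].
    apply le_epsilon; intros e He; rewrite Rplus_0_l.
    destruct (HE (e / 2)) as (d2 & D2 & H2); [lra|].
    destruct (Hg (e / 2)) as (d3 & D3 & H3); [lra|].
    set (h := Rmin d1 (Rmin d2 d3) / 2).
    assert (L1 := Rmin_l d1 (Rmin d2 d3)); assert (L2 := Rmin_r d1 (Rmin d2 d3)).
    assert (L3 := Rmin_l d2 d3); assert (L4 := Rmin_r d2 d3).
    assert (h0 : 0 < Rmin d1 (Rmin d2 d3)) by (repeat apply Rmin_pos; auto).
    assert (Mh : Cmod (RtoC h) = h) by (rewrite Cmod_R, Rabs_pos_eq; unfold h; lra).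
    assert (Nh : RtoC h <> 0%C) by (apply RtoC_neq_0; unfold h; lra).
    assert (I2 : Cmod (E (RtoC h) - E 0)%C < e / 2).
    { apply H2; unfold distC; replace (RtoC h - 0)%C with (RtoC h) by ring.
      rewrite Mh; unfold h; lra. }
    assert (I3 : Cmod ((f (z + RtoC h) - f z) / RtoC h - g)%C < e / 2).
    { apply (H3 (RtoC h)); change (Cnorm (RtoC h)) with (Cmod (RtoC h)).
      rewrite Mh; unfold h; lra. }
    rewrite H1 in I3 by (rewrite Mh; unfold h; lra).
    rewrite E0 in I2.
    replace (RtoC h * E (RtoC h) / RtoC h)%C with (E (RtoC h)) in I3 by (field; auto).
    replace (g - d)%C with (- (E (RtoC h) - g) + (E (RtoC h) - d))%C by ring.
    eapply Rle_trans; [apply Cmod_triangle|]; rewrite Cmod_opp; lra. }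
  apply Cmod_eq_0 in Z.
  replace g with ((g - d) + d)%C by ring; rewrite Z; ring.
Qed.

Definition der (f : nat -> C) (k : nat) : C := (RtoC (INR (S k)) * f (S k))%C.

Lemma cderiv_pow k z : cderiv (fun w => Cpow w (S k)) z (RtoC (INR (S k)) * Cpow z k)%C.
Proof.
  induction k as [|k IH].
  - replace (RtoC (INR 1) * Cpow z 0)%C with (RtoC 1) by (simpl; ring).
    apply cderiv_ext with (fun w => w); [intros; simpl; ring|apply cderiv_id].
  - replace (RtoC (INR (S (S k))) * Cpow z (S k))%C
      with (1 * Cpow z (S k) + z * (RtoC (INR (S k)) * Cpow z k))%C.
    + exact (cderiv_mult (fun w => w) (fun w => Cpow w (S k)) z _ _ (cderiv_id z) IH).
    + rewrite (S_INR (S k)), RtoC_plus, Cpow_S; ring.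
Qed.

Lemma cderiv_psum f d z : supp d f -> cderiv (psum f d) z (psum (der f) d z).
Proof.
  intros Hs; apply cderiv_ext with (psum f (S d)).
  { intros w; apply psum_supp; auto. }
  assert (T : forall N, cderiv (fun w => f (S N) * Cpow w (S N))%C z (der f N * Cpow z N)%C).
  { intros N.
    replace (der f N * Cpow z N)%C
      with (0 * Cpow z (S N) + f (S N) * (RtoC (INR (S N)) * Cpow z N))%C
      by (unfold der; ring).
    apply cderiv_mult; [apply cderiv_const|apply cderiv_pow]. }
  clear Hs; induction d as [|d IH].
  - replace (psum (der f) 0 z) with (0 + der f 0 * Cpow z 0)%C by (unfold psum; simpl; ring).
    apply (cderiv_plus (psum f 0) (fun w => f 1%nat * Cpow w 1)%C); [|apply T].
    apply cderiv_ext with (fun _ => f O); [intros; unfold psum; simpl; ring|apply cderiv_const].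
  - apply (cderiv_plus (psum f (S d)) (fun w => f (S (S d)) * Cpow w (S (S d)))%C); auto.
Qed.

(** The quotient rule, arranged as sums, scalings and two successive divisions so that the closure
    rules of [anal] and [contC] apply directly. *)
Definition dphi (m n : nat) (c : nat -> nat -> C) (z1 z2 : C) : C :=
  ((psum (rowp c n z2) m z1 * psum (der (rowt m n c z2)) m z1
    + (- (1)) * (psum (rowt m n c z2) m z1 * psum (der (rowp c n z2)) m z1))
   / psum (rowp c n z2) m z1 / psum (rowp c n z2) m z1)%C.

Lemma cderiv_phi m n (c : nat -> nat -> C) z1 z2 : stable m n c -> Cmod z1 < 1 -> Cmod z2 < 1 ->
  cderiv (fun w => phi m n c w z2) z1 (dphi m n c z1 z2).
Proof.
  intros Hst H1 H2.
  assert (N := proj2 (stable_closed m n c z2 Hst ltac:(lra)) z1 H1).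
  assert (P := cderiv_psum (rowp c n z2) m z1 (rowp_supp m n c z2 (proj1 Hst))).
  assert (Q := cderiv_psum (rowt m n c z2) m z1 (rowt_supp m n c z2)).
  assert (X := cderiv_mult _ _ _ _ _ Q (cderiv_inv _ _ _ N P)).
  replace (dphi m n c z1 z2) with
    (psum (der (rowt m n c z2)) m z1 * / psum (rowp c n z2) m z1 +
     psum (rowt m n c z2) m z1
     * - (psum (der (rowp c n z2)) m z1 / (psum (rowp c n z2) m z1 * psum (rowp c n z2) m z1)))%C.
  - exact X.
  - unfold dphi; field; auto.
Qed.

Lemma dphi_anal m n (c : nat -> nat -> C) z2 : stable m n c -> Cmod z2 < 1 ->
  anal (fun z1 => dphi m n c z1 z2).
Proof.
  intros Hst H2.
  assert (N := proj2 (stable_closed m n c z2 Hst ltac:(lra))).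
  assert (S := rowp_supp m n c z2 (proj1 Hst)).
  apply anal_div; auto; apply anal_div; auto.
  apply anal_plus; [apply anal_poly_mul, anal_poly|].
  apply anal_scale, anal_poly_mul, anal_poly.
Qed.

Lemma contC_dphi {X} (d : X -> X -> R) m n (c : nat -> nat -> C) (g1 g2 : X -> C) x :
  stable m n c -> Cmod (g1 x) < 1 -> Cmod (g2 x) < 1 -> contC d g1 x -> contC d g2 x ->
  contC d (fun y => dphi m n c (g1 y) (g2 y)) x.
Proof.
  intros Hst H1 H2 C1 C2.
  assert (N := proj2 (stable_closed m n c (g2 x) Hst ltac:(lra)) _ H1).
  assert (R1 : forall k, contC d (fun y => rowp c n (g2 y) k) x)
    by (intros; apply contC_rowp; auto).
  assert (R2 : forall k, contC d (fun y => rowt m n c (g2 y) k) x)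
    by (intros; apply (contC_rowp d (refl_coef m n c)); auto).
  assert (R3 : forall k, contC d (fun y => der (rowp c n (g2 y)) k) x)
    by (intros; apply contC_mult; [apply contC_const|apply R1]).
  assert (R4 : forall k, contC d (fun y => der (rowt m n c (g2 y)) k) x)
    by (intros; apply contC_mult; [apply contC_const|apply R2]).
  apply contC_div; auto; [apply contC_div; auto|]; repeat apply contC_plus;
    repeat apply contC_mult; try apply contC_const; try (apply contC_psum; auto).
Qed.

(** The real mean value theorem for [Re (conj u * F)] along the segment, where [u] is the direction
    of [F w - F a]. A degenerate segment is treated apart, since difference quotients are taken with
    increments [h v]. *)
Lemma segment_mean_value (F g : C -> C) (a w : C) :
  (forall s, 0 <= s <= 1 -> C_deriv_at F (a + RtoC s * (w - a))%C (g (a + RtoC s * (w - a))%C)) ->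
  exists s, 0 <= s <= 1 /\
    Cmod (F w - F a)%C <= Cmod (g (a + RtoC s * (w - a))%C) * Cmod (w - a)%C.
Proof.
  intros H.
  set (v := (w - a)%C).
  destruct (Ceq_dec v 0) as [V|V].
  { exists 0; split; [lra|].
    replace w with a by (replace w with (v + a)%C by (unfold v; ring); rewrite V; ring).
    replace (F a - F a)%C with (RtoC 0) by ring; rewrite Cmod_0.
    apply Rmult_le_pos; apply Cmod_ge_0. }
  assert (V0 : 0 < Cmod v) by (apply Cmod_gt_0; auto).
  destruct (unit_direction (F w - F a)%C) as (u & U1 & U2).
  set (path := fun s => (a + RtoC s * v)%C).
  set (f := fun s => Re (Cconj u * F (path s))%C).
  set (f' := fun s => Re (Cconj u * (g (path s) * v))%C).
  assert (Df : forall s, 0 <= s <= 1 -> derivable_pt_lim f s (f' s)).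
  { intros s Hs eps He.
    destruct (H s Hs (eps / Cmod v)) as (dl & D & Hd); [apply Rdiv_lt_0_compat; auto|].
    assert (D' : 0 < dl / Cmod v) by (apply Rdiv_lt_0_compat; auto).
    exists (mkposreal _ D'); intros h Hh Lh; simpl in Lh.
    assert (Nh : RtoC h <> 0%C) by (apply RtoC_neq_0; auto).
    assert (Mh : Cmod (RtoC h * v)%C = Rabs h * Cmod v) by (rewrite Cmod_mult, Cmod_R; auto).
    assert (K : Cmod ((F (path s + RtoC h * v) - F (path s)) / (RtoC h * v) - g (path s))%C
      < eps / Cmod v).
    { apply (Hd (RtoC h * v)%C); change (Cnorm (RtoC h * v)%C) with (Cmod (RtoC h * v)%C).
      rewrite Mh; split.
      - apply Rmult_lt_0_compat; auto; apply Rabs_pos_lt; auto.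
      - apply Rmult_lt_compat_r with (r := Cmod v) in Lh; auto.
        replace (dl / Cmod v * Cmod v) with dl in Lh by (field; lra); auto. }
    replace (path s + RtoC h * v)%C with (path (s + h)%R) in K
      by (unfold path; rewrite RtoC_plus; ring).
    assert (E : (f (s + h) - f s) / h - f' s
      = Re (Cconj u * v * ((F (path (s + h)%R) - F (path s)) / (RtoC h * v) - g (path s)))%C).
    { replace (Cconj u * v * ((F (path (s + h)%R) - F (path s)) / (RtoC h * v) - g (path s)))%C
        with (RtoC (/ h) * (Cconj u * F (path (s + h)%R) - Cconj u * F (path s))
              - Cconj u * (g (path s) * v))%C
        by (rewrite RtoC_inv by auto; field; auto).
      unfold f, f'.
      set (x := (Cconj u * F (path (s + h)%R))%C); set (y := (Cconj u * F (path s))%C).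
      set (t := (Cconj u * (g (path s) * v))%C); clearbody x y t.
      unfold Re, RtoC, Cminus, Cplus, Copp, Cmult; simpl; field; auto. }
    rewrite E; eapply Rle_lt_trans; [apply re_le_Cmod|].
    rewrite !Cmod_mult, Cmod_conj, U1, Rmult_1_l.
    apply Rmult_lt_compat_l with (r := Cmod v) in K; auto.
    replace (Cmod v * (eps / Cmod v)) with eps in K by (field; lra); exact K. }
  destruct (MVT_cor2 f f' 0 1 ltac:(lra) Df) as (s & Es & Hs).
  exists s; split; [lra|].
  assert (P1 : path 1 = w) by (unfold path, v; ring).
  assert (P0 : path 0 = a) by (unfold path, v; ring).
  assert (L : f 1 - f 0 = Cmod (F w - F a)%C).
  { unfold f; rewrite P1, P0.
    transitivity (Re (Cconj u * (F w - F a))%C).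
    - unfold Re, Cminus, Cplus, Copp, Cmult; simpl; ring.
    - rewrite U2 at 1.
      replace (Cconj u * (RtoC (Cmod (F w - F a)) * u))%C
        with (RtoC (Cmod (F w - F a)%C) * (u * Cconj u))%C by ring.
      rewrite <- Cmod2_conj, U1; unfold Re, RtoC, Cmult; simpl; ring. }
  rewrite <- L, Es, Rminus_0_r, Rmult_1_r; unfold f'.
  eapply Rle_trans; [apply Rle_abs|]; eapply Rle_trans; [apply re_le_Cmod|].
  rewrite !Cmod_mult, Cmod_conj, U1, Rmult_1_l; apply Rle_refl.
Qed.

Lemma Cmod_segment (a w : C) s M : 0 <= s <= 1 -> Cmod a <= M -> Cmod w <= M ->
  Cmod (a + RtoC s * (w - a))%C <= M.
Proof.
  intros Hs Ha Hw.
  replace (a + RtoC s * (w - a))%C with (RtoC (1 - s) * a + RtoC s * w)%C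
    by (rewrite RtoC_minus; ring).
  eapply Rle_trans; [apply Cmod_triangle|].
  rewrite !Cmod_mult, !Cmod_R, !Rabs_pos_eq by lra; nra.
Qed.

Lemma C_deriv_at_cderiv (f : C -> C) (z d : C) : cderiv f z d -> C_deriv_at f z d.
Proof.
  intros (E & HE & E0 & d1 & D1 & H1) eps He.
  destruct (HE eps He) as (d2 & D2 & H2).
  exists (Rmin d1 d2); split; [apply Rmin_pos; auto|].
  change (forall h : C, 0 < Cmod h < Rmin d1 d2 -> Cmod ((f (z + h) - f z) / h - d)%C < eps).
  intros h Hh.
  assert (L1 := Rmin_l d1 d2); assert (L2 := Rmin_r d1 d2).
  assert (Nh : h <> 0%C) by (apply Cmod_gt_0; lra).
  rewrite H1 by lra; replace (h * E h / h)%C with (E h) by (field; auto).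
  rewrite <- E0; apply H2; unfold distC; replace (h - 0)%C with h by ring; lra.
Qed.

(** * Lower bound for the means of the derivative *)

Lemma powp_mono x y p : 0 < p -> 0 <= x <= y -> powp x p <= powp y p.
Proof.
  intros Hp H; unfold powp.
  destruct (Rlt_dec 0 x), (Rlt_dec 0 y); try lra; [|left; apply exp_pos].
  apply Rle_Rpower_l; lra.
Qed.

Lemma powp_cont p : 1 <= p -> forall x, continuous (fun t => powp (Rabs t) p) x.
Proof.
  intros Hp x.
  destruct (Req_dec x 0) as [->|N].
  (* At the origin, [1 <= p] gives [|y|^p <= |y|] for [|y| < 1]. *)
  - apply continuous_of_eps; intros eps He.
    exists (Rmin 1 eps); split; [apply Rmin_pos; lra|]; intros y Hy.
    rewrite Rminus_0_r in Hy; rewrite Rabs_R0.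
    assert (L1 := Rmin_l 1 eps); assert (L2 := Rmin_r 1 eps).
    replace (powp 0 p) with 0 by (unfold powp; destruct (Rlt_dec 0 0); lra).
    rewrite Rminus_0_r; unfold powp; destruct (Rlt_dec 0 (Rabs y)).
    + rewrite Rabs_pos_eq by (left; apply exp_pos).
      apply Rle_lt_trans with (Rabs y); [|lra].
      unfold Rpower.
      rewrite <- (exp_ln (Rabs y)) at 2 by auto; apply exp_le_compat.
      assert (ln (Rabs y) <= 0) by (rewrite <- ln_1; apply ln_le; lra).
      nra.
    + rewrite Rabs_R0; auto.
  - apply (continuous_ext_loc _ (fun t => Rpower (Rabs t) p)).
    + assert (P : 0 < Rabs x) by (apply Rabs_pos_lt; auto).
      exists (mkposreal _ P); intros y Hy.
      change (Rabs (y - x) < Rabs x) in Hy.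
      unfold powp; destruct (Rlt_dec 0 (Rabs y)) as [|Ny]; auto.
      exfalso; apply Ny, Rabs_pos_lt; intros ->.
      rewrite Rminus_0_l, Rabs_Ropp in Hy; lra.
    + unfold Rpower.
      apply (continuous_comp (fun t => p * ln (Rabs t)) exp).
      * apply (continuous_scal_r p (fun t => ln (Rabs t))).
        apply (continuous_comp Rabs ln); [apply continuous_Rabs|].
        apply continuous_ln; apply Rabs_pos_lt; auto.
      * apply continuous_exp.
Qed.

Lemma continuous_powp_Cmod p (f : R -> C) x : 1 <= p -> contC distR f x ->
  continuous (fun t => powp (Cmod (f t)) p) x.
Proof.
  intros Hp H.
  apply continuous_ext with (fun t => powp (Rabs (Cmod (f t))) p).
  - intros t; rewrite Rabs_pos_eq; auto; apply Cmod_ge_0.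
  - apply (continuous_comp (fun t => Cmod (f t)) (fun y => powp (Rabs y) p)).
    + apply continuous_Cmod; auto.
    + apply powp_cont; auto.
Qed.

Definition gmean (m n : nat) (c : nat -> nat -> C) (p r : R) (z2 : C) : R :=
  RInt (fun t => powp (Cmod (dphi m n c (polar r t) z2)) p) 0 (2 * PI).

Lemma powp_nonneg x p : 0 <= powp x p.
Proof. unfold powp; destruct (Rlt_dec 0 x); [left; apply exp_pos|lra]. Qed.

Lemma gmean_cont m n (c : nat -> nat -> C) p r z2 : stable m n c -> 1 <= p ->
  0 < r < 1 -> Cmod z2 < 1 ->
  forall t, continuous (fun t => powp (Cmod (dphi m n c (polar r t) z2)) p) t.
Proof.
  intros Hst Hp Hr Hz t; apply continuous_powp_Cmod; auto.
  apply (contC_dphi distR m n c (polar r) (fun _ => z2)); auto.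
  - rewrite Cmod_polar; lra.
  - apply polar_cont.
  - apply contC_const.
Qed.

Lemma contC_phi_snd m n (c : nat -> nat -> C) z1 z2 : stable m n c ->
  Cmod z1 < 1 -> Cmod z2 <= 1 -> contC distC (fun z => phi m n c z1 z) z2.
Proof.
  intros Hst H1 H2; apply contC_div.
  - apply (stable_closed m n c z2 Hst H2); auto.
  - apply contC_psum; [|apply contC_const]; intros k.
    apply (contC_rowp distC (refl_coef m n c) n (fun w => w)), contC_id.
  - apply contC_psum; [|apply contC_const]; intros k.
    apply (contC_rowp distC c n (fun w => w)), contC_id.
Qed.

(** Somewhere on the segment the derivative has modulus at least [1 / (4 d)]. That point stays at
    distance at least [k d / 2] inside the circle of radius [r], so point evaluation loses a factor
    [4 / (k d)]; the net power is [d * d^(-p)]. *)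
Lemma gmean_lower m n (c : nat -> nat -> C) p r z2 (a w : C) d k :
  stable m n c -> 1 <= p -> Cmod z2 < 1 -> 0 < d <= 1 -> 0 < k <= 1 / 4 ->
  1 - k * d / 2 <= r < 1 -> Cmod a <= 1 - k * d -> Cmod w <= 1 - k * d ->
  Cmod (w - a)%C <= d -> 1 / 4 <= Cmod (phi m n c w z2 - phi m n c a z2)%C ->
  Rpower d (1 - p) <= 4 * Rpower 4 p / k * (gmean m n c p r z2 / (2 * PI)).
Proof.
  intros Hst Hp Hz Hd Hk Hr Ha Hw Hwa Hphi.
  assert (kd : 0 < k * d) by (apply Rmult_lt_0_compat; lra).
  assert (kd4 : k * d <= 1 / 4) by nra.
  destruct (segment_mean_value (fun z => phi m n c z z2) (fun z => dphi m n c z z2) a w)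
    as (s & Hs & Hv).
  { intros s Hs; apply C_deriv_at_cderiv, cderiv_phi; auto.
    eapply Rle_lt_trans; [apply (Cmod_segment a w s (1 - k * d))|]; auto; lra. }
  set (w' := (a + RtoC s * (w - a))%C) in *.
  assert (Hw' : Cmod w' <= 1 - k * d) by (apply Cmod_segment; auto).
  assert (w0 := Cmod_ge_0 w').
  assert (L : / (4 * d) <= Cmod (dphi m n c w' z2)).
  { assert (G0 := Cmod_ge_0 (dphi m n c w' z2)).
    assert (1 / 4 <= Cmod (dphi m n c w' z2) * d) by nra.
    apply Rmult_le_reg_r with (4 * d); [lra|]; rewrite Rinv_l by lra; lra. }
  assert (I0 : 0 < / (4 * d)) by (apply Rinv_0_lt_compat; lra).
  destruct (dphi_anal m n c z2 Hst Hz) as (al & Hal).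
  assert (PE := hardy_point_evaluation r al (fun z => dphi m n c z z2) w' p
    ltac:(lra) ltac:(lra) Hp (Hal r ltac:(lra))).
  assert (Cc : forall t, contC distR (fun t => dphi m n c (polar r t) z2) t).
  { intros t; apply (contC_dphi distR m n c (polar r) (fun _ => z2)); auto.
    - rewrite Cmod_polar; lra.
    - apply polar_cont.
    - apply contC_const. }
  specialize (PE Cc (ex_RInt_continuous_all _ _ _
    (gmean_cont m n c p r z2 Hst Hp ltac:(lra) Hz))).
  fold (gmean m n c p r z2) in PE.
  assert (G0 : 0 <= gmean m n c p r z2).
  { apply RInt_ge_0.
    - assert (H := PI_RGT_0); lra.
    - apply ex_RInt_continuous_all, gmean_cont; auto; lra.
    - intros; apply powp_nonneg. }
  assert (PI0 := PI_RGT_0).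
  assert (M := powp_mono _ _ p ltac:(lra) (conj (Rlt_le _ _ I0) L)).
  assert (V : powp (/ (4 * d)) p = / Rpower 4 p * (Rpower d (1 - p) * / d)).
  { unfold powp; destruct (Rlt_dec 0 (/ (4 * d))); [|lra].
    rewrite Rinv_mult, <- Rpower_mult_distr by (apply Rinv_0_lt_compat; lra).
    f_equal.
    - unfold Rpower; rewrite ln_Rinv by lra; rewrite <- exp_Ropp; f_equal; ring.
    - rewrite <- (Rpower_1 d) at 3 by lra; rewrite <- Rpower_Ropp, <- Rpower_plus.
      unfold Rpower; rewrite ln_Rinv by lra; f_equal; ring. }
  assert (Q : (r + Cmod w') / (r - Cmod w') <= 4 / (k * d)).
  { apply Rle_trans with (2 / (k * d / 2)); [|right; field; lra].
    apply Rmult_le_compat; [lra|left; apply Rinv_0_lt_compat; lra|lra|].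
    apply Rinv_le_contravar; lra. }
  assert (P4 : 0 < Rpower 4 p) by apply exp_pos.
  assert (Pd : 0 < Rpower d (1 - p)) by apply exp_pos.
  assert (T : 2 * PI * (/ Rpower 4 p * (Rpower d (1 - p) * / d))
    <= 4 / (k * d) * gmean m n c p r z2).
  { rewrite <- V; eapply Rle_trans; [apply Rmult_le_compat_l; [lra|apply M]|].
    eapply Rle_trans; [apply PE|]; apply Rmult_le_compat_r; auto. }
  apply Rmult_le_compat_l with (r := d * Rpower 4 p / (2 * PI)) in T.
  - replace (d * Rpower 4 p / (2 * PI) * (2 * PI * (/ Rpower 4 p * (Rpower d (1 - p) * / d))))
      with (Rpower d (1 - p)) in T by (field; lra).
    replace (d * Rpower 4 p / (2 * PI) * (4 / (k * d) * gmean m n c p r z2))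
      with (4 * Rpower 4 p / k * (gmean m n c p r z2 / (2 * PI))) in T by (field; lra).
    exact T.
  - apply Rmult_le_pos; [apply Rmult_le_pos; lra|left; apply Rinv_0_lt_compat; lra].
Qed.

(** * Comparison near a boundary point and compactness *)

Lemma hsum_near m n (c : nat -> nat -> C) p N z e : stable m n c -> Cmod z <= 1 -> 0 < e ->
  exists eta, 0 < eta /\ forall w, Cmod (w - z)%C < eta ->
    hsum m n c p N w <= hsum m n c p N z + e.
Proof.
  intros Hst Hz He; destruct (contC_hsum m n c p N z Hst Hz e He) as (d & D & H).
  exists d; split; auto; intros w Hw; specialize (H w Hw).
  rewrite <- RtoC_minus, Cmod_R in H; apply Rabs_lt_between in H; lra.
Qed.

(** As [d^(1 - p) >= 1], an error of 1 in [hsum] is absorbed into [(C0 + 1) d^(1 - p)], and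
    [gmean_lower] replaces [d^(1 - p)] by the mean. When [d = 1] the summand 1 does this. Only [eta]
    depends on [N] and [z]. *)
Lemma local_estimate m p : 1 < p -> exists C1, 0 < C1 /\
  forall n c N z, stable m n c -> Cmod z = 1 -> exists eta, 0 < eta /\
    forall z2 r, Cmod z2 < 1 -> Cmod (z2 - z)%C < eta -> 1 - eta < r < 1 ->
      hsum m n c p N z2 <= C1 * (1 + gmean m n c p r z2 / (2 * PI)).
Proof.
  intros Hp; destruct (hsum_large m p Hp) as (C0 & C00 & HL).
  assert (K := kappa_bounds m); set (k := kappa m) in *.
  assert (P4 : 0 < Rpower 4 p) by apply exp_pos.
  set (B := 4 * Rpower 4 p / k).
  assert (B0 : 0 < B).
  { apply Rmult_lt_0_compat; [lra|apply Rinv_0_lt_compat; lra]. }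
  exists ((C0 + 1) * (1 + B)); split; [apply Rmult_lt_0_compat; lra|].
  intros n c N z Hst Hz.
  destruct (HL n c z Hst Hz) as (d & Hd & Hh & Hdich).
  specialize (Hh N).
  destruct (hsum_near m n c p N z 1 Hst ltac:(lra) ltac:(lra)) as (e1 & E1 & He1).
  assert (PI0 := PI_RGT_0).
  assert (G0 : forall r z2, 0 < r < 1 -> Cmod z2 < 1 -> 0 <= gmean m n c p r z2 / (2 * PI)).
  { intros r z2 Hr H2; apply Rmult_le_pos; [|left; apply Rinv_0_lt_compat; lra].
    apply RInt_ge_0; [lra| |intros; apply powp_nonneg].
    apply ex_RInt_continuous_all, gmean_cont; auto; lra. }
  assert (D1 : 1 <= Rpower d (1 - p)).
  { unfold Rpower; rewrite <- exp_0 at 1; apply exp_le_compat.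
    assert (ln d <= 0) by (rewrite <- ln_1; apply ln_le; lra); nra. }
  destruct Hdich as [->|(a & w & Ha & Hw & Hwa & Hv)].
  - exists (Rmin e1 1); split; [apply Rmin_pos; lra|]; intros z2 r H2 Hzz Hr.
    assert (M1 := Rmin_l e1 1); assert (M2 := Rmin_r e1 1).
    specialize (He1 z2 ltac:(lra)); specialize (G0 r z2 ltac:(lra) H2).
    replace (Rpower 1 (1 - p)) with 1 in Hh
      by (unfold Rpower; rewrite ln_1, Rmult_0_r, exp_0; auto).
    assert (0 <= (C0 + 1) * (gmean m n c p r z2 / (2 * PI))) by (apply Rmult_le_pos; lra).
    assert (0 <= (C0 + 1) * B * (1 + gmean m n c p r z2 / (2 * PI)))
      by (apply Rmult_le_pos; [apply Rmult_le_pos; lra|lra]).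
    lra.
  - assert (kd : 0 < k * d) by (apply Rmult_lt_0_compat; lra).
    assert (kd4 : k * d <= 1 / 4) by nra.
    destruct (contC_minus distC _ _ z (contC_phi_snd m n c w z Hst ltac:(lra) ltac:(lra))
      (contC_phi_snd m n c a z Hst ltac:(lra) ltac:(lra)) (1 / 4) ltac:(lra)) as (e2 & E2 & He2).
    (* [e1] keeps [hsum] within 1 of its boundary value, [e2] lets the gap between the two values of
       [phi] drop from 1/2 to no less than 1/4, and [k * d / 2] puts the circle of radius [r] well
       outside [a] and [w]. *)
    set (eta := Rmin e1 (Rmin e2 (k * d / 2))).
    exists eta; split; [repeat apply Rmin_pos; lra|]; intros z2 r H2 Hzz Hr.
    assert (M1 : eta <= e1) by apply Rmin_l.
    assert (M2 : eta <= Rmin e2 (k * d / 2)) by apply Rmin_r.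
    assert (M3 := Rmin_l e2 (k * d / 2)); assert (M4 := Rmin_r e2 (k * d / 2)).
    specialize (He1 z2 ltac:(lra)); specialize (G0 r z2 ltac:(lra) H2).
    assert (He2' := He2 z2); unfold distC in He2'; specialize (He2' ltac:(lra)).
    assert (V2 : 1 / 4 <= Cmod (phi m n c w z2 - phi m n c a z2)%C).
    { assert (R1 := Cmod_reverse_triangle (phi m n c w z2 - phi m n c a z2)%C
        (phi m n c w z - phi m n c a z)%C).
      apply Rabs_le_between in R1; lra. }
    assert (L := gmean_lower m n c p r z2 a w d k Hst ltac:(lra) H2 Hd K ltac:(lra)
      Ha Hw Hwa V2).
    fold B in L.
    assert (hsum m n c p N z2 <= (C0 + 1) * Rpower d (1 - p)) by nra.
    assert ((C0 + 1) * Rpower d (1 - p) <= (C0 + 1) * (B * (gmean m n c p r z2 / (2 * PI))))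
      by (apply Rmult_le_compat_l; lra).
    assert (0 <= (C0 + 1) * (gmean m n c p r z2 / (2 * PI))) by (apply Rmult_le_pos; lra).
    assert (0 <= (C0 + 1) * B) by (apply Rmult_le_pos; lra).
    lra.
Qed.

Lemma circle_uniform (P : R -> C -> Prop) :
  (forall z, Cmod z = 1 -> exists eta, 0 < eta /\
     forall z2 r, Cmod z2 < 1 -> Cmod (z2 - z)%C < eta -> 1 - eta < r < 1 -> P r z2) ->
  exists rho, 0 < rho < 1 /\ forall r t, rho < r < 1 -> 0 <= t <= 2 * PI -> P r (polar r t).
Proof.
  intros H.
  assert (Hloc : forall t, exists d : posreal, d <= 1 /\
    forall t' r, Rabs (t' - t) < d -> 1 - d < r < 1 -> P r (polar r t')).
  { intros t; destruct (H (cis t) (Cmod_cis t)) as (eta & E0 & He).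
    destruct (polar_cont_pair (1, t) eta E0) as (d & D0 & Hd).
    assert (M0 : 0 < Rmin 1 (Rmin d eta)) by (repeat apply Rmin_pos; lra).
    assert (M1 := Rmin_l 1 (Rmin d eta)); assert (M2 := Rmin_r 1 (Rmin d eta)).
    assert (M3 := Rmin_l d eta); assert (M4 := Rmin_r d eta).
    exists (mkposreal _ M0); simpl; split; [lra|]; intros t' r Ht Hr.
    apply He; [rewrite Cmod_polar; lra| |lra].
    replace (cis t) with (polar 1 t) by (rewrite polar_cis; apply Cmult_1_l).
    apply (Hd (r, t')); unfold distRR; simpl; apply Rmax_lub_lt; [|lra].
    rewrite Rabs_minus_sym, Rabs_pos_eq; lra. }
  set (delta := fun t => proj1_sig (constructive_indefinite_description _ (Hloc t))).
  destruct (compactness_value_1d 0 (2 * PI) delta) as [d Hd].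
  exists (1 - Rmin d 1 / 2).
  assert (M0 : 0 < Rmin d 1) by (apply Rmin_pos; [apply cond_pos|lra]).
  assert (M1 := Rmin_l d 1); assert (M2 := Rmin_r d 1).
  split; [lra|]; intros r t Hr Ht.
  (* [compactness_value_1d] yields the nearby centre under a double negation. *)
  apply NNPP; intros NP; apply (Hd t Ht); intros (s & Hs & Hts & Hds); apply NP.
  destruct (proj2_sig (constructive_indefinite_description _ (Hloc s))) as [L1 L2].
  apply L2; [exact Hts|].
  fold (delta s); lra.
Qed.

(** * Iterated integrals *)

Definition cont2 (F : R -> R -> R) : Prop := forall x y, continuity_2d_pt F x y.

Lemma cont2_fst F y : cont2 F -> forall x, continuous (fun x => F x y) x.
Proof.
  intros H x; apply continuous_of_eps; intros eps He.
  destruct (H x y (mkposreal eps He)) as [d Hd].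
  exists d; split; [apply cond_pos|]; intros u Hu; apply Hd; auto.
  rewrite Rminus_eq_0, Rabs_R0; apply cond_pos.
Qed.

Lemma cont2_swap F : cont2 F -> cont2 (fun x y => F y x).
Proof. intros H x y eps; destruct (H y x eps) as [d Hd]; exists d; intros u v Hu Hv; auto. Qed.

Lemma cont2_snd F x : cont2 F -> forall y, continuous (fun y => F x y) y.
Proof. intros H; apply (cont2_fst (fun y x => F x y)), cont2_swap; auto. Qed.

Lemma RInt_param_continuous F a b : cont2 F ->
  forall y, continuous (fun y => RInt (fun x => F x y) a b) y.
Proof.
  intros H.
  assert (W : forall a b, a <= b -> forall y, continuous (fun y => RInt (fun x => F x y) a b) y).
  { clear a b; intros a b Hab y; apply continuous_of_eps; intros eps He.
    assert (E : 0 < eps / (b - a + 1)) by (apply Rdiv_lt_0_compat; lra).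
    destruct (uniform_continuity_2d_1d F a b y (fun x _ => H x y) (mkposreal _ E)) as [d Hd].
    exists d; split; [apply cond_pos|]; intros y' Hy.
    assert (I : forall v, is_RInt (fun x => F x v) a b (RInt (fun x => F x v) a b)).
    { intros v; apply (RInt_correct (V := R_CompleteNormedModule)), ex_RInt_continuous_all.
      apply cont2_fst; auto. }
    apply Rle_lt_trans with ((b - a) * (eps / (b - a + 1))).
    - apply (is_RInt_close _ _ a b _ _ _ Hab (I y') (I y)).
      intros t Ht; left; apply Hd; try lra.
      + assert (D := cond_pos d); lra.
      + apply Rabs_lt_between in Hy; lra.
      + rewrite Rminus_eq_0, Rabs_R0; apply cond_pos.
    - replace eps with ((b - a + 1) * (eps / (b - a + 1))) at 2 by (field; lra).
      apply Rmult_lt_compat_r; lra. }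
  destruct (Rle_dec a b) as [L|L]; [apply W; auto|].
  intros y; apply continuous_ext with (fun y => opp (RInt (fun x => F x y) b a)).
  - intros v; apply (opp_RInt_swap (V := R_CompleteNormedModule)).
    apply ex_RInt_continuous_all, cont2_fst; auto.
  - apply (continuous_opp (fun y => RInt (fun x => F x y) b a)), W; lra.
Qed.

(** With the upper limit [b] replaced by a variable [u], the right side is differentiated under the
    integral sign; its derivative is the inner integral of the left side, and it vanishes at
    [u = a]. *)
Lemma RInt_Fubini F a b c d : cont2 F ->
  RInt (fun x => RInt (fun y => F x y) c d) a b = RInt (fun y => RInt (fun x => F x y) a b) c d.
Proof.
  intros H.
  set (J := fun u y => RInt (fun x => F x y) a u).
  assert (DJ : forall y u, is_derive (fun u => J u y) u (F u y)).
  { intros y u; apply (is_derive_RInt (fun x => F x y) (fun u => J u y) a u).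
    - exists (mkposreal 1 Rlt_0_1); intros v _.
      apply (RInt_correct (V := R_CompleteNormedModule)), ex_RInt_continuous_all, cont2_fst; auto.
    - apply (cont2_fst F y H u). }
  assert (DD : forall u y, Derive (fun z => J z y) u = F u y)
    by (intros; apply is_derive_unique, DJ).
  set (Phi := fun u => RInt (fun y => J u y) c d).
  assert (DPhi : forall u, is_derive Phi u (RInt (fun y => F u y) c d)).
  { intros u.
    replace (RInt (fun y => F u y) c d) with (RInt (fun t => Derive (fun z => J z t) u) c d)
      by (apply RInt_ext; intros; apply DD).
    apply (is_derive_RInt_param J c d u).
    - exists (mkposreal 1 Rlt_0_1); intros v _ t _; eexists; apply DJ.
    - intros t _; apply continuity_2d_pt_ext with F; [intros; symmetry; apply DD|apply H].
    - exists (mkposreal 1 Rlt_0_1); intros v _.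
      apply ex_RInt_continuous_all; intros t; apply RInt_param_continuous; auto. }
  assert (I : is_RInt (fun u => RInt (fun y => F u y) c d) a b (minus (Phi b) (Phi a))).
  { apply (is_RInt_derive Phi); intros x _; [apply DPhi|].
    apply (RInt_param_continuous (fun y x => F x y)), cont2_swap; auto. }
  rewrite (is_RInt_unique _ _ _ _ I).
  assert (Z : Phi a = 0).
  { unfold Phi; rewrite (RInt_ext _ (fun _ => 0)).
    - rewrite RInt_const; unfold scal; simpl; unfold mult; simpl; ring.
    - intros y _; unfold J; rewrite RInt_point; reflexivity. }
  rewrite Z; unfold minus, plus, opp; simpl; unfold Phi, J; ring.
Qed.

(** * The double power series *)

(** The recursion for the coefficients divides only by the row of order 0, which has no zero in the
    disc. *)
Lemma phik_anal m n (c : nat -> nat -> C) k : stable m n c -> anal (fun z => phik m n c z k).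
Proof.
  intros Hst.
  assert (S0 : supp n (c O)) by (intros l Hl; apply (proj1 Hst); auto).
  assert (N0 : forall z, Cmod z < 1 -> psum (c O) n z <> 0%C).
  { intros z Hz; apply (proj1 (stable_closed m n c z Hst ltac:(lra))). }
  induction k as [k IH] using (well_founded_induction Wf_nat.lt_wf).
  destruct k as [|k].
  - apply (anal_div (c O) n (psum (refl_coef m n c O) n)); auto; apply anal_poly.
  - apply anal_ext with (fun z => ((psum (refl_coef m n c (S k)) n z
      + (- (1)) * csum (fun j => psum (c (S k - j)%nat) n z * phik m n c z j) k) / psum (c O) n z)%C).
    + intros z _; unfold phik; rewrite quot_S; unfold rowt, rowp.
      f_equal; ring.
    + apply anal_div; auto; apply anal_plus; [apply anal_poly|].
      apply anal_scale.
      apply (anal_csum (fun j z => psum (c (S k - j)%nat) n z * phik m n c z j)%C).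
      intros j Hj; apply anal_poly_mul, IH; lia.
Qed.

Lemma taylor_coefs m n (c : nat -> nat -> C) : stable m n c ->
  exists a : nat -> nat -> C, forall k r, 0 <= r < 1 -> geo r (a k) (fun z => phik m n c z k).
Proof.
  intros Hst.
  exists (fun k => proj1_sig (constructive_indefinite_description _ (phik_anal m n c k Hst))).
  intros k; apply (proj2_sig (constructive_indefinite_description _ (phik_anal m n c k Hst))).
Qed.

Lemma term_le_sum f k N : (forall j, 0 <= f j) -> (k <= N)%nat -> f k <= sum_f_R0 f N.
Proof.
  intros H Hk; induction Hk as [|N Hk IH].
  - destruct k as [|k]; [simpl; lra|].
    rewrite tech5; assert (P := sum_nonneg f k H); lra.
  - rewrite tech5; assert (P := H (S N)); lra.
Qed.

(** A Cauchy estimate uniform in [z], read off the factorisations: the numerator rows are at most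
    [T], the row of order 0 is at least [|c O O| (1 - r)^n], and the [m] divisions by [1 - b z1]
    cost [(1 - r)^(-m)]. *)
Lemma phik_bound m n (c : nat -> nat -> C) r : stable m n c -> 0 <= r < 1 ->
  exists B, 0 <= B /\ forall z k, Cmod z <= r -> Cmod (phik m n c z k) * r ^ k <= B.
Proof.
  intros Hst Hr.
  set (T := sum_f_R0 (fun k => sum_f_R0 (fun l => Cmod (refl_coef m n c k l)) n) m).
  assert (T0 : forall k, 0 <= sum_f_R0 (fun l => Cmod (refl_coef m n c k l)) n)
    by (intros; apply sum_nonneg; intros; apply Cmod_ge_0).
  assert (HT : 0 <= T) by (apply sum_nonneg; auto).
  assert (BT : forall z k, Cmod z <= 1 -> Cmod (rowt m n c z k) <= T).
  { intros z k Hz; destruct (Nat.le_gt_cases k m) as [L|L].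
    - unfold rowt, rowp; eapply Rle_trans; [apply (psum_bound _ _ _ 1 Hz)|].
      apply Rle_trans with (sum_f_R0 (fun l => Cmod (refl_coef m n c k l)) n).
      + apply sum_Rle; intros l _; rewrite pow1, Rmult_1_r; apply Rle_refl.
      + apply (term_le_sum (fun k => sum_f_R0 (fun l => Cmod (refl_coef m n c k l)) n)); auto.
    - rewrite (rowt_supp m n c z k L), Cmod_0; auto. }
  assert (S0 : supp n (c O)) by (intros l Hl; apply (proj1 Hst); auto).
  assert (N0 : forall z, Cmod z < 1 -> psum (c O) n z <> 0%C).
  { intros z Hz; apply (proj1 (stable_closed m n c z Hst ltac:(lra))). }
  assert (c0 : c O O <> 0%C).
  { rewrite <- (psum_at_0 (c O) n); apply N0; rewrite Cmod_0; lra. }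
  destruct (factor_lins_nonvanishing n (c O) c0 S0 N0) as (bs0 & Hl0 & _ & Hb0 & Hev0).
  assert (P : forall d, 0 < (1 - r) ^ d) by (intros; apply pow_lt; lra).
  assert (c0' : 0 < Cmod (c O O)) by (apply Cmod_gt_0; auto).
  set (q := Cmod (c O O) * (1 - r) ^ n).
  assert (q0 : 0 < q) by (apply Rmult_lt_0_compat; auto).
  assert (HB : 0 <= T / (1 - r) ^ m)
    by (apply Rmult_le_pos; auto; left; apply Rinv_0_lt_compat; auto).
  exists (/ q * (T / (1 - r) ^ m)); split.
  { apply Rmult_le_pos; auto; left; apply Rinv_0_lt_compat; auto. }
  intros z k Hz.
  destruct (stable_closed m n c z Hst ltac:(lra)) as [Nz _].
  destruct (stable_factor m n c z Hst ltac:(lra)) as (bs & Hl & Hq & Hb & Hev).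
  unfold phik; rewrite (quot_factor _ _ bs Nz Hq); unfold scale.
  rewrite Cmod_mult, Cmod_inv, Rmult_assoc by auto.
  apply Rmult_le_compat.
  - left; apply Rinv_0_lt_compat, Cmod_gt_0; auto.
  - apply Rmult_le_pos; [apply Cmod_ge_0|apply pow_le; lra].
  - apply Rinv_le_contravar; auto; unfold rowp, q; rewrite Hev0, Cmod_mult.
    apply Rmult_le_compat_l; [lra|].
    eapply Rle_trans; [|apply lin_prod_lower; auto; lra].
    rewrite Hl0; apply pow_incr; lra.
  - rewrite <- Hl at 2; apply div_lins_bound; auto.
    intros j; specialize (BT z j ltac:(lra)).
    assert (0 <= r ^ j) by (apply pow_le; lra).
    assert (r ^ j <= 1) by (apply pow_le_one; lra).
    assert (0 <= Cmod (rowt m n c z j)) by apply Cmod_ge_0; nra.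
Qed.

Lemma contC_phik_circle m n (c : nat -> nat -> C) k r : stable m n c -> 0 <= r <= 1 ->
  forall t, contC distR (fun t => phik m n c (polar r t) k) t.
Proof.
  intros Hst Hr t; apply (contC_comp distR (fun z => phik m n c z k) (polar r)).
  - apply polar_cont.
  - apply contC_phik; auto; rewrite Cmod_polar; lra.
Qed.

(** Cauchy's estimate in the second variable, from a single term of Bessel's inequality. *)
Lemma taylor_bound m n (c a : nat -> nat -> C) r : stable m n c -> 0 < r < 1 ->
  (forall k r, 0 <= r < 1 -> geo r (a k) (fun z => phik m n c z k)) ->
  exists B, 0 <= B /\ forall k l, Cmod (a k l) * r ^ k * r ^ l <= B.
Proof.
  intros Hst Hr Ha.
  destruct (phik_bound m n c r Hst ltac:(lra)) as (B & B0 & HB).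
  exists B; split; auto; intros k l.
  assert (rk : 0 < r ^ k) by (apply pow_lt; lra).
  assert (rl : 0 < r ^ l) by (apply pow_lt; lra).
  assert (PI0 := PI_RGT_0).
  assert (Bes := bessel r (a k) (fun z => phik m n c z k) l ltac:(lra) (Ha k r ltac:(lra))
    (contC_phik_circle m n c k r Hst ltac:(lra))).
  assert (T := term_le_sum (fun j => Cmod (a k j) ^ 2 * r ^ (2 * j)) l l).
  assert (T0 : forall j, 0 <= Cmod (a k j) ^ 2 * r ^ (2 * j))
    by (intros; apply Rmult_le_pos; [apply pow2_ge_0|apply pow_le; lra]).
  specialize (T T0 (le_n l)); cbv beta in T.
  assert (I : RInt (fun t => Cmod (phik m n c (polar r t) k) ^ 2) 0 (2 * PI)
    <= 2 * PI * (B / r ^ k) ^ 2).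
  { apply Rle_trans with (RInt (fun _ => (B / r ^ k) ^ 2) 0 (2 * PI)).
    - apply RInt_le; [lra| |apply ex_RInt_const|].
      + apply ex_RInt_continuous_all; intros t.
        apply (continuous_Cmod2 (fun t => phik m n c (polar r t) k)).
        apply contC_phik_circle; auto; lra.
      + intros t _; apply pow_incr; split; [apply Cmod_ge_0|].
        apply Rmult_le_reg_r with (r ^ k); auto.
        replace (B / r ^ k * r ^ k) with B by (field; lra).
        apply HB; rewrite Cmod_polar; lra.
    - rewrite RInt_const; unfold scal; simpl; unfold mult; simpl; right; ring. }
  assert (Q : Cmod (a k l) ^ 2 * r ^ (2 * l) <= (B / r ^ k) ^ 2).
  { eapply Rle_trans; [apply T|]; eapply Rle_trans; [apply Bes|].
    apply Rmult_le_reg_r with (2 * PI); [lra|].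
    unfold Rdiv at 1; rewrite Rmult_assoc, Rinv_l by lra; lra. }
  assert (L : Cmod (a k l) * r ^ l <= B / r ^ k).
  { apply pow2_le_reg.
    - apply Rmult_le_pos; auto; left; apply Rinv_0_lt_compat; auto.
    - rewrite Rpow_mult_distr, <- pow_mult, (Nat.mul_comm l 2); exact Q. }
  apply Rmult_le_compat_r with (r := r ^ k) in L; [|lra].
  replace (B / r ^ k * r ^ k) with B in L by (field; lra); lra.
Qed.

Lemma geometric_sum_le x N : 0 <= x < 1 -> sum_f_R0 (fun k => x ^ k) N <= / (1 - x).
Proof.
  intros Hx.
  assert (E : sum_f_R0 (fun k => x ^ k) N * (1 - x) = 1 - x ^ S N).
  { induction N as [|N IH]; [simpl; ring|].
    rewrite tech5, Rmult_plus_distr_r, IH; simpl; ring. }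
  assert (P : 0 <= x ^ S N) by (apply pow_le; lra).
  apply Rmult_le_reg_r with (1 - x); [lra|]; rewrite Rinv_l, E; lra.
Qed.

Definition rsum2 (f : nat -> nat -> R) (N : nat) : R :=
  sum_f_R0 (fun k => sum_f_R0 (fun l => f k l) N) N.

Lemma taylor_converges m n (c a : nat -> nat -> C) z1 z2 : stable m n c ->
  (forall k r, 0 <= r < 1 -> geo r (a k) (fun z => phik m n c z k)) ->
  Cmod z1 < 1 -> Cmod z2 < 1 ->
  (exists B, forall N, rsum2 (fun k l => Cmod (a k l) * Cmod z1 ^ k * Cmod z2 ^ l) N <= B) /\
  (forall eps, 0 < eps -> exists N0, forall N, (N0 <= N)%nat ->
     Cmod (csum (fun k => csum (fun l => a k l * (Cpow z1 k * Cpow z2 l)) N) N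
           - phi m n c z1 z2)%C < eps).
Proof.
  intros Hst Ha H1 H2.
  set (r := (1 + Rmax (Cmod z1) (Cmod z2)) / 2).
  assert (M1 := Rmax_l (Cmod z1) (Cmod z2)); assert (M2 := Rmax_r (Cmod z1) (Cmod z2)).
  assert (M3 : Rmax (Cmod z1) (Cmod z2) < 1) by (apply Rmax_lub_lt; auto).
  assert (z10 := Cmod_ge_0 z1); assert (z20 := Cmod_ge_0 z2).
  assert (Hr : 0 < r < 1) by (unfold r; lra).
  destruct (taylor_bound m n c a r Hst Hr Ha) as (B & B0 & HB).
  assert (Fr : forall x, 0 <= x < r -> 0 <= x / r < 1).
  { intros x Hx; split; [apply Rmult_le_pos; [lra|left; apply Rinv_0_lt_compat; lra]|].
    apply Rmult_lt_reg_r with r; [lra|]; unfold Rdiv; rewrite Rmult_assoc, Rinv_l; lra. }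
  assert (Hx := Fr (Cmod z1) ltac:(unfold r in *; lra)).
  assert (Hy := Fr (Cmod z2) ltac:(unfold r in *; lra)).
  set (x := Cmod z1 / r) in *; set (y := Cmod z2 / r) in *.
  assert (Ex : forall k, Cmod z1 ^ k = x ^ k * r ^ k)
    by (intros; rewrite <- Rpow_mult_distr; f_equal; unfold x; field; lra).
  assert (Ey : forall k, Cmod z2 ^ k = y ^ k * r ^ k)
    by (intros; rewrite <- Rpow_mult_distr; f_equal; unfold y; field; lra).
  assert (T : forall k l, Cmod (a k l) * Cmod z1 ^ k * Cmod z2 ^ l <= B * x ^ k * y ^ l).
  { intros k l; rewrite Ex, Ey.
    apply Rle_trans with ((Cmod (a k l) * r ^ k * r ^ l) * (x ^ k * y ^ l)); [right; ring|].
    rewrite (Rmult_assoc B); apply Rmult_le_compat_r; auto.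
    apply Rmult_le_pos; apply pow_le; lra. }
  assert (I1 : 0 < / (1 - x)) by (apply Rinv_0_lt_compat; lra).
  assert (I2 : 0 < / (1 - y)) by (apply Rinv_0_lt_compat; lra).
  split.
  - exists (B * / (1 - y) * / (1 - x)); intros N; unfold rsum2.
    apply Rle_trans with (sum_f_R0 (fun k => x ^ k * (B * / (1 - y))) N).
    + apply sum_Rle; intros k _.
      apply Rle_trans with (sum_f_R0 (fun l => y ^ l * (B * x ^ k)) N).
      * apply sum_Rle; intros l _; eapply Rle_trans; [apply T|right; ring].
      * rewrite <- scal_sum.
        apply Rle_trans with (B * x ^ k * / (1 - y)); [|right; ring].
        apply Rmult_le_compat_l; [apply Rmult_le_pos; auto; apply pow_le; lra|].
        apply geometric_sum_le; auto.
    + rewrite <- scal_sum; apply Rmult_le_compat_l; [apply Rmult_le_pos; lra|].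
      apply geometric_sum_le; auto.
  - intros eps He.
    destruct (phik_geo m n c z2 (Cmod z1) Hst ltac:(lra) ltac:(lra)) as (K & th & K0 & Ht & HK).
    set (Q := B / (1 - y) * / (1 - x)).
    assert (Q0 : 0 <= Q) by (repeat apply Rmult_le_pos; lra).
    destruct (geo_small K th (eps / 2) K0 Ht ltac:(lra)) as (N1 & HN1).
    (* [geo_small] wants a positive ratio, whereas [y] is 0 when [z2] is. *)
    destruct (geo_small Q (Rmax y (1 / 2)) (eps / 2) Q0) as (N2 & HN2); [|lra|].
    { split; [apply Rlt_le_trans with (1 / 2); [lra|apply Rmax_r]|apply Rmax_lub_lt; lra]. }
    exists (max N1 N2); intros N HN.
    specialize (HN1 N ltac:(lia)); specialize (HN2 N ltac:(lia)).
    specialize (HK z1 ltac:(lra) N).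
    (* The error splits into the row tails in [z2], controlled together by [geo_tail], and the tail
       in [z1] of the single series of [phi (_, z2)]. *)
    assert (E : csum (fun k => csum (fun l => a k l * (Cpow z1 k * Cpow z2 l)) N)%C N
      = (csum (fun k => (psum (a k) N z2 - phik m n c z2 k) * Cpow z1 k) N
         + psum (phik m n c z2) N z1)%C).
    { unfold psum at 2; rewrite <- csum_plus; apply csum_ext; intros k _.
      transitivity (psum (a k) N z2 * Cpow z1 k)%C; [|ring].
      unfold psum; rewrite <- csum_scal_r; apply csum_ext; intros; ring. }
    rewrite E.
    set (S := csum _ N); set (P := psum (phik m n c z2) N z1) in *.
    replace (S + P - phi m n c z1 z2)%C with (S + (P - phi m n c z1 z2))%C by ring.
    eapply Rle_lt_trans; [apply Cmod_triangle|].
    assert (HS : Cmod S <= Q * y ^ N).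
    { unfold S; eapply Rle_trans; [apply csum_mod|].
      apply Rle_trans with (sum_f_R0 (fun k => x ^ k * (B / (1 - y) * y ^ N)) N).
      - apply sum_Rle; intros k _; rewrite Cmod_mult, Cmod_pow, Ex.
        assert (rk : 0 < r ^ k) by (apply pow_lt; lra).
        assert (G := geo_tail r (a k) (fun z => phik m n c z k) z2 N (B / r ^ k) y
          (Ha k r ltac:(lra)) ltac:(unfold r; lra)).
        assert (Bk : 0 <= B / r ^ k)
          by (apply Rmult_le_pos; auto; left; apply Rinv_0_lt_compat; auto).
        specialize (G Bk Hy).
        assert (G' : Cmod (psum (a k) N z2 - phik m n c z2 k)%C <= B / r ^ k / (1 - y) * y ^ N).
        { apply G; intros l; rewrite Ey.
          specialize (HB k l).
          apply Rmult_le_reg_r with (r ^ k); auto.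
          replace (B / r ^ k * y ^ l * r ^ k) with (B * y ^ l) by (field; lra).
          apply Rle_trans with ((Cmod (a k l) * r ^ k * r ^ l) * y ^ l); [right; ring|].
          apply Rmult_le_compat_r; auto; apply pow_le; lra. }
        apply Rle_trans with (B / r ^ k / (1 - y) * y ^ N * (x ^ k * r ^ k)).
        + apply Rmult_le_compat_r; auto; apply Rmult_le_pos; apply pow_le; lra.
        + right; field; lra.
      - rewrite <- scal_sum.
        apply Rle_trans with (B / (1 - y) * y ^ N * / (1 - x)); [|unfold Q; right; ring].
        apply Rmult_le_compat_l; [|apply geometric_sum_le; auto].
        apply Rmult_le_pos; [apply Rmult_le_pos; lra|apply pow_le; lra]. }
    assert (Q * y ^ N <= Q * Rmax y (1 / 2) ^ N).
    { apply Rmult_le_compat_l; auto; apply pow_incr; split; [lra|apply Rmax_l]. }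
    lra.
Qed.

(** * Integration of the boundary estimate *)

Definition gfun (m n : nat) (c : nat -> nat -> C) (p r t1 t2 : R) : R :=
  powp (Cmod (dphi m n c (polar r t1) (polar r t2))) p.

Lemma gfun_cont2 m n (c : nat -> nat -> C) p r : stable m n c -> 1 <= p -> 0 < r < 1 ->
  cont2 (gfun m n c p r).
Proof.
  intros Hst Hp Hr x y.
  apply continuity_2d_pt_ext with
    (fun u v => (fun s => powp (Rabs s) p) (Cmod (dphi m n c (polar r u) (polar r v)))).
  { intros u v; unfold gfun; rewrite Rabs_pos_eq; auto; apply Cmod_ge_0. }
  apply (continuity_1d_2d_pt_comp (fun s => powp (Rabs s) p)
    (fun u v => Cmod (dphi m n c (polar r u) (polar r v)))).
  - apply continuity_pt_filterlim, powp_cont; auto.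
  - apply (continuity_2d_Cmod (fun u v => dphi m n c (polar r u) (polar r v))).
    apply (contC_dphi distRR m n c (fun q => polar r (fst q)) (fun q => polar r (snd q))); auto.
    + rewrite Cmod_polar; lra.
    + rewrite Cmod_polar; lra.
    + apply polar_cont_fst.
    + apply polar_cont_snd.
Qed.

Lemma hsum_circle_cont m n (c : nat -> nat -> C) p N r : stable m n c -> 0 <= r <= 1 ->
  forall t, continuous (fun t => hsum m n c p N (polar r t)) t.
Proof.
  intros Hst Hr t.
  apply (continuous_Re (fun t => RtoC (hsum m n c p N (polar r t)))).
  apply (contC_comp distR (fun z => RtoC (hsum m n c p N z)) (polar r)).
  - apply polar_cont.
  - apply contC_hsum; auto; rewrite Cmod_polar; lra.
Qed.

Lemma hsum_integral_bound m n (c : nat -> nat -> C) p : stable m n c -> 0 < p ->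
  (1 < p -> exists M, forall r, 0 < r < 1 ->
    RInt (fun t2 => RInt (fun t1 => gfun m n c p r t1 t2) 0 (2 * PI)) 0 (2 * PI) <= M) ->
  exists B, forall N, exists rho, 0 < rho < 1 /\ forall r, rho < r < 1 ->
    RInt (fun t => hsum m n c p N (polar r t)) 0 (2 * PI) <= B.
Proof.
  intros Hst Hp HM; assert (PI0 := PI_RGT_0).
  assert (Ex : forall N r, 0 <= r <= 1 -> ex_RInt (fun t => hsum m n c p N (polar r t)) 0 (2 * PI))
    by (intros; apply ex_RInt_continuous_all, hsum_circle_cont; auto).
  destruct (Rle_dec p 1) as [P1|P1].
  - exists (2 * PI * (blaschke_bound m + 1)); intros N.
    destruct (circle_uniform (fun _ z => hsum m n c p N z <= blaschke_bound m + 1))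
      as (rho & Hrho & H).
    { intros z Hz.
      destruct (hsum_near m n c p N z 1 Hst ltac:(lra) ltac:(lra)) as (e & E & He).
      exists e; split; auto; intros z2 r _ Hzz _; specialize (He z2 Hzz).
      assert (S := hsum_small m n c p N z Hst Hz ltac:(lra)); lra. }
    exists rho; split; auto; intros r Hr.
    apply Rle_trans with (RInt (fun _ => blaschke_bound m + 1) 0 (2 * PI)).
    + apply RInt_le; [lra|apply Ex; lra|apply ex_RInt_const|].
      intros t Ht; apply H; lra.
    + rewrite RInt_const; unfold scal; simpl; unfold mult; simpl; right; ring.
  - destruct (HM ltac:(lra)) as (M & HM').
    destruct (local_estimate m p ltac:(lra)) as (C1 & C10 & HL).
    exists (C1 * (2 * PI + M / (2 * PI))); intros N.
    destruct (circle_uniform (fun r z => hsum m n c p N z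
      <= C1 * (1 + gmean m n c p r z / (2 * PI)))) as (rho & Hrho & H).
    { intros z Hz; apply HL; auto. }
    exists rho; split; auto; intros r Hr.
    assert (CG : forall t, continuous (fun t => gmean m n c p r (polar r t)) t).
    { apply (RInt_param_continuous (gfun m n c p r)), gfun_cont2; auto; lra. }
    assert (IG := RInt_correct (V := R_CompleteNormedModule) _ _ _
      (ex_RInt_continuous_all _ 0 (2 * PI) CG)).
    specialize (HM' r ltac:(lra)).
    change (RInt (fun t => gmean m n c p r (polar r t)) 0 (2 * PI) <= M) in HM'.
    assert (I1 : is_RInt (fun t => C1 * (1 + gmean m n c p r (polar r t) / (2 * PI))) 0 (2 * PI)
      (C1 * (2 * PI + RInt (fun t => gmean m n c p r (polar r t)) 0 (2 * PI) / (2 * PI)))).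
    { set (G := RInt _ 0 (2 * PI)) in *.
      apply (is_RInt_ext (fun t => scal C1 (plus 1 (scal (/ (2 * PI)) (gmean m n c p r (polar r t)))))).
      - intros t _; unfold scal, plus; simpl; unfold mult; simpl; unfold Rdiv; ring.
      - replace (C1 * (2 * PI + G / (2 * PI)))
          with (scal C1 (plus (scal (2 * PI - 0) 1) (scal (/ (2 * PI)) G)))
          by (unfold scal, plus; simpl; unfold mult; simpl; unfold Rdiv; ring).
        apply (is_RInt_scal (V := R_NormedModule)).
        apply (is_RInt_plus (V := R_NormedModule)).
        + apply (is_RInt_const (V := R_NormedModule)).
        + apply (is_RInt_scal (V := R_NormedModule)); exact IG. }
    apply Rle_trans with (C1 * (2 * PI
      + RInt (fun t => gmean m n c p r (polar r t)) 0 (2 * PI) / (2 * PI))).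
    + rewrite <- (is_RInt_unique _ _ _ _ I1).
      apply RInt_le; [lra|apply Ex; lra|eexists; apply I1|].
      intros t Ht; apply H; lra.
    + apply Rmult_le_compat_l; [lra|].
      apply Rplus_le_compat_l, Rmult_le_compat_r; auto.
      left; apply Rinv_0_lt_compat; lra.
Qed.

Lemma RInt_sum_f_R0 (f : nat -> R -> R) a b N :
  (forall k, (k <= N)%nat -> ex_RInt (f k) a b) ->
  is_RInt (fun t => sum_f_R0 (fun k => f k t) N) a b (sum_f_R0 (fun k => RInt (f k) a b) N).
Proof.
  induction N as [|N IH]; intros H.
  - apply (RInt_correct (V := R_CompleteNormedModule)), H; lia.
  - apply (is_RInt_plus (V := R_NormedModule)); [apply IH; auto|].
    apply (RInt_correct (V := R_CompleteNormedModule)), H; lia.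
Qed.

(** Bessel's inequality in [z2] for each row, summed with the weights of the first index. *)
Lemma taylor_energy m n (c a : nat -> nat -> C) p N r : stable m n c -> 0 <= r < 1 ->
  (forall k r, 0 <= r < 1 -> geo r (a k) (fun z => phik m n c z k)) ->
  sum_f_R0 (fun k => sum_f_R0 (fun l => Rpower (INR k + 1) p * Cmod (a k l) ^ 2 * r ^ (2 * l)) N) N
  <= RInt (fun t => hsum m n c p N (polar r t)) 0 (2 * PI) / (2 * PI).
Proof.
  intros Hst Hr Ha; assert (PI0 := PI_RGT_0).
  assert (Ck : forall k, ex_RInt (fun t => Cmod (phik m n c (polar r t) k) ^ 2) 0 (2 * PI)).
  { intros k; apply ex_RInt_continuous_all; intros t.
    apply (continuous_Cmod2 (fun t => phik m n c (polar r t) k)).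
    apply contC_phik_circle; auto; lra. }
  assert (E : RInt (fun t => hsum m n c p N (polar r t)) 0 (2 * PI)
    = sum_f_R0 (fun k => RInt (fun t => Rpower (INR k + 1) p
        * Cmod (phik m n c (polar r t) k) ^ 2) 0 (2 * PI)) N).
  { apply is_RInt_unique.
    apply (RInt_sum_f_R0 (fun k t => Rpower (INR k + 1) p * Cmod (phik m n c (polar r t) k) ^ 2)).
    intros k _; apply (ex_RInt_scal (V := R_NormedModule)); auto. }
  rewrite E; unfold Rdiv; rewrite Rmult_comm, scal_sum.
  apply sum_Rle; intros k _.
  rewrite (RInt_scal (V := R_CompleteNormedModule)) by auto.
  assert (Bes := bessel r (a k) (fun z => phik m n c z k) N ltac:(lra) (Ha k r ltac:(lra))
    (contC_phik_circle m n c k r Hst ltac:(lra))).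
  match goal with |- _ <= ?x * _ => change x with (Rpower (INR k + 1) p
    * RInt (fun t => Cmod (phik m n c (polar r t) k) ^ 2) 0 (2 * PI)) end.
  assert (W : 0 < Rpower (INR k + 1) p) by apply exp_pos.
  apply Rle_trans with (Rpower (INR k + 1) p
    * sum_f_R0 (fun l => Cmod (a k l) ^ 2 * r ^ (2 * l)) N).
  - rewrite scal_sum; right; apply sum_eq; intros; ring.
  - rewrite Rmult_assoc; apply Rmult_le_compat_l; [lra|exact Bes].
Qed.

Lemma weighted_sum_bound m n (c a : nat -> nat -> C) p : stable m n c -> 0 < p ->
  (forall k r, 0 <= r < 1 -> geo r (a k) (fun z => phik m n c z k)) ->
  (1 < p -> exists M, forall r, 0 < r < 1 ->
    RInt (fun t2 => RInt (fun t1 => gfun m n c p r t1 t2) 0 (2 * PI)) 0 (2 * PI) <= M) ->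
  exists B, forall N, rsum2 (fun k l => Rpower (INR k + 1) p * Cmod (a k l) ^ 2) N <= B.
Proof.
  intros Hst Hp Ha HM; assert (PI0 := PI_RGT_0).
  destruct (hsum_integral_bound m n c p Hst Hp HM) as (B & HB).
  exists (B / (2 * PI)); intros N.
  destruct (HB N) as (rho & Hrho & H).
  assert (T0 : forall k l, 0 <= Rpower (INR k + 1) p * Cmod (a k l) ^ 2).
  { intros; apply Rmult_le_pos; [left; apply exp_pos|apply pow2_ge_0]. }
  set (S := rsum2 (fun k l => Rpower (INR k + 1) p * Cmod (a k l) ^ 2) N).
  assert (S0 : 0 <= S) by (apply sum_nonneg; intros; apply sum_nonneg; auto).
  (* All [l] in the sum are at most [N], so the factors [r^(2l)] are bounded below by the common
     [r^(2N)]. *)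
  assert (L : forall r, rho < r < 1 -> r ^ (2 * N) * S <= B / (2 * PI)).
  { intros r Hr.
    apply Rle_trans with (RInt (fun t => hsum m n c p N (polar r t)) 0 (2 * PI) / (2 * PI)).
    - eapply Rle_trans; [|apply (taylor_energy m n c a p N r Hst ltac:(lra) Ha)].
      unfold S, rsum2; rewrite scal_sum; apply sum_Rle; intros k _.
      rewrite Rmult_comm, scal_sum; apply sum_Rle; intros l Hl.
      apply Rmult_le_compat_l; auto.
      replace (2 * N)%nat with (2 * l + 2 * (N - l))%nat by lia; rewrite pow_add.
      assert (0 <= r ^ (2 * l)) by (apply pow_le; lra).
      assert (r ^ (2 * (N - l)) <= 1) by (apply pow_le_one; lra); nra.
    - apply Rmult_le_compat_r; [left; apply Rinv_0_lt_compat; lra|].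
      apply H; auto. }
  apply le_epsilon; intros e He.
  assert (N0 := pos_INR (2 * N)).
  set (q := INR (2 * N) * S + 1).
  assert (q0 : 0 < q) by (unfold q; assert (0 <= INR (2 * N) * S) by (apply Rmult_le_pos; auto); lra).
  (* The limit [r -> 1] made explicit: at [r = 1 - y], Bernoulli gives [S <= B / (2 PI) + 2 N y S],
     and [y <= e / q] makes the last term at most [e]. *)
  set (y := Rmin ((1 - rho) / 2) (e / q)).
  assert (y1 : y <= (1 - rho) / 2) by apply Rmin_l.
  assert (y2 : y <= e / q) by apply Rmin_r.
  assert (y0 : 0 < y) by (apply Rmin_pos; [lra|apply Rdiv_lt_0_compat; auto]).
  specialize (L (1 - y) ltac:(lra)).
  assert (Be := bernoulli_sub y (2 * N) ltac:(lra)).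
  assert ((1 - INR (2 * N) * y) * S <= (1 - y) ^ (2 * N) * S) by (apply Rmult_le_compat_r; auto).
  assert (y * q <= e).
  { apply Rle_trans with (e / q * q); [apply Rmult_le_compat_r; lra|right; field; lra]. }
  unfold q in *; nra.
Qed.

(** * Translation of the statement *)

Lemma Csum_csum (f : nat -> C) N : Csum f N = csum f N.
Proof. induction N as [|N IH]; [reflexivity|]; simpl; rewrite IH; reflexivity. Qed.

Lemma Defs_Cpow (z : C) k : Defs.Cpow z k = Cpow z k.
Proof. induction k as [|k IH]; [reflexivity|]; simpl; rewrite IH; reflexivity. Qed.

Lemma peval_psum m n (c : nat -> nat -> C) (z1 z2 : C) :
  peval m n c z1 z2 = psum (rowp c n z2) m z1.
Proof.
  unfold peval; rewrite Csum_csum; apply csum_ext; intros k _.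
  rewrite Csum_csum; unfold rowp, psum; rewrite <- csum_scal_r.
  apply csum_ext; intros l _; rewrite !Defs_Cpow.
  change (c k l * (z1 ^ k * z2 ^ l) = c k l * z2 ^ l * z1 ^ k)%C; ring.
Qed.

Lemma rif_phi m n (c : nat -> nat -> C) (z1 z2 : C) : rif m n c z1 z2 = phi m n c z1 z2.
Proof.
  unfold rif, phi, rowt; rewrite (peval_psum m n c), (peval_psum m n (refl_coef m n c)).
  reflexivity.
Qed.

Lemma Defs_RInt f a b : ex_RInt f a b -> Defs.RInt f a b = RInt f a b.
Proof.
  intros H; unfold Defs.RInt.
  destruct (excluded_middle_informative _) as [I|I].
  - rewrite <- RInt_Reals; reflexivity.
  - exfalso; apply I; constructor; apply ex_RInt_Reals_0; auto.
Qed.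

Lemma Defs_RInt_iterated F a b c d : cont2 F ->
  Defs.RInt (fun x => Defs.RInt (fun y => F x y) c d) a b = RInt (fun x => RInt (fun y => F x y) c d) a b.
Proof.
  intros H.
  assert (E : (fun x => Defs.RInt (fun y => F x y) c d) = (fun x => RInt (fun y => F x y) c d)).
  { apply functional_extensionality; intros x.
    apply Defs_RInt, ex_RInt_continuous_all, cont2_snd; auto. }
  rewrite E; apply Defs_RInt, ex_RInt_continuous_all.
  apply (RInt_param_continuous (fun y x => F x y)), cont2_swap; auto.
Qed.

(** For [g = f / (1 - z/z0)], the number [z0^k g_k] is the partial sum of [f] at [z0]; it is
    therefore 0 from order [n] on, and [g] is a polynomial. The factor [- 1/z0] converts [1 - z/z0]
    into [z - z0]. *)
Lemma psum_div_root (f : nat -> C) n (z0 : C) : z0 <> 0%C -> supp n f -> psum f n z0 = 0%C ->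
  exists e, forall z, psum f n z = ((z - z0) * psum e n z)%C.
Proof.
  intros N0 Hs H0.
  set (g := div_lin (/ z0)%C f).
  assert (E : forall k, (Cpow z0 k * g k = psum f k z0)%C).
  { induction k as [|k IH]; [unfold g, psum; simpl; ring|].
    rewrite psum_S, <- IH, Cpow_S; unfold g; simpl div_lin; field; auto. }
  assert (Gn : g n = 0%C).
  { specialize (E n); rewrite H0 in E.
    assert (P : Cpow z0 n <> 0%C) by (apply Cmod_gt_0; rewrite Cmod_pow; apply pow_lt, Cmod_gt_0; auto).
    replace (g n) with (/ Cpow z0 n * (Cpow z0 n * g n))%C by (field; auto).
    rewrite E; ring. }
  assert (Gs : forall k, (n <= k)%nat -> g k = 0%C).
  { intros k Hk; induction Hk as [|k Hk IH]; [auto|].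
    unfold g in *; simpl; rewrite IH, Hs by lia; ring. }
  exists (scale (- / z0)%C g); intros z.
  rewrite <- (psum_supp n f (S n) z Hs) by lia.
  rewrite <- (mul_div_lin (/ z0)%C f); fold g.
  rewrite psum_mul_lin, psum_S, Gs, psum_scale by lia; field; auto.
Qed.

Lemma row_div_root m n (d : nat -> nat -> C) (z0 : C) : z0 <> 0%C ->
  (forall k, supp n (d k)) -> (forall k, rowp d n z0 k = 0%C) ->
  exists e, forall z1 z2 : C, peval m n d z1 z2 = ((z2 - z0) * peval m n e z1 z2)%C.
Proof.
  intros N0 Hs H0.
  assert (X : forall k, exists e, forall z, psum (d k) n z = ((z - z0) * psum e n z)%C)
    by (intros k; apply psum_div_root; auto; apply H0).
  exists (fun k => proj1_sig (constructive_indefinite_description _ (X k))); intros z1 z2.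
  rewrite !peval_psum; unfold psum at 1 2; rewrite <- csum_scal.
  apply csum_ext; intros k _.
  unfold rowp; destruct (constructive_indefinite_description _ (X k)) as [e He]; simpl.
  rewrite He; ring.
Qed.

(** If the slice over a unimodular [z] vanished identically, so would that of the reflection, by
    [rowt_unimodular]. Then [z2 - z] would be a nonconstant common factor of [p] and its
    reflection. *)
Lemma stable_of_atoral m n (c : nat -> nat -> C) : bideg m n c ->
  (forall z1 z2, inD2 z1 z2 -> peval m n c z1 z2 <> C0) -> atoral m n c -> stable m n c.
Proof.
  intros (Hs & _) Hn Hat; split; [exact Hs|split].
  - intros z1 z2 H1 H2; rewrite <- peval_psum; apply (Hn z1 z2); split; auto.
  - intros z Hz; apply NNPP; intros Hno.
    assert (Z : forall k, rowp c n z k = 0%C).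
    { intros k; apply NNPP; intros H; apply Hno; exists k; auto. }
    assert (N0 : z <> 0%C) by (intros ->; rewrite Cmod_0 in Hz; lra).
    assert (Zt : forall k, rowp (refl_coef m n c) n z k = 0%C).
    { intros k; change (rowt m n c z k = 0%C); rewrite rowt_unimodular by auto.
      unfold scale, refl1; destruct (Nat.leb k m); [rewrite Z, Cconj_RtoC; ring|ring]. }
    destruct (row_div_root m n c z N0) as (e & He); auto.
    { intros k l Hl; apply Hs; auto. }
    destruct (row_div_root m n (refl_coef m n c) z N0) as (e' & He'); auto.
    { intros k l Hl; apply refl_coef_supp; auto. }
    destruct (Hat (fun _ z2 => Cminus z2 z)) as [a Ha].
    + exists O, 1%nat, (fun _ l => match l with O => Copp z | _ => RtoC 1 end); intros z1 z2.
      rewrite peval_psum; unfold rowp, psum; simpl csum.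
      change ((z2 - z)%C = ((- z * 1 + 1 * (z2 * 1)) * 1)%C); ring.
    + exists (fun z1 z2 => peval m n e z1 z2); split; [exists m, n, e; auto|exact He].
    + exists (fun z1 z2 => peval m n e' z1 z2); split; [exists m, n, e'; auto|exact He'].
    + assert (A1 := Ha (RtoC 0) z); assert (A2 := Ha (RtoC 0) (RtoC 0)).
      rewrite <- A1 in A2; apply N0.
      transitivity (- ((0 - z) - (z - z)))%C; [ring|].
      rewrite A2; ring.
Qed.

Lemma in_Dir_of_bound m n (c : nat -> nat -> C) p : stable m n c -> 0 < p ->
  (1 < p -> exists M, forall r, 0 < r < 1 ->
    RInt (fun t2 => RInt (fun t1 => gfun m n c p r t1 t2) 0 (2 * PI)) 0 (2 * PI) <= M) ->
  in_Dir p 0 (phi m n c).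
Proof.
  intros Hst Hp HM.
  destruct (taylor_coefs m n c Hst) as (a & Ha).
  exists a; split.
  - intros z1 z2 (H1 & H2).
    destruct (taylor_converges m n c a z1 z2 Hst Ha H1 H2) as (B & Hc); split; [exact B|].
    intros eps He; destruct (Hc eps He) as (N0 & HN); exists N0; intros N HNN.
    specialize (HN N HNN).
    unfold Csum2; rewrite Csum_csum.
    rewrite (csum_ext _ (fun k => csum (fun l => a k l * (Cpow z1 k * Cpow z2 l)) N)%C); [exact HN|].
    intros k _; rewrite Csum_csum; apply csum_ext; intros l _; rewrite !Defs_Cpow; reflexivity.
  - destruct (weighted_sum_bound m n c a p Hst Hp Ha HM) as (B & HB).
    exists B; intros N; eapply Rle_trans; [|apply (HB N)].
    apply sum_Rle; intros k _; apply sum_Rle; intros l _.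
    unfold weight; rewrite Rpower_O, Rmult_1_r by (assert (H := pos_INR l); lra).
    apply Rle_refl.
Qed.

Lemma in_Dir_ext al1 al2 f g : (forall z1 z2, f z1 z2 = g z1 z2) ->
  in_Dir al1 al2 f -> in_Dir al1 al2 g.
Proof.
  intros E (a & H1 & H2); exists a; split; auto.
  intros z1 z2 Hz; rewrite <- E; auto.
Qed.

Lemma dphi_unique m n (c : nat -> nat -> C) (f : CC -> CC -> CC) (z1 z2 d : C) : stable m n c ->
  (forall w z, f w z = phi m n c w z) -> inD2 z1 z2 ->
  C_deriv_at (fun w => f w z2) z1 d -> d = dphi m n c z1 z2.
Proof.
  intros Hst E (H1 & H2) Hd.
  apply (cderiv_unique_at (fun w => phi m n c w z2) z1); [apply cderiv_phi; auto|].
  replace (fun w => phi m n c w z2) with (fun w => f w z2); auto.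
  apply functional_extensionality; intros w; apply E.
Qed.

Lemma polar_inD r t : 0 < r < 1 -> inD (polar r t).
Proof. intros Hr; change (Cmod (polar r t) < 1); rewrite Cmod_polar; lra. Qed.

Lemma four_pi_sq_bound x M : / (4 * PI ^ 2) * x <= M -> x <= 4 * PI ^ 2 * M.
Proof.
  intros H; assert (P := PI_RGT_0).
  assert (0 < 4 * PI ^ 2) by (assert (0 < PI ^ 2) by (apply pow_lt; auto); lra).
  apply Rmult_le_compat_l with (r := 4 * PI ^ 2) in H; [|lra].
  rewrite <- Rmult_assoc, Rinv_r, Rmult_1_l in H by lra; auto.
Qed.

(** * Interchanging the two variables *)

Lemma refl_coef_transpose m n c k l :
  refl_coef n m (fun i j => c j i) k l = refl_coef m n c l k.
Proof. unfold refl_coef; rewrite Bool.andb_comm; reflexivity. Qed.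

Lemma peval_transpose m n (c : nat -> nat -> C) (z1 z2 : C) :
  peval n m (fun k l => c l k) z2 z1 = peval m n c z1 z2.
Proof.
  unfold peval; rewrite !Csum_csum.
  rewrite (csum_ext _ (fun k => csum (fun l => c l k * (Cpow z1 l * Cpow z2 k)) m)%C).
  - rewrite csum_exchange; apply csum_ext; intros k _.
    etransitivity; [|symmetry; apply Csum_csum].
    apply csum_ext; intros l _; reflexivity.
  - intros k _; etransitivity; [apply Csum_csum|]; apply csum_ext; intros l _.
    change (c l k * (z2 ^ k * z1 ^ l) = c l k * (z1 ^ l * z2 ^ k))%C; ring.
Qed.

Lemma bideg_transpose m n c : bideg m n c -> bideg n m (fun k l => c l k).
Proof. intros (H1 & H2 & H3); repeat split; auto; intros k l H; apply H1; tauto. Qed.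

Lemma is_poly_transpose f : is_poly f -> is_poly (fun z1 z2 => f z2 z1).
Proof.
  intros (a & b & d & H); exists b, a, (fun k l => d l k); intros z1 z2.
  rewrite H, (peval_transpose a b d); reflexivity.
Qed.

Lemma atoral_transpose m n c : atoral m n c -> atoral n m (fun k l => c l k).
Proof.
  intros Hat q Hq (r & Hr & H1) (s & Hs & H2).
  destruct (Hat (fun z1 z2 => q z2 z1)) as [a Ha].
  - apply is_poly_transpose; auto.
  - exists (fun z1 z2 => r z2 z1); split; [apply is_poly_transpose; auto|].
    intros z1 z2; rewrite <- (peval_transpose m n c); apply H1.
  - exists (fun z1 z2 => s z2 z1); split; [apply is_poly_transpose; auto|].
    intros z1 z2; rewrite <- H2, <- (peval_transpose m n (refl_coef m n c)).
    f_equal; apply functional_extensionality; intros k.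
    apply functional_extensionality; intros l; symmetry; apply refl_coef_transpose.
  - exists a; intros z1 z2; apply (Ha z2 z1).
Qed.

Lemma rif_transpose m n (c : nat -> nat -> C) (z1 z2 : C) :
  rif n m (fun k l => c l k) z2 z1 = rif m n c z1 z2.
Proof.
  unfold rif; rewrite (peval_transpose m n c); f_equal.
  rewrite <- (peval_transpose m n (refl_coef m n c)).
  f_equal; apply functional_extensionality; intros k.
  apply functional_extensionality; intros l; apply refl_coef_transpose.
Qed.

Lemma in_Dir_transpose al1 al2 f :
  in_Dir al1 al2 (fun z1 z2 => f z2 z1) -> in_Dir al2 al1 f.
Proof.
  intros (a & H1 & B & HB); exists (fun k l => a l k); split.
  - intros z1 z2 (D1 & D2); destruct (H1 z2 z1 (conj D2 D1)) as ((B' & HB') & Hc); split.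
    + exists B'; intros N; eapply Rle_trans; [|apply (HB' N)].
      unfold Rsum2; rewrite Rsum_exchange; apply sum_Rle; intros k _.
      apply sum_Rle; intros l _; right; ring.
    + intros eps He; destruct (Hc eps He) as (N0 & HN); exists N0; intros N HNN.
      specialize (HN N HNN).
      replace (Csum2 (fun k l => Defs.Cmul (a l k) (Defs.Cmul (Defs.Cpow z1 k) (Defs.Cpow z2 l))) N)
        with (Csum2 (fun k l => Defs.Cmul (a k l) (Defs.Cmul (Defs.Cpow z2 k) (Defs.Cpow z1 l))) N);
        auto.
      exact (peval_transpose N N (fun k l => a l k) z1 z2).
  - exists B; intros N; eapply Rle_trans; [|apply (HB N)].
    unfold Rsum2; rewrite Rsum_exchange; apply sum_Rle; intros k _.
    apply sum_Rle; intros l _; right; unfold weight; ring.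
Qed.

Theorem theorem9p1 :
  forall (m n : nat) (c : nat -> nat -> CC),
    bideg m n c ->
    (forall z1 z2, inD2 z1 z2 -> peval m n c z1 z2 <> C0) ->
    atoral m n c ->
    forall pp : R, 0 < pp ->
      (forall g : CC -> CC -> CC, is_dz1 (rif m n c) g -> in_Hp pp g ->
         in_Dir pp 0 (rif m n c)) /\
      (forall g : CC -> CC -> CC, is_dz2 (rif m n c) g -> in_Hp pp g ->
         in_Dir 0 pp (rif m n c)).
Proof.
  intros m n c Hbd Hn Hat p Hp; split; intros g Hg (_ & M & HM).
  - assert (Hst := stable_of_atoral m n c Hbd Hn Hat).
    apply in_Dir_ext with (phi m n c); [intros; symmetry; apply rif_phi|].
    apply in_Dir_of_bound; auto; intros Hp1.
    exists (4 * PI ^ 2 * M); intros r Hr; apply four_pi_sq_bound.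
    assert (HF := gfun_cont2 m n c p r Hst ltac:(lra) Hr).
    (* The estimate integrates over [z1] for fixed [z2], whereas [in_Hp] has the [z2] integral
       inside. *)
    rewrite <- (RInt_Fubini (gfun m n c p r)), <- Defs_RInt_iterated by auto.
    eapply Rle_trans; [|apply (HM r Hr)]; right; f_equal.
    f_equal; apply functional_extensionality; intros t1.
    f_equal; apply functional_extensionality; intros t2.
    unfold gfun; rewrite (dphi_unique m n c (rif m n c) (polar r t1) (polar r t2)
      (g (polar r t1) (polar r t2)) Hst);
      [reflexivity|intros; apply rif_phi|split; apply polar_inD; auto|].
    apply Hg; split; apply polar_inD; auto.
  (* The second half is the first one for the transposed coefficients. The differentiated variable
     [z2] is already that of the inner integral in [in_Hp], so the order of integration stays. *)
  - set (c' := fun k l => c l k).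
    assert (Hn' : forall z1 z2, inD2 z1 z2 -> peval n m c' z1 z2 <> C0).
    { intros z1 z2 (D1 & D2); unfold c'; rewrite (peval_transpose m n c).
      apply Hn; split; auto. }
    assert (Hst := stable_of_atoral n m c' (bideg_transpose m n c Hbd) Hn'
      (atoral_transpose m n c Hat)).
    assert (E : forall z2 z1, rif m n c z1 z2 = phi n m c' z2 z1).
    { intros z2 z1; rewrite <- rif_phi; symmetry; apply rif_transpose. }
    apply in_Dir_transpose.
    apply in_Dir_ext with (phi n m c'); [intros; symmetry; apply E|].
    apply in_Dir_of_bound; auto; intros Hp1.
    exists (4 * PI ^ 2 * M); intros r Hr; apply four_pi_sq_bound.
    assert (HF := gfun_cont2 n m c' p r Hst ltac:(lra) Hr).
    rewrite <- (Defs_RInt_iterated (fun t2 t1 => gfun n m c' p r t1 t2)) by (apply cont2_swap; auto).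
    eapply Rle_trans; [|apply (HM r Hr)]; right; f_equal.
    f_equal; apply functional_extensionality; intros t1.
    f_equal; apply functional_extensionality; intros t2.
    unfold gfun; rewrite (dphi_unique n m c' (fun z2 z1 => rif m n c z1 z2)
      (polar r t2) (polar r t1) (g (polar r t1) (polar r t2)) Hst);
      [reflexivity|intros; apply E|split; apply polar_inD; auto|].
    apply (Hg (polar r t1) (polar r t2)); split; apply polar_inD; auto.
Qed.
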